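(* Let $T$ be an indeterminate string of length $n$ with $k$ non-solid symbols. The shortest cover of $T$ among all $\odot$-prefixes of $T$ (i.e., the shortest solid string that is both a $\odot$-prefix of $T$ and a cover of $T$) can be computed in $\mathcal{O}(nk^4)$ time.
   Context: An indeterminate string (i-string) $T$ over a finite alphabet $\Sigma$ is a sequence of nonempty subsets of $\Sigma$; singleton positions are solid, others non-solid (given as bit vectors of size $|\Sigma|$, with $2\le|\Sigma|\le n$). Two i-strings $U,V$ match ($U\approx V$) if $|U|=|V|$ and $U[i]\cap V[i]\ne\emptyset$ for all $i$. $U$ occurs in $T$ at $j$ if $U\approx T[j..j+|U|-1]$; $\mathit{Occ}(U,T)$ is the set of occurrences. For an i-string $U$ of length $m$ and $i\in\mathit{Occ}(U,T)$, $U\odot i$ denotes $U[1]\cap T[i],\ldots,U[m]\cap T[i+m-1]$. A $\odot$-prefix of $T$ is a solid string $S$ with $S=T[1..|S|]\odot i$ for some position $i$. A cover of $T$ is a solid string $S$ such that every position $i$ of $T$ satisfies $\mathit{Occ}(S,T)\cap\{i-|S|+1,\ldots,i\}\ne\emptyset$. *)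

(* Defs.v *)
From mathcomp Require Import all_boot.

Set Implicit Arguments.
Unset Strict Implicit.
Unset Printing Implicit Defensive.

(** * Indeterminate strings

    The alphabet is ['I_s]; an indeterminate string is a sequence of nonempty
    subsets of it.  Positions are numbered from 0. *)

Section IStrings.

Variable s : nat.
Implicit Types (T U V : seq {set 'I_s}) (u : seq 'I_s) (X : {set 'I_s}).

Definition istring T : bool := set0 \notin T.

Definition solid X : bool := #|X| == 1.

Definition nonsolids T : seq {set 'I_s} := [seq X <- T | ~~ solid X].

Definition of_solid u : seq {set 'I_s} := [seq [set a] | a <- u].

(* [all2] is false on sequences of different sizes. *)
Definition imatch U V : bool := all2 (fun X Y => X :&: Y != set0) U V.

Definition factor T (j m : nat) : seq {set 'I_s} := take m (drop j T).

Definition occ U T (j : nat) : bool :=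
  (j + size U <= size T) && imatch U (factor T j (size U)).

Definition odot U T (i : nat) : seq {set 'I_s} :=
  [seq XY.1 :&: XY.2 | XY <- zip U (factor T i (size U))].

(* [odot] is meaningful only at an occurrence, hence the [occ] conjunct. *)
Definition odot_prefix T u : Prop :=
  size u <= size T /\
  exists i, let P := take (size u) T in
    occ P T i /\ of_solid u = odot P T i.

(* [i < j + size u] stands for [i - |u| + 1 <= j], a bound that may be
   negative. *)
Definition cover T u : Prop :=
  forall i, i < size T ->
    exists j, [/\ i < j + size u, j <= i & occ (of_solid u) T j].

Definition odot_prefix_cover T u : Prop := odot_prefix T u /\ cover T u.

(* An indeterminate string need not have any solid cover; [None] reports that
   no odot-prefix is a cover. *)
Definition shortest_odot_prefix_cover T (A : option (seq 'I_s)) : Prop :=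
  match A with
  | Some u => odot_prefix_cover T u /\
      forall u', odot_prefix_cover T u' -> size u <= size u'
  | None => forall u, ~ odot_prefix_cover T u
  end.

End IStrings.

(** * Word RAM

    Structured programs over finitely many registers and a random-access
    memory, both holding [w]-bit words.  Arithmetic is modulo [2 ^ w]; each
    constant, register access, memory access, arithmetic operation, assignment
    and branch costs one unit of time. *)

Inductive binop := OpAdd | OpSub | OpMul | OpDiv | OpMod | OpEq | OpLt.

Inductive expr :=
  | Const of nat
  | Reg of nat
  | Read of expr
  | Bin of binop & expr & expr.

Inductive cmd :=
  | Skip
  | Assign of nat & expr
  | Store of expr & expr
  | Seq of cmd & cmd
  | If of expr & cmd & cmd
  | While of expr & cmd.

Record state := State { regs : nat -> nat; mem : nat -> nat }.

Definition upd (f : nat -> nat) (x v : nat) : nat -> nat :=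
  fun y => if y == x then v else f y.

Definition set_reg (st : state) (x v : nat) : state :=
  State (upd (regs st) x v) (mem st).

Definition set_mem (st : state) (a v : nat) : state :=
  State (regs st) (upd (mem st) a v).

Section Semantics.

Variable w : nat.

Definition wrap (v : nat) : nat := v %% 2 ^ w.

(* Division by zero yields 0, and [x %% 0 = x]. *)
Definition eval_op (o : binop) (x y : nat) : nat :=
  match o with
  | OpAdd => wrap (x + y)
  | OpSub => wrap (x + (2 ^ w - y))
  | OpMul => wrap (x * y)
  | OpDiv => x %/ y
  | OpMod => x %% y
  | OpEq => wrap (x == y)
  | OpLt => wrap (x < y)
  end.

Fixpoint eval (e : expr) (st : state) : nat :=
  match e with
  | Const v => wrap v
  | Reg x => regs st x
  | Read e1 => mem st (eval e1 st)
  | Bin o e1 e2 => eval_op o (eval e1 st) (eval e2 st)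
  end.

Fixpoint expr_cost (e : expr) : nat :=
  match e with
  | Const _ | Reg _ => 1
  | Read e1 => (expr_cost e1).+1
  | Bin _ e1 e2 => (expr_cost e1 + expr_cost e2).+1
  end.

(* [exec c st t st']: started in [st], the program [c] halts in [st'] after
   exactly [t] units of time. *)
Inductive exec : cmd -> state -> nat -> state -> Prop :=
  | ExecSkip st : exec Skip st 1 st
  | ExecAssign x e st :
      exec (Assign x e) st (expr_cost e).+1 (set_reg st x (eval e st))
  | ExecStore ea ev st :
      exec (Store ea ev) st (expr_cost ea + expr_cost ev).+1
           (set_mem st (eval ea st) (eval ev st))
  | ExecSeq c1 c2 st t1 st1 t2 st2 :
      exec c1 st t1 st1 -> exec c2 st1 t2 st2 ->
      exec (Seq c1 c2) st (t1 + t2) st2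
  | ExecIfTrue e c1 c2 st t st1 :
      eval e st != 0 -> exec c1 st t st1 ->
      exec (If e c1 c2) st (expr_cost e + t).+1 st1
  | ExecIfFalse e c1 c2 st t st1 :
      eval e st = 0 -> exec c2 st t st1 ->
      exec (If e c1 c2) st (expr_cost e + t).+1 st1
  | ExecWhileTrue e c st t1 st1 t2 st2 :
      eval e st != 0 -> exec c st t1 st1 -> exec (While e c) st1 t2 st2 ->
      exec (While e c) st (expr_cost e + t1 + t2).+1 st2
  | ExecWhileFalse e c st :
      eval e st = 0 -> exec (While e c) st (expr_cost e).+1 st.

End Semantics.

(** * Input and output conventions

    The memory initially contains [n = size T], the alphabet size [s], one word
    per position of [T], and then the bit vectors of the non-solid symbols of
    [T], from left to right, one bit per word; all else is zero.  The word of a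
    solid position is its letter; the word of the [r]-th non-solid position,
    counting from 0, is [s + r]. *)

Section Encoding.

Variable s : nat.
Implicit Types (T : seq {set 'I_s}) (X : {set 'I_s}).

Definition bit_vector X : seq nat :=
  [seq nat_of_bool (a \in X) | a <- enum 'I_s].

Definition solid_letter X : nat := head 0 [seq val a | a <- enum X].

Definition symbol_code T (i : nat) : nat :=
  let X := nth set0 T i in
  if solid X then solid_letter X else s + size (nonsolids (take i T)).

Definition encode T : seq nat :=
  [:: size T; s] ++ mkseq (symbol_code T) (size T)
    ++ flatten [seq bit_vector X | X <- nonsolids T].

Definition init_state T : state := State (fun=> 0) (nth 0 (encode T)).

Definition encode_answer (A : option (seq 'I_s)) : seq nat :=
  if A is Some u then [:: 1, size u & [seq val a | a <- u]] else [:: 0].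

(* The answer is read from the beginning of the final memory. *)
Definition outputs (st : state) (A : option (seq 'I_s)) : Prop :=
  mkseq (mem st) (size (encode_answer A)) = encode_answer A.

End Encoding.

(* Main.v *)
Require Import Defs.
From mathcomp Require Import all_boot zify.

Set Implicit Arguments.
Unset Strict Implicit.
Unset Printing Implicit Defensive.

(** Call two positions i equivalent at length m when they yield the same
    letters [T[q] & T[i + q]] at the non-solid positions q < m of T, all of them
    being singletons.  The odot-prefixes of length m are the equivalence classes
    having a member i with [T[0..m)] matching at i, since the solid positions of
    [T[0..m)] leave no choice.  For m = 1, .., n we keep, for every class, the
    doubly linked list of the occurrences of its string, its maximal gap (with
    the end of T as a sentinel), and the number of classes with each gap.  If no
    length below m works then every gap is at least m, so length m works iff the
    number of classes with gap m is not zero.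

    When the new position m - 1 is solid, passing to m only deletes the
    positions j where the prefix of T matches exactly m - 1 symbols; each j is
    deleted at one m only.  When it is non-solid (k times), the classes are
    refined and the lists rebuilt.  A position j without non-solid symbols at the
    j + q occurs in its own class only; the other ones are of the form q' - q,
    so there are at most k^2 of them, and each can be tested against all classes
    at a cost O(k) per class.  A rebuilding costs O(n k^3), hence O(n k^4) in all.

    The longest match of a prefix of T at j is found with k + 1 Z-arrays of the
    code string of T, one per start of a solid block: distinct non-solid
    positions have distinct codes, so a match of codes stops at a non-solid
    symbol, at most 2k times per j. *)

(** * Programs with arrays *)

(** Every gap is at least m when no smaller length works, because shortening the length by one only
    enlarges the occurrence sets, and a larger set has no larger gap: a class with a member matching
    m symbols and a gap below m would make m - 1 work. A class without such a member yields no
    odot-prefix; recording n + 1 as its gap keeps it out of every count that is inspected. Machine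
    words wrap around and the memory is flat, so the algorithm is verified in a small language over
    natural numbers and arrays, whose compilation preserves the running time exactly. This needs one
    number D = 2n + 20 above all stored values and a syntactic bound D ^ 16 on intermediate values.
    The 2n comes from the Z-arrays, which run over a suffix of the code string followed by the whole
    string; 20 exceeds all constants and array numbers. As 2n + 20 <= n ^ 5 for n >= 2, words of 80
    log n bits suffice. *)

(* Expressions and commands over registers, the raw input area of the memory
   ([HI], [HSi]) and two-dimensional arrays ([HA r i j] is cell (i, j) of the
   array numbered r).  With rows of length D, array cell (r, i, j) lives at
   address (r D + i) D + j, and the input below D^2. *)
Inductive hexpr :=
  | HC of nat
  | HR of nat
  | HI of hexpr
  | HA of nat & hexpr & hexpr
  | HB of binop & hexpr & hexpr.

Inductive hcmd :=
  | HSkip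
  | HAs of nat & hexpr
  | HSt of nat & hexpr & hexpr & hexpr
  | HSi of hexpr & hexpr
  | HSeq of hcmd & hcmd
  | HIf of hexpr & hcmd & hcmd
  | HWh of hexpr & hcmd.

(** Comparison by [eqn] and the two [!] marks below let simplification compute an update once both
    register numbers are literals, and leave it alone otherwise. *)
Definition up {A} (f : nat -> A) x v y := if eqn y x then v else f y.
Arguments up {A} f !x v !y /.

Record hst := Hst { hr : nat -> nat; hi : nat -> nat;
                    ha : nat -> nat -> nat -> nat }.

Definition sr h x v := Hst (up (hr h) x v) (hi h) (ha h).
Definition upa (f : nat -> nat -> nat) i j v i' j' :=
  if (i' == i) && (j' == j) then v else f i' j'.
Definition sa h r i j v :=
  Hst (hr h) (hi h) (up (ha h) r (upa (ha h r) i j v)).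
Definition si h a v := Hst (hr h) (up (hi h) a v) (ha h).

Lemma upE A (f : nat -> A) x v y : up f x v y = if y == x then v else f y.
Proof. by []. Qed.

(** Register 0 is reserved for the row length D, which is why [cp] shifts all program registers by
    one. *)
Definition cad r i j :=
  Bin OpAdd (Bin OpMul (Bin OpAdd (Bin OpMul (Const r) (Reg 0)) i) (Reg 0)) j.

Fixpoint cp e : expr :=
  match e with
  | HC v => Const v
  | HR x => Reg x.+1
  | HI e => Read (cp e)
  | HA r i j => Read (cad r (cp i) (cp j))
  | HB o a b => Bin o (cp a) (cp b)
  end.

Definition hcost e := expr_cost (cp e).

Fixpoint cc c : cmd :=
  match c with
  | HSkip => Skip
  | HAs x e => Assign x.+1 (cp e)
  | HSt r i j v => Store (cad r (cp i) (cp j)) (cp v)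
  | HSi a v => Store (cp a) (cp v)
  | HSeq a b => Seq (cc a) (cc b)
  | HIf e a b => If (cp e) (cc a) (cc b)
  | HWh e a => While (cp e) (cc a)
  end.

(** Subtraction truncates at 0 here and wraps around in the machine; [ok] admits it only where the
    two agree. *)
Definition hop o x y : nat :=
  match o with
  | OpAdd => x + y
  | OpSub => x - y
  | OpMul => x * y
  | OpDiv => x %/ y
  | OpMod => x %% y
  | OpEq => x == y
  | OpLt => x < y
  end.

Fixpoint hev e h : nat :=
  match e with
  | HC v => v
  | HR x => hr h x
  | HI e => hi h (hev e h)
  | HA r i j => ha h r (hev i h) (hev j h)
  | HB o a b => hop o (hev a h) (hev b h)
  end.

(* A value of degree [d] is below [D ^ d] when all stored values are below
   [D]. *)
Fixpoint dg e :=
  match e with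
  | HC _ | HR _ => 1
  | HI e => dg e
  | HA _ i j => maxn 3 (maxn (dg i) (dg j))
  | HB OpMul a b => dg a + dg b
  | HB _ a b => (maxn (dg a) (dg b)).+1
  end.

(** Array numbers start at 1, so that all arrays lie beyond the first D ^ 2 cells, which are left to
    the input. The bound 20 goes with [20 <= D]. *)
Fixpoint wfe e : bool :=
  match e with
  | HC v => v < 20
  | HR x => true
  | HI e => wfe e
  | HA r i j => [&& 0 < r < 20, wfe i & wfe j]
  | HB o a b => wfe a && wfe b
  end.

Definition wf e := wfe e && (dg e <= 16).

Fixpoint wfc c : bool :=
  match c with
  | HSkip => true
  | HAs x e => wf e
  | HSt r i j v => [&& 0 < r < 20, wf i, wf j & wf v]
  | HSi a v => wf a && wf v
  | HSeq a b => wfc a && wfc b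
  | HIf e a b => [&& wf e, wfc a & wfc b]
  | HWh e a => wf e && wfc a
  end.

Fixpoint mr c : seq nat :=
  match c with
  | HAs x e => [:: x]
  | HSeq a b => mr a ++ mr b
  | HIf e a b => mr a ++ mr b
  | HWh e a => mr a
  | _ => [::]
  end.

Fixpoint ma c : seq nat :=
  match c with
  | HSt r _ _ _ => [:: r]
  | HSeq a b => ma a ++ ma b
  | HIf e a b => ma a ++ ma b
  | HWh e a => ma a
  | _ => [::]
  end.

Fixpoint mi c : bool :=
  match c with
  | HSi _ _ => true
  | HSeq a b => mi a || mi b
  | HIf e a b => mi a || mi b
  | HWh e a => mi a
  | _ => false
  end.

(** What a program can change is read off its text, so facts about all other registers and arrays
    are transported by mere computation. *)
Definition frame (c : hcmd) h h' :=
  [/\ forall x, x \notin mr c -> hr h' x = hr h x,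
      ~~ mi c -> hi h' = hi h
    & forall r, r \notin ma c -> ha h' r = ha h r].

(** * Execution over natural numbers and its simulation by machine words *)

Section Machine.

Variable D : nat.

Fixpoint ok e h : bool :=
  match e with
  | HC _ | HR _ => true
  | HI e => ok e h && (hev e h < D * D)
  | HA r i j => [&& ok i h, ok j h, hev i h < D & hev j h < D]
  | HB OpSub a b => [&& ok a h, ok b h & hev b h <= hev a h]
  | HB _ a b => ok a h && ok b h
  end.

(** Costs are those of the compiled code. Every stored value must be below D: this keeps all later
    expressions within their degree bound. *)
Inductive hexec : hcmd -> hst -> nat -> hst -> Prop :=
  | XSkip h : hexec HSkip h 1 h
  | XAs x e h : ok e h -> hev e h < D ->
      hexec (HAs x e) h (hcost e).+1 (sr h x (hev e h))
  | XSt r i j v h : ok i h -> ok j h -> ok v h ->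
      hev i h < D -> hev j h < D -> hev v h < D ->
      hexec (HSt r i j v) h (hcost (HA r i j) + hcost v)
        (sa h r (hev i h) (hev j h) (hev v h))
  | XSi a v h : ok a h -> ok v h -> hev a h < D * D -> hev v h < D ->
      hexec (HSi a v) h (hcost a + hcost v).+1 (si h (hev a h) (hev v h))
  | XSeq c1 c2 h t1 h1 t2 h2 : hexec c1 h t1 h1 -> hexec c2 h1 t2 h2 ->
      hexec (HSeq c1 c2) h (t1 + t2) h2
  | XIfT e c1 c2 h t h1 : ok e h -> hev e h != 0 -> hexec c1 h t h1 ->
      hexec (HIf e c1 c2) h (hcost e + t).+1 h1
  | XIfF e c1 c2 h t h1 : ok e h -> hev e h = 0 -> hexec c2 h t h1 ->
      hexec (HIf e c1 c2) h (hcost e + t).+1 h1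
  | XWhT e c h t1 h1 t2 h2 : ok e h -> hev e h != 0 -> hexec c h t1 h1 ->
      hexec (HWh e c) h1 t2 h2 ->
      hexec (HWh e c) h (hcost e + t1 + t2).+1 h2
  | XWhF e c h : ok e h -> hev e h = 0 ->
      hexec (HWh e c) h (hcost e).+1 h.

Section Compile.

Variable w : nat.
Hypothesis hD : 20 <= D.
Hypothesis hw : D ^ 16 <= 2 ^ w.

Definition ad r i j := (r * D + i) * D + j.

Definition sim (h : hst) (st : state) : Prop :=
  [/\ regs st 0 = D,
      forall x, regs st x.+1 = hr h x /\ hr h x < D,
      forall a, a < D * D -> Defs.mem st a = hi h a /\ hi h a < D
    & forall r i j, 0 < r < 20 -> i < D -> j < D ->
        Defs.mem st (ad r i j) = ha h r i j /\ ha h r i j < D].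

Lemma expD_le d : d <= 16 -> D ^ d <= 2 ^ w.
Proof. by move=> hd; apply: leq_trans hw; rewrite leq_pexp2l //; lia. Qed.

Lemma wrap_small v d : v < D ^ d -> d <= 16 -> Defs.wrap w v = v.
Proof. by move=> hv /expD_le h; rewrite /Defs.wrap modn_small //; lia. Qed.

Lemma dg_gt0 e : 0 < dg e.
Proof. by elim: e => //= [r i hi' j hj|[] a ha' b hb'] //; lia. Qed.

Lemma ltn_expD v d d' : v < D ^ d -> d <= d' -> v < D ^ d'.
Proof. by move=> h hd; apply: leq_trans h _; rewrite leq_pexp2l //; lia. Qed.

Lemma ad_lt r i j : r < 20 -> i < D -> j < D -> ad r i j < D ^ 3.
Proof. by rewrite /ad !expnS expn0 => hr' hi' hj'; nia. Qed.

Lemma eval_cad r i j h st vi vj : sim h st -> r < 20 ->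
  eval w i st = vi -> eval w j st = vj -> vi < D -> vj < D ->
  eval w (cad r i j) st = ad r vi vj.
Proof.
move=> [h0 _ _ _] hr' /= -> -> hi' hj'; rewrite h0.
have h3 := ad_lt hr' hi' hj'.
have hD1 : D ^ 1 = D by rewrite expn1.
have w1 v : v <= ad r vi vj -> Defs.wrap w v = v.
  by move=> hv; apply: (@wrap_small _ 3) => //; lia.
have w2 : Defs.wrap w r = r by apply: (@wrap_small _ 1) => //; lia.
rewrite w2 (w1 (r * D)) ?(w1 (r * D + vi)) ?(w1 ((r * D + vi) * D)) ?w1 //;
  rewrite /ad; nia.
Qed.

Lemma hop_small o x y dx dy : x < D ^ dx -> y < D ^ dy ->
  0 < dx -> 0 < dy ->
  hop o x y < D ^ (match o with OpMul => dx + dy | _ => (maxn dx dy).+1 end).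
Proof.
move=> hx hy hdx hdy.
have hx' : x < D ^ (maxn dx dy) by apply: ltn_expD hx _; lia.
have hy' : y < D ^ (maxn dx dy) by apply: ltn_expD hy _; lia.
have hp : 0 < D ^ (maxn dx dy) by lia.
have hb (b : bool) : b < D ^ (maxn dx dy).+1.
  by rewrite expnS; case: b => /=; nia.
case: o => //=; try by rewrite expnS; nia.
- by rewrite expnD; nia.
Qed.

(** Subexpressions have no larger degree, so no value reaches 2 ^ w and each [wrap] is the identity,
    except in a subtraction: there x + (2 ^ w - y) with y <= x wraps around exactly once. *)
Lemma eval_cp e h st : sim h st -> wfe e -> dg e <= 16 -> ok e h ->
  eval w (cp e) st = hev e h /\ hev e h < D ^ dg e.
Proof.
move=> R; have [h0 h1 h2 h3] := R.
elim: e => [v|x|e IH|r i IHi j IHj|o a IHa b IHb].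
- move=> /= hv _ _; have : v < D ^ 1 by rewrite expn1; lia.
  by split=> //=; rewrite (@wrap_small _ 1).
- by move=> /= _ _ _; have [-> hx] := h1 x; rewrite expn1.
- move=> /= hw' hd /andP[hok hb]; have [-> _] := IH hw' hd hok.
  have [-> hx] := h2 _ hb; split=> //.
  by apply: (@ltn_expD _ 1); rewrite ?expn1 // dg_gt0.
- move=> /= /and3P[hr' wi unlink_cost] hd /and4P[oi oj bi bj].
  have [ei _] := IHi wi (ltac:(lia)) oi.
  have [ej _] := IHj unlink_cost (ltac:(lia)) oj.
  have := eval_cad R (ltac:(lia) : r < 20) ei ej bi bj; rewrite /= => ->.
  have [-> hx] := h3 r _ _ hr' bi bj; split=> //.
  by apply: (@ltn_expD _ 1); rewrite ?expn1 //; lia.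
- move=> hwf hd hok.
  have {hwf} /andP[wa wb] : wfe a && wfe b by [].
  have [hda hdb] : dg a <= 16 /\ dg b <= 16.
    by move: hd => /=; case: (o); lia.
  have [oa ob osub] : [/\ ok a h, ok b h & o = OpSub -> hev b h <= hev a h].
    by move: hok => /=; case: (o) => [|/and3P[]||||/andP[]|/andP[]] //; case/andP.
  have [ea la] := IHa wa hda oa; have [eb lb] := IHb wb hdb ob.
  have hs := hop_small o la lb (dg_gt0 a) (dg_gt0 b).
  have hdd : match o with OpMul => dg a + dg b | _ => (maxn (dg a) (dg b)).+1 end
             = dg (HB o a b) by case: (o).
  rewrite hdd in hs; split=> //.
  rewrite /= ea eb; have hwr v : v < D ^ dg (HB o a b) -> Defs.wrap w v = v.
    by move=> hv; apply: wrap_small hv hd.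
  case: o hs osub {hd hok hdd} hwr => //= hs osub hwr; try by rewrite hwr.
  rewrite addnBA; last by have := expD_le hdb; lia.
  rewrite addnC -addnBA; last exact: osub.
  rewrite /Defs.wrap -modnDml modnn add0n modn_small //.
  by have := expD_le hda; have := leq_subr (hev b h) (hev a h); lia.
Qed.

(** An address is a numeral in base D whose last two digits are i and j. *)
Lemma ad_inj r i j r' i' j' : i < D -> j < D -> i' < D -> j' < D ->
  (ad r i j == ad r' i' j') = [&& r' == r, i' == i & j' == j].
Proof.
move=> hi1 hj1 hi2 hj2; apply/eqP/and3P => [|[/eqP-> /eqP-> /eqP->] //].
move=> E; have D0 : 0 < D by lia.
have hdm a b : b < D -> (a * D + b) %/ D = a /\ (a * D + b) %% D = b.
  by move=> hb; rewrite divnMDl // modnMDl divn_small // modn_small // addn0.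
have [p1 p2] := hdm (r * D + i) j hj1; have [p3 p4] := hdm (r' * D + i') j' hj2.
have Ej : j' = j by rewrite -p2 -p4; congr (_ %% _); exact: esym E.
have Er : r * D + i = r' * D + i' by rewrite -p1 -p3; congr (_ %/ _); exact: E.
have [p5 p6] := hdm r i hi1; have [p7 p8] := hdm r' i' hi2.
have Ei : i' = i by rewrite -p6 -p8 Er.
have Err : r' = r by rewrite -p5 -p7 Er.
by rewrite Ei Ej Err.
Qed.

Lemma compileP c h t h' st : hexec c h t h' -> wfc c -> sim h st ->
  exists2 st', exec w (cc c) st t st' & sim h' st'.
Proof.
move=> X; elim: X st => {c h t h'} /=.
- by move=> h st _ R; exists st => //; constructor.
- move=> x e h oe le st /andP[w1 w2] R; have [ee _] := eval_cp R w1 w2 oe.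
  exists (set_reg st x.+1 (hev e h)).
    by rewrite -ee; exact: ExecAssign.
  case: R => h0 h1 h2 h3; split=> //= y.
  by have [ey hy] := h1 y; rewrite /upd upE eqSS; case: eqP.
- move=> r i j v h oi oj ov li lj lv st /and4P[hr0 /andP[wi di] /andP[unlink_cost dj] /andP[wv dv]] R.
  have [ei _] := eval_cp R wi di oi; have [ej _] := eval_cp R unlink_cost dj oj.
  have [ev _] := eval_cp R wv dv ov.
  have ea := eval_cad R (ltac:(lia) : r < 20) ei ej li lj.
  exists (set_mem st (ad r (hev i h) (hev j h)) (hev v h)).
    rewrite -ea -ev.
    have -> : hcost (HA r i j) + hcost v =
              (expr_cost (cad r (cp i) (cp j)) + expr_cost (cp v)).+1 by [].
    exact: ExecStore.
  case: R => h0 h1 h2 h3; split=> //=.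
  + move=> a hlt; have [e l] := h2 _ hlt; rewrite /upd; case: eqP => // ea'.
    by move: hlt; rewrite ea' /ad; nia.
  + move=> r' i' j' hr1 hi1 hj1; have [e l] := h3 _ _ _ hr1 hi1 hj1.
    rewrite /upd ad_inj // upE /upa [r == _]eq_sym [hev i h == _]eq_sym.
    rewrite [hev j h == _]eq_sym; case: eqP => [er|_] /=; last by [].
    by rewrite -er; case: ifP.
- move=> a v h oa ov la lv st /andP[/andP[wa da] /andP[wv dv]] R.
  have [ea _] := eval_cp R wa da oa; have [ev _] := eval_cp R wv dv ov.
  exists (set_mem st (hev a h) (hev v h)).
    by rewrite -ea -ev; exact: ExecStore.
  case: R => h0 h1 h2 h3; split=> //=.
  + move=> b hlt; have [e l] := h2 _ hlt; rewrite /upd upE; by case: eqP.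
  + move=> r' i' j' hr1 hi1 hj1; have [e l] := h3 _ _ _ hr1 hi1 hj1.
    rewrite /upd; case: eqP => // ea'.
    by move: la; rewrite -ea' /ad; nia.
- move=> c1 c2 h t1 h1 t2 h2 _ I1 _ I2 st /andP[w1 w2] R.
  have [st1 X1 R1] := I1 _ w1 R; have [st2 X2 R2] := I2 _ w2 R1.
  by exists st2 => //; exact: ExecSeq X1 X2.
- move=> e c1 c2 h t h1 oe ne _ I1 st /and3P[/andP[we de] w1 w2] R.
  have [ee _] := eval_cp R we de oe; have [st1 X1 R1] := I1 _ w1 R.
  by exists st1 => //; apply: ExecIfTrue => //; rewrite ee.
- move=> e c1 c2 h t h1 oe ne _ I1 st /and3P[/andP[we de] w1 w2] R.
  have [ee _] := eval_cp R we de oe; have [st1 X1 R1] := I1 _ w2 R.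
  by exists st1 => //; apply: ExecIfFalse => //; rewrite ee.
- move=> e c h t1 h1 t2 h2 oe ne _ I1 _ I2 st /andP[/andP[we de] w1] R.
  have [ee _] := eval_cp R we de oe; have [st1 X1 R1] := I1 _ w1 R.
  have [|st2 X2 R2] := I2 st1 _ R1; first by rewrite /wf we de.
  by exists st2 => //; apply: ExecWhileTrue X1 X2; rewrite ee.
- move=> e c h oe ne st /andP[/andP[we de] w1] R.
  have [ee _] := eval_cp R we de oe.
  by exists st => //; apply: ExecWhileFalse; rewrite ee.
Qed.

End Compile.

Lemma hexec_frame c h t h' : hexec c h t h' -> frame c h h'.
Proof.
elim=> {c h t h'}; rewrite /frame /=; try by split.
- move=> x e h _ _; split=> // y; rewrite inE upE => /negPf.
  by move=> ->.
- move=> r i j v h *; split=> // y; rewrite inE upE => /negPf.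
  by move=> ->.
- move=> c1 c2 h t1 h1 t2 h2 _ [a1 a2 a3] _ [b1 b2 b3]; split=> x.
  + by rewrite mem_cat negb_or => /andP[? ?]; rewrite b1 // a1.
  + by move: x; rewrite negb_or => /andP[? ?]; rewrite b2 // a2.
  + by rewrite mem_cat negb_or => /andP[? ?]; rewrite b3 // a3.
- move=> e c1 c2 h t h1 _ _ _ [a1 a2 a3]; split=> x.
  + by rewrite mem_cat negb_or => /andP[? ?]; rewrite a1.
  + by move: x; rewrite negb_or => /andP[? ?]; rewrite a2.
  + by rewrite mem_cat negb_or => /andP[? ?]; rewrite a3.
- move=> e c1 c2 h t h1 _ _ _ [a1 a2 a3]; split=> x.
  + by rewrite mem_cat negb_or => /andP[? ?]; rewrite a1.
  + by move: x; rewrite negb_or => /andP[? ?]; rewrite a2.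
  + by rewrite mem_cat negb_or => /andP[? ?]; rewrite a3.
- move=> e c h t1 h1 t2 h2 _ _ _ [a1 a2 a3] _ [b1 b2 b3]; split=> x.
  + by move=> ?; rewrite b1 // a1.
  + by rewrite b2 // a2.
  + by move=> ?; rewrite b3 // a3.
Qed.

(** * Total correctness with time bounds *)

Definition runs c h B (Q : hst -> Prop) :=
  exists t h', [/\ hexec c h t h', t <= B & Q h'].

Lemma runs_weak c h B B' Q : runs c h B Q -> B <= B' -> runs c h B' Q.
Proof.
by move=> [t [h' [X l q]]] hB; exists t, h'; split=> //; apply: leq_trans l hB.
Qed.

(** The frame of the program is handed over along with its postcondition, so specifications need
    only mention what changes. *)
Lemma runs_post c h B (Q Q' : hst -> Prop) :
  runs c h B Q -> (forall h', frame c h h' -> Q h' -> Q' h') -> runs c h B Q'.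
Proof.
move=> [t [h' [X l q]]] hQ; exists t, h'; split=> //; apply: hQ q.
exact: hexec_frame X.
Qed.

Lemma runs_seq c1 c2 h B1 B2 Q :
  runs c1 h B1 (fun h1 => runs c2 h1 B2 Q) -> runs (HSeq c1 c2) h (B1 + B2) Q.
Proof.
move=> [t1 [h1 [X1 l1 [t2 [h2 [X2 l2 q]]]]]]; exists (t1 + t2), h2; split=> //.
  exact: XSeq X1 X2.
exact: leq_add.
Qed.

Lemma runs_seqc c1 c2 h B1 B2 (P Q : hst -> Prop) :
  runs c1 h B1 P ->
  (forall h1, frame c1 h h1 -> P h1 -> runs c2 h1 B2 Q) ->
  runs (HSeq c1 c2) h (B1 + B2) Q.
Proof. by move=> r1 r2; apply: runs_seq; apply: runs_post r1 _. Qed.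

Lemma runs_skip h (Q : hst -> Prop) : Q h -> runs HSkip h 1 Q.
Proof. by move=> q; exists 1, h; split=> //; constructor. Qed.

Lemma runs_as x e h (Q : hst -> Prop) : ok e h -> hev e h < D ->
  Q (sr h x (hev e h)) -> runs (HAs x e) h (hcost e).+1 Q.
Proof. by move=> o l q; do 2 eexists; split; [exact: XAs|by []|by []]. Qed.

Lemma runs_st r i j v h (Q : hst -> Prop) : ok i h -> ok j h -> ok v h ->
  hev i h < D -> hev j h < D -> hev v h < D ->
  Q (sa h r (hev i h) (hev j h) (hev v h)) ->
  runs (HSt r i j v) h (hcost (HA r i j) + hcost v) Q.
Proof. by move=> *; do 2 eexists; split; [exact: XSt|by []|by []]. Qed.

Lemma runs_si a v h (Q : hst -> Prop) : ok a h -> ok v h ->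
  hev a h < D * D -> hev v h < D ->
  Q (si h (hev a h) (hev v h)) -> runs (HSi a v) h (hcost a + hcost v).+1 Q.
Proof. by move=> *; do 2 eexists; split; [exact: XSi|by []|by []]. Qed.

Lemma runs_if e c1 c2 h B1 B2 (Q : hst -> Prop) : ok e h ->
  (hev e h != 0 -> runs c1 h B1 Q) -> (hev e h = 0 -> runs c2 h B2 Q) ->
  runs (HIf e c1 c2) h (hcost e + (B1 + B2)).+1 Q.
Proof.
move=> oe r1 r2; have [e0|e0] := eqVneq (hev e h) 0.
- have [t [h' [X l q]]] := r2 e0; do 2 eexists; split; [exact: XIfF X|lia|by []].
- have [t [h' [X l q]]] := r1 e0; do 2 eexists; split; [exact: XIfT X|lia|by []].
Qed.

Lemma runs_ifT e c1 c2 h B (Q : hst -> Prop) : ok e h -> hev e h != 0 ->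
  runs c1 h B Q -> runs (HIf e c1 c2) h (hcost e + B).+1 Q.
Proof.
by move=> oe e0 [t [h' [X l q]]]; do 2 eexists; split; [exact: XIfT X|lia|].
Qed.

Lemma runs_ifF e c1 c2 h B (Q : hst -> Prop) : ok e h -> hev e h = 0 ->
  runs c2 h B Q -> runs (HIf e c1 c2) h (hcost e + B).+1 Q.
Proof.
by move=> oe e0 [t [h' [X l q]]]; do 2 eexists; split; [exact: XIfF X|lia|].
Qed.

(** The potential pays for the test and the body of every round, so it bounds the total time and
    proves termination at once. The cost B of a round may depend on the state. *)
Lemma runs_whilep e c (I : hst -> Prop) (pot : hst -> nat) (Q : hst -> Prop) h :
  I h ->
  (forall h, I h -> ok e h) ->
  (forall h, I h -> hev e h != 0 -> exists B,
     runs c h B (fun h' => I h' /\ pot h' + B + (hcost e).+1 <= pot h)) ->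
  (forall h, I h -> hev e h = 0 -> Q h) ->
  runs (HWh e c) h (pot h + (hcost e).+1) Q.
Proof.
move=> Ih oe body exit; move: {-1}(pot h) (leqnn (pot h)) => N.
elim: N {-2}N (leqnn N) h Ih => [|M IH] N lN h Ih lp.
  have [e0|e0] := eqVneq (hev e h) 0.
    exists (hcost e).+1, h; split; [exact: XWhF (oe _ Ih) e0|lia|exact: exit].
  by have [B [t [h' [_ _ [_]]]]] := body _ Ih e0; lia.
have [e0|e0] := eqVneq (hev e h) 0.
  exists (hcost e).+1, h; split; [exact: XWhF (oe _ Ih) e0|lia|exact: exit].
have [B [t [h' [X l [Ih' hp]]]]] := body _ Ih e0.
have [|t' [h2 [X2 l2 q]]] := IH (pot h') _ h' Ih' (leqnn _); first lia.
exists (hcost e + t + t').+1, h2; split=> //; last lia.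
exact: XWhT (oe _ Ih) e0 X X2.
Qed.

(** The bound [e] is evaluated anew before every round. The increment costs 4 and the test
    [hcost e + 3], whence the 7 per round in the rules below. *)
Definition For x lo e body :=
  HSeq (HAs x lo)
    (HWh (HB OpLt (HR x) e) (HSeq body (HAs x (HB OpAdd (HR x) (HC 1))))).

(* [phi] is an amortizing potential. *)
Lemma runs_forp x lo e body (I : nat -> hst -> Prop) (phi : hst -> nat) a b
    (f : nat -> nat) h (Q : hst -> Prop) :
  ok lo h -> hev lo h = a -> a <= b -> b < D ->
  I a (sr h x a) ->
  (forall i h, a <= i <= b -> I i h -> hr h x = i -> ok e h /\ hev e h = b) ->
  (forall i h, a <= i < b -> I i h -> hr h x = i ->
     exists B, runs body h B (fun h' => [/\ hr h' x = i, I i.+1 (sr h' x i.+1)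
       & phi (sr h' x i.+1) + B <= phi h + f i])) ->
  (forall h, I b h -> hr h x = b -> Q h) ->
  runs (For x lo e body) h
    (hcost lo + hcost e + 4 + phi (sr h x a)
     + \sum_(a <= i < b) (f i + hcost e + 7)) Q.
Proof.
move=> ol el ab bD I0 oe body_ok exit.
set S := \sum_(a <= i < b) _.
have -> : hcost lo + hcost e + 4 + phi (sr h x a) + S =
  (hcost lo).+1 + (phi (sr h x a) + S + (hcost (HB OpLt (HR x) e)).+1).
  by rewrite /hcost /=; lia.
apply: runs_seq; apply: runs_as => //; first by rewrite el; lia.
rewrite el.
pose J h := a <= hr h x <= b /\ I (hr h x) h.
pose pot h := phi h + \sum_(hr h x <= i < b) (f i + hcost e + 7).
have hxa : hr (sr h x a) x = a by rewrite /= upE eqxx.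
have -> : phi (sr h x a) + S = pot (sr h x a) by rewrite /pot hxa.
apply: (@runs_whilep _ _ J pot).
- by split; rewrite hxa // leqnn.
- by move=> h1 [hab Ih]; have [o _] := oe _ _ hab Ih erefl; rewrite /= o.
- move=> h1 [hab Ih]; have [o ee] := oe _ _ hab Ih erefl.
  rewrite /= ee; case: ltnP => // hlt _.
  have hab' : a <= hr h1 x < b by lia.
  have [B RB] := body_ok (hr h1 x) h1 hab' Ih erefl.
  exists (B + 4); apply: runs_seq; apply: runs_post RB _.
  move=> h2 _ [ex I2 hphi]; apply: (@runs_weak _ _ 4) => //.
  apply: runs_as => //=; first by rewrite ex; lia.
  rewrite ex addn1.
  have hx2 : hr (sr h2 x (hr h1 x).+1) x = (hr h1 x).+1 by rewrite /= upE eqxx.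
  split; first by split; rewrite ?hx2 //; lia.
  by rewrite /pot hx2 (big_ltn hlt) /hcost /= -/(hcost e); lia.
- move=> h1 [hab Ih]; have [o ee] := oe _ _ hab Ih erefl.
  rewrite /= ee; case: ltnP => // hlt _; have hb : hr h1 x = b by lia.
  by apply: exit; rewrite -?hb.
Qed.

Lemma runs_for x lo e body (I : nat -> hst -> Prop) a b (f : nat -> nat) h
    (Q : hst -> Prop) :
  ok lo h -> hev lo h = a -> a <= b -> b < D ->
  I a (sr h x a) ->
  (forall i h, a <= i <= b -> I i h -> hr h x = i -> ok e h /\ hev e h = b) ->
  (forall i h, a <= i < b -> I i h -> hr h x = i ->
     runs body h (f i) (fun h' => hr h' x = i /\ I i.+1 (sr h' x i.+1))) ->
  (forall h, I b h -> hr h x = b -> Q h) ->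
  runs (For x lo e body) h
    (hcost lo + hcost e + 4 + \sum_(a <= i < b) (f i + hcost e + 7)) Q.
Proof.
move=> ol el ab bD I0 oe body_ok exit.
have R := @runs_forp x lo e body I (fun=> 0) a b f h Q ol el ab bD I0 oe.
rewrite addn0 in R; apply: R exit => i h1 hi Ih ei.
exists (f i); apply: runs_post (body_ok i h1 hi Ih ei) _ => h2 _ [? ?].
by split.
Qed.

Lemma runs_forc x lo e body (I : nat -> hst -> Prop) a b f h
    (Q : hst -> Prop) :
  ok lo h -> hev lo h = a -> a <= b -> b < D ->
  I a (sr h x a) ->
  (forall i h, a <= i <= b -> I i h -> hr h x = i -> ok e h /\ hev e h = b) ->
  (forall i h, a <= i < b -> I i h -> hr h x = i ->
     runs body h f (fun h' => hr h' x = i /\ I i.+1 (sr h' x i.+1))) ->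
  (forall h, I b h -> hr h x = b -> Q h) ->
  runs (For x lo e body) h
    (hcost lo + hcost e + 4 + (b - a) * (f + hcost e + 7)) Q.
Proof.
move=> *; apply: runs_weak; first exact: (@runs_for _ _ _ _ I a b (fun=> f)).
by rewrite sum_nat_const_nat.
Qed.

End Machine.

(** * The program *)

Declare Scope hcmd_scope.
Delimit Scope hcmd_scope with H.
Notation "a |+| b" := (HB OpAdd a b) (at level 50, left associativity) : hcmd_scope.
Notation "a |-| b" := (HB OpSub a b) (at level 50, left associativity) : hcmd_scope.
Notation "a |*| b" := (HB OpMul a b) (at level 40, left associativity) : hcmd_scope.
Notation "a |%| b" := (HB OpMod a b) (at level 40, left associativity) : hcmd_scope.
Notation "a |<| b" := (HB OpLt a b) (at level 70, no associativity) : hcmd_scope.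
Notation "a |==| b" := (HB OpEq a b) (at level 70, no associativity) : hcmd_scope.
Notation "x ::= e" := (HAs x e) (at level 75, no associativity) : hcmd_scope.
Notation "a ;; b" := (HSeq a b) (at level 80, right associativity) : hcmd_scope.
Coercion HC : nat >-> hexpr.
Local Open Scope hcmd_scope.

(* Registers holding n, s, k, the length m, and the number t of non-solid
   positions below m; then [vJ] a position, [vC] a class, [vF] a flag. *)
Notation vN := 0 (only parsing).
Notation vS := 1 (only parsing).
Notation vK := 2 (only parsing).
Notation vM := 3 (only parsing).
Notation vT := 4 (only parsing).
Notation vJ := 5 (only parsing).
Notation vC := 6 (only parsing).
Notation vR := 7 (only parsing).
Notation vD := 8 (only parsing).
Notation vE := 9 (only parsing).
Notation vOk := 10 (only parsing).
Notation vLo := 11 (only parsing).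
Notation vHi := 12 (only parsing).
Notation vA := 13 (only parsing).
Notation vB := 14 (only parsing).
Notation vI := 15 (only parsing).
Notation vP := 16 (only parsing).
Notation vY := 17 (only parsing).
Notation vL := 18 (only parsing).
Notation vF := 19 (only parsing).

(* Arrays: [rNN] codes of the intersections of non-solid symbols, [rQ] their
   positions, [rZ] Z-arrays, [rPF] lengths of the longest prefix of T matching
   at j, [rBK] and [rBN] positions j bucketed by that length and bucket sizes,
   [rRep] representative of the class of a position (n if it has none), [rBad]
   whether a non-solid symbol is met, [rTbl] and [rStp] the table refining the
   classes and its time stamps (so that it needs no clearing), [rCnt] number of
   classes with a given gap, [rMp] longest match of a member of a class,
   [rLast], [rGap], [rNxt], [rPrv] the occurrence lists. *)
Notation rNN := 1 (only parsing).
Notation rQ := 2 (only parsing).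
Notation rZ := 3 (only parsing).
Notation rPF := 4 (only parsing).
Notation rBK := 5 (only parsing).
Notation rBN := 6 (only parsing).
Notation rRep := 7 (only parsing).
Notation rBad := 8 (only parsing).
Notation rTbl := 9 (only parsing).
Notation rStp := 10 (only parsing).
Notation rCnt := 11 (only parsing).
Notation rMp := 12 (only parsing).
Notation rLast := 13 (only parsing).
Notation rGap := 14 (only parsing).
Notation rNxt := 15 (only parsing).
Notation rPrv := 16 (only parsing).

Notation A1 r j := (HA r (HC 0) j).
Notation St1 r j v := (HSt r (HC 0) j v).

Definition eX e := HI (2 |+| e).
Definition eBit r a := HI (2 |+| HR vN |+| r |*| HR vS |+| a).

(** The result is 0 for an empty intersection, a + 1 for the single letter a, and s + 1 for several
    letters. A solid side reduces the question to an equality or one bit, so a table is needed only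
    for pairs of non-solid symbols. A letter is itself the code of a solid symbol, so this command
    also tests membership of a letter. *)
Definition cInter d u v :=
  HIf (v |<| HR vS)
    (HIf (u |<| HR vS) (d ::= (u |==| v) |*| (v |+| 1))
                      (d ::= eBit (u |-| HR vS) v |*| (v |+| 1)))
    (HIf (u |<| HR vS) (d ::= eBit (v |-| HR vS) u |*| (u |+| 1))
                      (d ::= HA rNN (u |-| HR vS) (v |-| HR vS))).

Definition cPre :=
  vN ::= HI 0;; vS ::= HI 1;;
  For vJ 0 (HR vN)
    (HIf (eX (HR vJ) |<| HR vS) HSkip
       (St1 rQ (HR vK) (HR vJ);; vK ::= HR vK |+| 1)).

Definition cNN :=
  For vI 0 (HR vK) (For vJ 0 (HR vK) (
    vD ::= 0;;
    For vA 0 (HR vS)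
      (HIf (eBit (HR vI) (HR vA) |*| eBit (HR vJ) (HR vA))
        (HIf (HR vD) (vD ::= HR vS |+| 1) (vD ::= HR vA |+| 1))
        HSkip);;
    HSt rNN (HR vI) (HR vJ) (HR vD))).

(* [vB] is the start a of the pattern, [vE] its index, [vL] and [vR] delimit
   the rightmost known match of a prefix. *)
Definition eV y := eX ((HR vB |+| y) |%| HR vN).

(** The last index, 2n - a, is that of the empty suffix; it is included because common extensions
    may be requested at position n. *)
Definition cZ1 :=
  vL ::= 0;; vR ::= 0;; vF ::= HR vN |+| HR vN |-| HR vB;;
  For vY 1 (HR vF |+| 1)
    (HIf (HA rZ (HR vE) (HR vY |-| HR vL) |+| HR vY |<| HR vR)
       (HSt rZ (HR vE) (HR vY) (HA rZ (HR vE) (HR vY |-| HR vL)))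
       (HIf (HR vR |<| HR vY) (vR ::= HR vY) HSkip;;
        HWh ((HR vR |<| HR vF) |*| (eV (HR vR |-| HR vY) |==| eV (HR vR)))
          (vR ::= HR vR |+| 1);;
        HSt rZ (HR vE) (HR vY) (HR vR |-| HR vY);;
        vL ::= HR vY)).

Definition cZ :=
  For vE 0 (HR vK |+| 1)
    (HIf (HR vE) (vB ::= A1 rQ (HR vE |-| 1) |+| 1) (vB ::= 0);; cZ1).

(* In the string [X[b..n) X[0..n)] of the Z-array of index [e], position [x] of
   the second copy is [n - b + x]; only [n - b] symbols of the first copy count. *)
Definition cLce d e b x :=
  HIf (HA rZ e (HR vN |-| b |+| x) |<| HR vN |-| b)
    (d ::= HA rZ e (HR vN |-| b |+| x)) (d ::= HR vN |-| b).

(** Code comparison stops at p only if the codes at p and j + p differ. If the two symbols still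
    intersect, one of them is non-solid, so one of the two suffixes to be compared next starts right
    behind a non-solid symbol and has a Z-array. *)
Definition cPF1 :=
  cLce vP 0 0 (HR vJ);; vF ::= 1;;
  HWh (HR vF)
    (HIf (HR vJ |+| HR vP |<| HR vN)
       (cInter vD (eX (HR vP)) (eX (HR vJ |+| HR vP));;
        HIf (HR vD)
          (HIf (eX (HR vP) |<| HR vS)
            (cLce vD (eX (HR vJ |+| HR vP) |-| HR vS |+| 1) (HR vJ |+| HR vP |+| 1)
                  (HR vP |+| 1))
            (cLce vD (eX (HR vP) |-| HR vS |+| 1) (HR vP |+| 1)
                  (HR vJ |+| HR vP |+| 1));;
           vP ::= HR vP |+| 1 |+| HR vD)
          (vF ::= 0))
       (vF ::= 0));;
  St1 rPF (HR vJ) (HR vP).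

Definition cPF :=
  St1 rPF 0 (HR vN);; For vJ 1 (HR vN) cPF1.

Definition cBK :=
  For vJ 0 (HR vN)
    (vA ::= A1 rPF (HR vJ);;
     HSt rBK (HR vA) (A1 rBN (HR vA)) (HR vJ);;
     St1 rBN (HR vA) (A1 rBN (HR vA) |+| 1)).

(** A new class is keyed by the old representative and the code at the new position. Representatives
    can be overwritten in place, since the entry of a position is read only in its own round. *)
Definition cRefine :=
  vP ::= HR vM |-| 1;; vT ::= HR vT |+| 1;;
  For vJ 0 (HR vN)
    (HIf (HR vJ |+| HR vP |<| HR vN)
      (HIf (eX (HR vJ |+| HR vP) |<| HR vS) HSkip (St1 rBad (HR vJ) 1);;
       vA ::= A1 rRep (HR vJ);;
       cInter vD (eX (HR vP)) (eX (HR vJ |+| HR vP));;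
       HIf ((HR vA |<| HR vN) |*| (0 |<| HR vD) |*| (HR vD |<| HR vS |+| 1))
         (HIf (HA rStp (HR vA) (HR vD) |==| HR vT)
            (St1 rRep (HR vJ) (HA rTbl (HR vA) (HR vD)))
            (HSt rStp (HR vA) (HR vD) (HR vT);;
             HSt rTbl (HR vA) (HR vD) (HR vJ);;
             St1 rRep (HR vJ) (HR vJ)))
         (St1 rRep (HR vJ) (HR vN)))
      (St1 rRep (HR vJ) (HR vN))).

Definition cMatch :=
  vOk ::= 1;;
  For vR 0 (HR vT)
    (vA ::= A1 rQ (HR vR);;
     cInter vD (eX (HR vA)) (eX (HR vC |+| HR vA));;
     cInter vE (HR vD |-| 1) (eX (HR vJ |+| HR vA));;
     HIf (HR vE) HSkip (vOk ::= 0)).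

(** One loop serves all cases: its range is all of [0, n) when a non-solid symbol is met, otherwise
    just the class of [vJ], or nothing if that class is undefined. *)
Definition cForEach body :=
  vLo ::= A1 rRep (HR vJ);; vHi ::= HR vLo |+| 1;;
  HIf (A1 rBad (HR vJ)) (vLo ::= 0;; vHi ::= HR vN) HSkip;;
  HIf (HR vLo |<| HR vN) HSkip (vHi ::= HR vLo);;
  For vC (HR vLo) (HR vHi)
    (HIf (A1 rRep (HR vC) |==| HR vC)
      (cMatch;; HIf (HR vOk) body HSkip) HSkip).

Definition cAppend :=
  vA ::= A1 rLast (HR vC);;
  HSt rNxt (HR vC) (HR vA) (HR vJ);;
  HSt rPrv (HR vC) (HR vJ) (HR vA);;
  HIf (A1 rGap (HR vC) |<| HR vJ |-| HR vA)
    (St1 rGap (HR vC) (HR vJ |-| HR vA)) HSkip;;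
  St1 rLast (HR vC) (HR vJ).

(** Occurrence 0 needs no insertion, being the initial [rLast] of every class; the end n of T is
    appended last. Gap n + 1 marks a class none of whose members matches m symbols. *)
Definition cBuild :=
  For vJ 0 (HR vN |+| 2) (St1 rCnt (HR vJ) 0);;
  For vC 0 (HR vN)
    (St1 rMp (HR vC) 0;; St1 rLast (HR vC) 0;; St1 rGap (HR vC) 0);;
  For vJ 0 (HR vN)
    (vC ::= A1 rRep (HR vJ);;
     HIf ((HR vC |<| HR vN) |*| (A1 rMp (HR vC) |<| A1 rPF (HR vJ)))
       (St1 rMp (HR vC) (A1 rPF (HR vJ))) HSkip);;
  For vJ 1 (HR vN)
    (HIf (A1 rPF (HR vJ) |<| HR vM) HSkip (cForEach cAppend));;
  vJ ::= HR vN;;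
  For vC 0 (HR vN)
    (HIf (A1 rRep (HR vC) |==| HR vC)
      (cAppend;;
       HIf (A1 rMp (HR vC) |<| HR vM) (St1 rGap (HR vC) (HR vN |+| 1)) HSkip;;
       St1 rCnt (A1 rGap (HR vC)) (A1 rCnt (A1 rGap (HR vC)) |+| 1))
      HSkip).

Definition cSetGap :=
  vE ::= A1 rGap (HR vC);;
  St1 rCnt (HR vE) (A1 rCnt (HR vE) |-| 1);;
  St1 rCnt (HR vD) (A1 rCnt (HR vD) |+| 1);;
  St1 rGap (HR vC) (HR vD).

Definition cUnlink :=
  vA ::= HA rPrv (HR vC) (HR vJ);; vB ::= HA rNxt (HR vC) (HR vJ);;
  HSt rNxt (HR vC) (HR vA) (HR vB);;
  HSt rPrv (HR vC) (HR vB) (HR vA);;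
  HIf (A1 rGap (HR vC) |<| HR vB |-| HR vA)
    (vD ::= HR vB |-| HR vA;; cSetGap) HSkip.

(** The position [vJ] stops matching at length m, so its own class may have lost its last matching
    member; hence the test of [rMp] after the unlinking. *)
Definition cDelete :=
  For vI 0 (A1 rBN (HR vM |-| 1))
    (vJ ::= HA rBK (HR vM |-| 1) (HR vI);;
     cForEach cUnlink;;
     vC ::= A1 rRep (HR vJ);;
     HIf (HR vC |<| HR vN)
       (HIf (A1 rMp (HR vC) |<| HR vM) (vD ::= HR vN |+| 1;; cSetGap) HSkip)
       HSkip).

Definition cMain :=
  vM ::= 1;; vT ::= 0;; vF ::= 0;;
  HWh ((HR vM |<| HR vN |+| 1) |*| (HR vF |==| 0))
    (HIf (eX (HR vM |-| 1) |<| HR vS)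
       (HIf (HR vM |==| 1) cBuild cDelete)
       (cRefine;; cBuild);;
     HIf (A1 rCnt (HR vM)) (vF ::= 1) (vM ::= HR vM |+| 1)).

(** The answer overwrites the very input cells it is computed from, so the letters are first
    collected in the array [rLast], no longer needed as such. *)
Definition cOut :=
  HIf (HR vF)
    (vC ::= 0;;
     HWh ((A1 rRep (HR vC) |==| HR vC) |*| (A1 rGap (HR vC) |==| HR vM) |==| 0)
       (vC ::= HR vC |+| 1);;
     For vP 0 (HR vM)
       (HIf (eX (HR vP) |<| HR vS) (St1 rLast (HR vP) (eX (HR vP)))
         (cInter vD (eX (HR vP)) (eX (HR vC |+| HR vP));;
          St1 rLast (HR vP) (HR vD |-| 1)));;
     For vP 0 (HR vM) (HSi (2 |+| HR vP) (A1 rLast (HR vP)));;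
     HSi 0 1;; HSi 1 (HR vM))
    (HSi 0 0).

Definition cAll := cPre;; cNN;; cZ;; cPF;; cBK;; cMain;; cOut.

Lemma wf_all : wfc cAll.
Proof. by []. Qed.

Local Open Scope hcmd_scope.
Local Open Scope nat_scope.

Ltac vc_step :=
  lazymatch goal with
  | |- runs _ (HSeq _ _) _ _ _ => eapply runs_seq
  | |- runs _ (HAs _ _) _ _ _ => eapply runs_as
  | |- runs _ (HSt _ _ _ _) _ _ _ => eapply runs_st
  | |- runs _ (HSi _ _) _ _ _ => eapply runs_si
  | |- runs _ HSkip _ _ _ => eapply runs_skip
  end.

(* Any code above [s] stands for several letters. *)
Definition lcode (s : nat) (l : seq nat) : nat :=
  match l with [::] => 0 | [:: a] => a.+1 | _ => s.+1 end.

(** * Symbol codes, classes and occurrence lists *)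

Section Algo.

Variables (n s k : nat) (X : nat -> nat) (bt : nat -> nat -> bool).

(** This section knows T only through its codes [X] and the bits [bt] of the non-solid symbols; sets
    return after the program has been verified. *)
Definition ks i := [seq x <- iota 0 i | s <= X x].
Arguments ks : simpl never.
Definition q r := nth 0 (ks n) r.

Definition mb c a : bool := if c < s then c == a else bt (c - s) a.

Lemma ksS i : ks i.+1 = if s <= X i then rcons (ks i) i else ks i.
Proof.
by rewrite /ks -addn1 iotaD filter_cat /= add0n; case: ifP; rewrite ?cats1 ?cats0.
Qed.

(** The list of non-solid positions below i is a prefix of the full one, so the numbering [q] serves
    all prefixes of T. *)
Lemma ks_nth i r : i <= n -> r < size (ks i) -> nth 0 (ks i) r = q r.
Proof.
move=> hi hr; rewrite /q; have -> : n = i + (n - i) by lia.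
by rewrite /ks iotaD filter_cat nth_cat -/(ks i) hr.
Qed.

Definition inter u v := lcode s [seq a <- iota 0 s | mb u a && mb v a].

Lemma interC u v : inter u v = inter v u.
Proof. by rewrite /inter; congr lcode; apply: eq_filter => a; rewrite andbC. Qed.

Lemma inter_solid u v : u < s -> inter u v = if mb v u then u.+1 else 0.
Proof.
move=> hu; rewrite /inter.
rewrite (eq_filter (a2 := fun a => mb v u && (a == u))); last first.
  by move=> a; rewrite {1}/mb hu eq_sym andbC; case: eqP => [->|]; rewrite ?andbF.
case: (mb v u) => /=; last by rewrite filter_pred0.
by rewrite filter_pred1_uniq ?iota_uniq // mem_iota.
Qed.

Lemma inter_le u v : inter u v <= s.+1.
Proof.
rewrite /inter; case E: [seq _ <- _ | _] => [|a [|b l]] //=.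
have : a \in [seq a <- iota 0 s | mb u a && mb v a] by rewrite E inE eqxx.
by rewrite mem_filter mem_iota => /andP[_ /andP[_]]; lia.
Qed.

Lemma inter_neq0 u v :
  inter u v != 0 <-> exists2 a, a < s & mb u a && mb v a.
Proof.
rewrite /inter; split.
  case E: [seq _ <- _ | _] => [|a l] // _.
  have : a \in [seq a <- iota 0 s | mb u a && mb v a] by rewrite E inE eqxx.
  by rewrite mem_filter mem_iota => /andP[h /andP[_ h2]]; exists a.
move=> [a la ha].
have : a \in [seq a <- iota 0 s | mb u a && mb v a].
  by rewrite mem_filter mem_iota ha la.
by case: [seq _ <- _ | _] => [|b [|]].
Qed.

Lemma inter_letter u v b : inter u v = b.+1 -> b < s ->
  forall a, a < s -> mb u a && mb v a = (a == b).
Proof.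
rewrite /inter => E hb a ha.
have := mem_filter (fun a => mb u a && mb v a) a (iota 0 s).
rewrite mem_iota /= add0n ha andbT => <-.
case: [seq _ <- _ | _] E => [|c [|d l]] //=; last by lia.
by move=> [->]; rewrite inE.
Qed.

Lemma lcode_rcons l a : a < s -> lcode s (rcons l a) =
  if lcode s l == 0 then a.+1 else s.+1.
Proof. by case: l => [|b [|c l]]. Qed.

(** * Longest common extensions and longest matching prefixes *)

Definition V a y := X ((a + y) %% n).

(* Longest common prefix of the suffix of [X] at [a], followed by [X], and of
   its own suffix at [y]. *)
Definition isz a y z :=
  [/\ a + y + z <= n + n, forall u, u < z -> V a u = V a (y + u)
    & a + y + z < n + n -> V a z <> V a (y + z)].

(** Take the least z at which the text ends or a mismatch occurs not before R. This justifies
    starting the explicit comparisons of the Z algorithm at R. *)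
Lemma isz_ext a y R : a + R <= n + n -> y <= R ->
  (forall u, y + u < R -> V a u = V a (y + u)) ->
  exists z, isz a y z /\ R <= y + z.
Proof.
move=> h1 h2 h3.
pose P z := (n + n <= a + y + z) || (V a z != V a (y + z)) && (R <= y + z).
have exP : exists z, P z by exists (n + n); rewrite /P; lia.
case: (ex_minnP exP) => z Pz minz.
have hzlt u : u < z -> ~~ P u by move=> hu; apply/negP => /minz; lia.
have hz : a + y + z <= n + n.
  by case: z Pz minz hzlt => [|z] _ _ hzlt; [lia|have := hzlt z (ltnSn z); rewrite /P; lia].
have hR : R <= y + z by case/orP: Pz => [|/andP[]]; lia.
exists z; split=> //; split=> // [u hu|hlt].
  case: (ltnP (y + u) R) => [/h3//|hu2].
  by have := hzlt u hu; rewrite /P hu2 andbT negb_or negbK => /andP[_ /eqP].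
by case/orP: Pz => [|/andP[/eqP]]; first lia.
Qed.

Definition start e := if e is e'.+1 then (q e').+1 else 0.

Definition islce b x e :=
  [/\ b + e <= n, x + e <= n, forall u, u < e -> X (b + u) = X (x + u)
    & b + e < n -> x + e < n -> X (b + e) <> X (x + e)].

(** Beyond n - b symbols the first copy is exhausted and the comparison runs into the second one,
    hence the minimum. If the cut takes effect, the suffix at b has ended and no mismatch is
    claimed. *)
Lemma isz_lce b x z : b <= n -> x <= n -> isz b (n - b + x) z ->
  islce b x (minn z (n - b)).
Proof.
move=> hb hx [z1 z2 z3].
have V1 u : b + u < n -> V b u = X (b + u) by move=> h; rewrite /V modn_small.
have V2 u : x + u < n -> V b (n - b + x + u) = X (x + u).
  move=> h; rewrite /V; have -> : b + (n - b + x + u) = n + (x + u) by lia.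
  by rewrite modnDl modn_small.
split; try lia.
- move=> u hu; rewrite -(V1 u); last lia.
  by rewrite z2 ?V2; lia.
- move=> h1 h2; have hz : minn z (n - b) = z by lia.
  by rewrite hz in h1 h2 *; rewrite -(V1 z h1) -(V2 z h2); apply: z3; lia.
Qed.

(** At p = n the first disjunct holds, so the search always succeeds within its range. *)
Definition pf j := find (fun p => (n <= j + p) || (inter (X p) (X (j + p)) == 0))
  (iota 0 n.+1).

Lemma pfP j m : j <= n ->
  (m <= pf j) <-> (j + m <= n /\ forall y, y < m -> inter (X y) (X (j + y)) != 0).
Proof.
move=> hj; rewrite /pf; set P := fun p => _.
have hP : has P (iota 0 n.+1).
  by apply/hasP; exists n; rewrite ?mem_iota ?leq_addl //= /P; lia.
have hlt : find P (iota 0 n.+1) < n.+1 by rewrite -{2}(size_iota 0 n.+1) -has_find.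
have hat := nth_find 0 hP; rewrite nth_iota // add0n in hat.
have hbef y : y < find P (iota 0 n.+1) -> ~~ P y.
  move=> hy; have := before_find 0 hy; rewrite nth_iota ?add0n; first by move->.
  by lia.
split=> [hm|[h1 h2]].
  split=> [|y hy]; last first.
    by have := hbef y (leq_trans hy hm); rewrite /P negb_or => /andP[].
  case: m hm => [|m] hm; first lia.
  by have := hbef m hm; rewrite /P negb_or => /andP[]; lia.
rewrite leqNgt; apply/negP => h3; move: hat; rewrite {1}/P => /orP[|]; first lia.
by apply/negP; apply: h2.
Qed.

Lemma pf_le j : j <= n -> j + pf j <= n.
Proof. by move=> hj; have [] := (pfP (pf j) hj).1 (leqnn _). Qed.

Definition ispf j p := [/\ j + p <= n, forall y, y < p -> inter (X y) (X (j + y)) != 0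
  & j + p < n -> inter (X p) (X (j + p)) = 0].

Lemma ispfP j p : ispf j p -> pf j = p.
Proof.
move=> [h1 h2 h3]; have hj : j <= n by lia.
apply/eqP; rewrite eqn_leq; apply/andP; split; last by apply/pfP.
rewrite leqNgt; apply/negP => /(pfP _ hj) [h4 h5].
by have := h5 p (ltnSn p); rewrite h3 //; lia.
Qed.

Lemma ks_mono a b : a <= b -> size (ks a) <= size (ks b).
Proof.
move=> h; have -> : b = a + (b - a) by lia.
by rewrite /ks iotaD filter_cat size_cat leq_addr.
Qed.

Definition bk i v := [seq j <- iota 0 i | pf j == v].

Lemma bkS i v : bk i.+1 v = if pf i == v then rcons (bk i v) i else bk i v.
Proof.
by rewrite /bk -addn1 iotaD filter_cat /= add0n; case: ifP; rewrite ?cats1 ?cats0.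
Qed.

Lemma size_bk i v : size (bk i v) <= i.
Proof. by rewrite size_filter -{2}(size_iota 0 i) count_size. Qed.

Arguments bk : simpl never.

(* Two positions are in the same class when their codes [dl r] agree for all
   [r < t]; the class is defined when these codes are singletons.  [occW t c j]
   says that the letters of the class of [c] also fit at [j]. *)
Definition dl r j := if j + q r < n then inter (X (q r)) (X (j + q r)) else 0.
Definition def t j := all (fun r => 0 < dl r j <= s) (iota 0 t).
Definition eqw t i j := all (fun r => dl r i == dl r j) (iota 0 t).
Definition bad t j := has (fun r => (j + q r < n) && (s <= X (j + q r))) (iota 0 t).
Definition occW t c j :=
  all (fun r => (j + q r < n) && mb (X (j + q r)) (dl r c).-1) (iota 0 t).
Arguments def : simpl never.
Arguments eqw : simpl never.
Arguments bad : simpl never.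
Arguments occW : simpl never.

(** * Classes, their representatives and their refinement *)

Lemma allS (P : nat -> bool) t : all P (iota 0 t.+1) = all P (iota 0 t) && P t.
Proof. by rewrite -addn1 iotaD all_cat /= add0n andbT. Qed.

Lemma hasS (P : nat -> bool) t : has P (iota 0 t.+1) = has P (iota 0 t) || P t.
Proof. by rewrite -addn1 iotaD has_cat /= add0n orbF. Qed.

Lemma all_iota (P : nat -> bool) t :
  reflect (forall r, r < t -> P r) (all P (iota 0 t)).
Proof.
apply: (iffP allP) => [h r hr|h r]; first by apply: h; rewrite mem_iota.
by rewrite mem_iota => /andP[_]; rewrite add0n; apply: h.
Qed.

Lemma eqw_refl t i : eqw t i i.
Proof. by apply/all_iota => r _. Qed.

Lemma eqw_sym t i j : eqw t i j = eqw t j i.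
Proof. by rewrite /eqw; apply: eq_all => r; rewrite eq_sym. Qed.

Lemma eqw_trans t i j l : eqw t i j -> eqw t j l -> eqw t i l.
Proof.
move=> /all_iota h1 /all_iota h2; apply/all_iota => r hr.
by rewrite (eqP (h1 r hr)) h2.
Qed.

Lemma dl_range r j : 0 < dl r j -> j + q r < n.
Proof. by rewrite /dl; case: ifP. Qed.

(** Each T[j + q r] is a single letter. As the letter of the class of c fits there, it is that
    letter, which therefore lies in T[q r], and the codes of j and c agree. So such a position has
    only one class to consider. *)
Lemma occ_good t c j : t <= k -> (forall r, r < t -> j + q r < n) -> def t c ->
  occW t c j -> ~~ bad t j -> def t j /\ eqw t c j.
Proof.
move=> tk hj /all_iota dc /all_iota oc /hasPn nb.
have H r : r < t -> dl r j = dl r c.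
  move=> hr; have hjr := hj r hr.
  have := nb r; rewrite mem_iota hr hjr /= -ltnNge => /(_ isT) hx.
  have /andP[d0 d1] := dc r hr; have := oc r hr; rewrite hjr /= /mb hx => /eqP ex.
  have hcr := dl_range d0; rewrite {1}/dl hjr interC inter_solid //.
  move: ex; rewrite {1 2}/dl hcr => ex.
  have hi : inter (X (q r)) (X (c + q r)) = (X (j + q r)).+1.
    by rewrite ex prednK //; move: d0; rewrite /dl hcr.
  have := inter_letter hi hx hx; rewrite eqxx => /andP[-> _].
  by rewrite hi.
split; apply/all_iota => r hr; first by rewrite H //; apply: dc.
by rewrite H.
Qed.

(** Undefined positions are sent to n, so that [f j < n] is the test for being defined. *)
Definition repok t (f : nat -> nat) :=
  (forall j, j < n -> if def t j then [/\ f j < n, def t (f j) & eqw t (f j) j]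
                      else f j = n) /\
  (forall i j, i < n -> j < n -> def t i -> eqw t i j -> f i = f j).

Lemma repok_def t f j : repok t f -> j < n -> (f j < n) = def t j.
Proof. by move=> [h _] /h; case: ifP => _ [] // ->; rewrite ltnn. Qed.

Lemma repok_idem t f j : repok t f -> j < n -> f j < n -> f (f j) = f j.
Proof.
move=> R hj hf; have [h1 h2] := R; have := h1 j hj.
by rewrite -(repok_def R hj) hf => - [h3 h4 h5]; apply: h2.
Qed.

Lemma def_eqw t i j : eqw t i j -> def t i = def t j.
Proof.
move=> /all_iota h; apply/all_iota/all_iota => H r hr.
  by rewrite -(eqP (h r hr)); apply: H.
by rewrite (eqP (h r hr)); apply: H.
Qed.

Lemma defS t j : def t.+1 j = def t j && (0 < dl t j <= s).
Proof. exact: allS. Qed.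

Lemma eqwS t i j : eqw t.+1 i j = eqw t i j && (dl t i == dl t j).
Proof. exact: allS. Qed.

Lemma badS t j : bad t.+1 j = bad t j || (j + q t < n) && (s <= X (j + q t)).
Proof. exact: hasS. Qed.

Lemma repok_eq t f i j : repok t f -> i < n -> j < n -> def t i -> def t j ->
  f i = f j -> eqw t i j.
Proof.
move=> [R1 _] hi hj di dj E.
have := R1 i hi; have := R1 j hj; rewrite di dj -E => - [_ _ h1] [_ _ h2].
by apply: eqw_trans h1; rewrite eqw_sym.
Qed.

Section RefineStep.

Variables (t : nat) (f0 : nat -> nat).
Hypothesis R0 : repok t f0.

(* The new representatives [f], the table [tb] and its stamps [st] once the
   positions below [j] have been refined. *)
Definition refining j (f : nat -> nat) (tb st : nat -> nat -> nat) :=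
  [/\ forall i, j <= i -> f i = f0 i,
      forall i, i < j -> if def t.+1 i then
        [/\ f i <= i, def t.+1 (f i) & eqw t.+1 (f i) i] else f i = n,
      forall i i', i < j -> i' < j -> def t.+1 i -> eqw t.+1 i i' -> f i = f i',
      forall o e, st o e = t.+1 -> exists i, [/\ i < j, def t.+1 i,
        f0 i = o, dl t i = e & f i = tb o e]
    & forall i, i < j -> def t.+1 i ->
        st (f0 i) (dl t i) = t.+1 /\ tb (f0 i) (dl t i) = f i].

Lemma refining_undef j f tb st v : refining j f tb st -> j < n -> ~~ def t.+1 j ->
  (forall i, v i = if i == j then n else f i) -> refining j.+1 v tb st.
Proof.
move=> [r1 r2 r3 r4 r5] hj nd hv; split.
- by move=> i hi; rewrite hv; case: eqP => [|_]; [lia|apply: r1; lia].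
- move=> i hi; rewrite hv; case: eqP => [->|ne]; first by rewrite (negPf nd).
  by apply: r2; lia.
- move=> i i' hi hi' di ei; have di' := di; rewrite (def_eqw ei) in di'.
  have ne : i != j by apply: contraNneq nd => <-.
  have ne' : i' != j by apply: contraNneq nd => <-.
  by rewrite !hv (negPf ne) (negPf ne'); apply: r3 => //; lia.
- move=> o e /r4 [i [h1 h2 h3 h4 h5]]; exists i; split=> //; first lia.
  by rewrite hv; case: eqP => //; lia.
- move=> i hi di; have ne : i != j by apply: contraNneq nd => <-.
  by rewrite hv (negPf ne); apply: r5 => //; lia.
Qed.

(** The stamp certifies an earlier position with the same old class and the same code, hence in the
    same new class; its representative is copied. *)
Lemma refining_old j f tb st v : refining j f tb st -> j < n -> def t.+1 j ->
  st (f0 j) (dl t j) = t.+1 ->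
  (forall i, v i = if i == j then tb (f0 j) (dl t j) else f i) ->
  refining j.+1 v tb st.
Proof.
move=> [r1 r2 r3 r4 r5] hj dj hst hv.
have [i0 [a1 a2 a3 a4 a5]] := r4 _ _ hst.
have E0 : eqw t.+1 i0 j.
  move: (a2) (dj); rewrite eqwS !defS a4 eqxx andbT => /andP[d1 _] /andP[d2 _].
  by apply: repok_eq R0 _ _ d1 d2 a3 => //; lia.
have := r2 i0 a1; rewrite a2 a5 => - [b1 b2 b3].
split.
- by move=> i hi; rewrite hv; case: eqP => [|_]; [lia|apply: r1; lia].
- move=> i hi; rewrite hv; case: eqP => [->|ne]; last by apply: r2; lia.
  by rewrite dj; split=> //; [lia|apply: eqw_trans b3 E0].
- have key i : i < j -> def t.+1 i -> eqw t.+1 i j -> f i = tb (f0 j) (dl t j).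
    move=> hi di ei; rewrite -a5; apply: r3 => //.
    by apply: eqw_trans ei _; rewrite eqw_sym.
  move=> i i' hi hi' di ei; have di' := di; rewrite (def_eqw ei) in di'.
  rewrite !hv; case: (eqVneq i j) => [ej|ne]; case: (eqVneq i' j) => [ej'|ne'] //.
  + by rewrite key //; [lia|rewrite eqw_sym -ej].
  + by rewrite key //; [lia|rewrite -ej'].
  + by apply: r3 => //; lia.
- move=> o e /r4 [i [h1 h2 h3 h4 h5]]; exists i; split=> //; first lia.
  by rewrite hv; case: eqP => //; lia.
- move=> i hi di; rewrite hv; case: (eqVneq i j) => [->|ne] //.
  by apply: r5 => //; lia.
Qed.

(** An earlier position in the new class of j would have left its stamp; as there is none, j founds
    the class and represents it. *)
Lemma refining_new j f tb st v tb' st' : refining j f tb st -> j < n ->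
  def t.+1 j -> st (f0 j) (dl t j) <> t.+1 ->
  (forall i, v i = if i == j then j else f i) ->
  (forall o e, tb' o e = if (o == f0 j) && (e == dl t j) then j else tb o e) ->
  (forall o e, st' o e = if (o == f0 j) && (e == dl t j) then t.+1 else st o e) ->
  refining j.+1 v tb' st'.
Proof.
move=> [r1 r2 r3 r4 r5] hj dj hst hv ht hs'.
have nokey i : i < j -> def t.+1 i -> eqw t.+1 i j -> False.
  move=> hi di ei; have [h1 _] := r5 i hi di; apply: hst.
  move: di ei h1; rewrite eqwS defS => /andP[di _] /andP[e1 /eqP ->].
  by case: R0 => _ R2; rewrite (R2 i j) //; lia.
split.
- by move=> i hi; rewrite hv; case: eqP => [|_]; [lia|apply: r1; lia].
- move=> i hi; rewrite hv; case: eqP => [->|ne]; last by apply: r2; lia.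
  by rewrite dj eqw_refl.
- move=> i i' hi hi' di ei; have di' := di; rewrite (def_eqw ei) in di'.
  rewrite !hv; case: (eqVneq i j) => [ej|ne]; case: (eqVneq i' j) => [ej'|ne'] //.
  + by case: (nokey i') => //; [lia|rewrite eqw_sym -ej].
  + by case: (nokey i) => //; [lia|rewrite -ej'].
  + by apply: r3 => //; lia.
- move=> o e; rewrite hs' ht; case: ifP => [/andP[/eqP-> /eqP->] _|ne].
    by exists j; split; rewrite ?hv ?eqxx.
  move=> /r4 [i [h1 h2 h3 h4 h5]]; exists i; split=> //; first lia.
  by rewrite hv; case: eqP => //; lia.
- move=> i hi di; rewrite hv hs' ht; case: (eqVneq i j) => [->|ne].
    by rewrite !eqxx.
  have hij : i < j by lia.
  have [h1 h2] := r5 i hij di; case: ifP => // /andP[/eqP e1 /eqP e2].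
  by case: hst; rewrite -e1 -e2.
Qed.

End RefineStep.

(** * Occurrences, gaps and linked lists *)

Definition occurs m c j := [&& j < n, m <= pf j & occW (size (ks m)) c j].

(** The end n counts as a right neighbour, so the last gap measures how far the last occurrence has
    to reach. *)
Definition consec (O : nat -> bool) a b :=
  [/\ a < b <= n, O a, (b == n) || O b & forall x, a < x < b -> ~~ O x].

Definition ismaxgap O g := (forall a b, consec O a b -> b - a <= g) /\
  exists a b, consec O a b /\ b - a = g.

Definition linked O (nx pv : nat -> nat) :=
  forall a b, consec O a b -> nx a = b /\ pv b = a.

Definition mpok (f mp : nat -> nat) := forall c, c < n -> f c = c ->
  (forall i, i < n -> f i = c -> pf i <= mp c) /\
  exists i, [/\ i < n, f i = c & pf i = mp c].

Definition pcons (O : nat -> bool) j a b :=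
  [/\ a < b < j, O a, O b & forall x, a < x < b -> ~~ O x].

(** Invariant of list construction: the occurrences below j are linked, [lst] is the last of them
    and [g] the largest gap so far, with 0 standing for no gap yet. *)
Definition plist O j (nx pv : nat -> nat) lst g :=
  [/\ O lst && (lst < j), forall x, lst < x < j -> ~~ O x,
      forall a b, pcons O j a b -> [/\ nx a = b, pv b = a & b - a <= g]
    & (g == 0) && (lst == 0) \/ exists a b, pcons O j a b /\ b - a = g].

Lemma plist_ext O j nx pv nx' pv' lst g : (forall x, nx' x = nx x) ->
  (forall x, pv' x = pv x) -> plist O j nx pv lst g -> plist O j nx' pv' lst g.
Proof.
move=> h1 h2 [p1 p2 p3 p4]; split=> // a b /p3 [x1 x2 x3].
by split; rewrite ?h1 ?h2.
Qed.

Lemma pconsS O j a b : pcons O j.+1 a b <-> pcons O j a b \/ (b = j /\ pcons O j.+1 a j).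
Proof.
split=> [[h1 h2 h3 h4]|[[h1 h2 h3 h4]|[-> //]]].
  by case: (eqVneq b j) => e; [right; subst b; split|left; split] => //; lia.
by split=> //; lia.
Qed.

Lemma plist_skip O j nx pv lst g : ~~ O j -> plist O j nx pv lst g ->
  plist O j.+1 nx pv lst g.
Proof.
move=> nj [p1 p2 p3 p4].
have E a b : pcons O j.+1 a b -> pcons O j a b.
  by case/pconsS => // -[_ [_ _ hj _]]; rewrite hj in nj.
split; first by lia.
- by move=> x hx; case: (eqVneq x j) => [->//|ne]; apply: p2; lia.
- by move=> a b /E /p3.
- case: p4 => [g0|[a [b [h1 h2]]]]; [by left|right].
  by exists a, b; split=> //; apply/pconsS; left.
Qed.

Lemma plist_append (O : nat -> bool) j nx pv lst g : O j -> plist O j nx pv lst g ->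
  plist O j.+1 (fun x => if x == lst then j else nx x)
    (fun x => if x == j then lst else pv x) j (maxn g (j - lst)).
Proof.
move=> oj [/andP[p0 p1] p2 p3 p4].
have E a : pcons O j.+1 a j <-> a = lst.
  split=> [[h1 h2 _ h4]|->].
    case: (ltngtP a lst) => // h; first by have := h4 lst; rewrite h p1 p0 => /(_ isT).
    by have := p2 a; rewrite h h2; case/andP: h1 => -> _ /(_ isT).
  by split=> //; rewrite p1 leqnn.
split.
- by rewrite oj ltnSn.
- by move=> x; lia.
- move=> a b /pconsS[hab|[-> /E ->]]; last first.
    by rewrite !eqxx; split=> //; lia.
  have [x1 x2 x3] := p3 a b hab; case: hab => [h1 h2 h3 h4].
  have -> : (a == lst) = false.
    by apply/eqP => ea; have := p2 b; rewrite -ea h1 h3 => /(_ isT).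
  have -> : (b == j) = false by lia.
  by split=> //; lia.
- right; case: (leqP (j - lst) g) => hg; last first.
    by exists lst, j; split; [apply/E|lia].
  case: p4 => [g0|[a [b [h1 h2]]]]; first by lia.
  by exists a, b; split; [apply/pconsS; left|lia].
Qed.

(** With n as an additional occurrence, closing a list is just one more append. *)
Definition occS m c x := (x == n) || occurs m c x.

Lemma consecP m c a b :
  consec (occurs m c) a b <-> pcons (occS m c) n.+1 a b.
Proof.
have ocn x : occurs m c x -> x < n by case/and3P.
split=> [[h1 h2 h3 h4]|[h1 h2 h3 h4]].
  split; rewrite /occS ?h2 ?orbT //.
  by move=> x hx; rewrite negb_or h4 // andbT; lia.
have oa : occurs m c a by move: h2; rewrite /occS; case: eqP => //; lia.
split=> // x hx; by have := h4 x hx; rewrite negb_or => /andP[].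
Qed.

Lemma count_split (P : nat -> bool) c : c < n ->
  count P (iota 0 n) = count (fun x => (x != c) && P x) (iota 0 n) + P c.
Proof.
move=> hc; have hin : c \in iota 0 n by rewrite mem_iota.
rewrite !(permP (perm_to_rem hin)) /= eqxx add0n addnC; congr (_ + _).
apply: eq_in_count => x; rewrite mem_rem_uniq ?iota_uniq // inE => /andP[-> _].
by [].
Qed.

Lemma consec_ext O O' a b : (forall x, O x = O' x) -> consec O a b -> consec O' a b.
Proof.
by move=> e [h1 h2 h3 h4]; split; rewrite -?e // => x hx; rewrite -e; apply: h4.
Qed.

Lemma ismaxgap_ext O O' g : (forall x, O x = O' x) -> ismaxgap O g -> ismaxgap O' g.
Proof.
move=> e [h1 [a [b [h2 h3]]]]; split.
  by move=> x y /(consec_ext (fun x => esym (e x))) /h1.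
by exists a, b; split=> //; apply: consec_ext h2.
Qed.

Lemma linked_ext O O' nx pv nx' pv' : (forall x, O x = O' x) ->
  (forall x, nx' x = nx x) -> (forall x, pv' x = pv x) ->
  linked O nx pv -> linked O' nx' pv'.
Proof.
move=> e e1 e2 h a b /(consec_ext (fun x => esym (e x))) /h [h1 h2].
by rewrite e1 e2.
Qed.

Lemma ex_prev (O : nat -> bool) j : O 0 -> 0 < j <= n -> (j == n) || O j ->
  exists a, consec O a j.
Proof.
move=> o0 hj oj; have ex : exists a, O a && (a < j) by exists 0; rewrite o0; lia.
case: (ex_maxnP ex (m := j)) => [a|a /andP[h1 h2] h3]; first by lia.
exists a; split=> //; first lia.
by move=> x hx; apply/negP => ox; have := h3 x; rewrite ox /=; lia.
Qed.

Lemma ex_next (O : nat -> bool) j : O j -> j < n -> exists b, consec O j b.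
Proof.
move=> oj hj; have ex : exists b, ((b == n) || O b) && (j < b) by exists n; rewrite eqxx.
case: (ex_minnP ex) => b /andP[h1 h2] h3; exists b; split=> //.
  by have := h3 n; rewrite eqxx hj h2 => ->.
by move=> x hx; apply/negP => ox; have := h3 x; rewrite ox orbT /=; lia.
Qed.

(** Removing j merges its two gaps. Any other pair of neighbours was a pair before, and has neither
    a on its left nor b on its right, so relinking a and b does not disturb it. *)
Lemma consec_del O j a b a' b' : consec O a j -> consec O j b ->
  consec (fun x => O x && (x != j)) a' b' ->
  a' = a /\ b' = b \/ [/\ consec O a' b', a' != a, b' != b, a' != j & b' != j].
Proof.
move=> [h1 h2 h3 h4] [g1 g2 g3 g4] [x1 /andP[x2 x2'] x3 x4].
have b'j : b' != j by case/orP: x3 => [|/andP[]//]; lia.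
have x3' : (b' == n) || O b' by case/orP: x3 => [->//|/andP[->]]; rewrite orbT.
case: (boolP (a' < j < b')) => hj; [left|right].
  split.
  - case: (ltngtP a' a) => // h; first by have := x4 a; rewrite h2 /=; lia.
    by have := h4 a'; rewrite x2; lia.
  - case: (ltngtP b' b) => // h; last by have := x4 b; case/orP: g3 => [|ob]; rewrite ?ob /=; lia.
    by have := g4 b'; case/orP: x3' => [|ob]; rewrite ?ob; lia.
have hc : consec O a' b'.
  split=> // x hx; have := x4 x hx; case: (eqVneq x j) => [ej|_]; last by rewrite andbT.
  by lia.
split=> //.
- apply/eqP => e; subst a'; have := x4 j; have : b' < j \/ j < b' by lia.
  by case=> h; [case/orP: x3' => [|ob]; [lia|have := h4 b'; rewrite ob; lia]|lia].
- apply/eqP => e; subst b'; have : a' < j \/ j < a' by lia.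
  by case=> h; [lia|have := g4 a'; rewrite x2; lia].
Qed.

(** The merged gap exceeds the two that vanish, so an old maximum is either attained elsewhere or
    surpassed. Hence maximal gaps never have to be recomputed. *)
Lemma maxgap_del O j a b g : consec O a j -> consec O j b -> ismaxgap O g ->
  ismaxgap (fun x => O x && (x != j)) (maxn g (b - a)).
Proof.
move=> c1 c2 [m1 [x [y [c3 e]]]]; have [h1 h2 h3 h4] := c1; have [g1 g2 g3 g4] := c2.
split=> [a' b' /(consec_del c1 c2) [[-> ->]|[/m1 h _ _ _ _]]|]; try lia.
have cab : consec (fun x => O x && (x != j)) a b.
  split; first lia.
  - by rewrite h2; lia.
  - by case/orP: g3 => [->//|->]; rewrite /=; lia.
  - move=> z hz; case: (ltngtP z j) => [hh|hh|->]; last by rewrite andbF.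
      by rewrite negb_and h4 //; lia.
    by rewrite negb_and g4 //; lia.
case: (leqP (b - a) g) => hg; last by exists a, b; split=> //; lia.
exists x, y; split; last by lia.
have [f1 f2 f3 f4] := c3.
have xj : x != j by apply/eqP => ex; move: (m1 _ _ c2) f4 f3; subst x; move=> _ f4 f3;
  case: (ltngtP y b) => hy; [case/orP: f3 => oy; [lia|have := g4 y; rewrite oy; lia]|
    case/orP: g3 => ob; [lia|have := f4 b; rewrite ob; lia]|lia].
have yj : y != j by apply/eqP => ey; subst y;
  case: (ltngtP x a) => hx; [have := f4 a; rewrite h2; lia|have := h4 x; rewrite f2; lia|lia].
split=> //; first by rewrite f2.
- by case/orP: f3 => [->//|->]; rewrite yj orbT.
- by move=> z /f4; rewrite negb_and => ->.
Qed.

(** [bad k] stands in for [bad t]: the charge of a position then does not depend on the length at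
    which it is deleted, and the charges can be summed over positions. *)
Definition unlink_cost j := 500 + (if bad k j then n else 1) * (550 * k.+1 + 250).

Lemma bad_mono t t' j : t <= t' -> bad t j -> bad t' j.
Proof.
move=> h /hasP[r]; rewrite mem_iota => /andP[_ hr] b; apply/hasP; exists r => //.
by rewrite mem_iota /=; lia.
Qed.

Lemma mem_bk v j : (j \in bk n v) = (j < n) && (pf j == v).
Proof. by rewrite mem_filter mem_iota add0n andbC. Qed.

(** Here c is any member of the class, possibly not matching m symbols itself; the separate witness
    i does, and makes the string of the class an odot-prefix. *)
Definition feasible m := exists c, [/\ c < n, def (size (ks m)) c,
  exists i, [/\ i < n, eqw (size (ks m)) c i & m <= pf i] &
  forall a b, consec (occurs m c) a b -> b - a <= m].

Lemma occ_eqw m c c' j : eqw (size (ks m)) c c' -> occurs m c j = occurs m c' j.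
Proof.
move=> /all_iota e; rewrite /occurs /occW; congr [&& _, _ & _].
apply: eq_in_all => r; rewrite mem_iota => /andP[_ hr].
by rewrite (eqP (e r hr)).
Qed.

Lemma occ_pred m c j : m <= n -> occurs m c j -> occurs m.-1 c j.
Proof.
move=> hm /and3P[h1 h2 /all_iota h3]; rewrite /occurs h1 /=; apply/andP; split; first lia.
apply/all_iota => r hr; apply: h3; apply: leq_trans hr _; apply: ks_mono; lia.
Qed.

(** The gap from a to b lies inside a gap of the sparser set: the one ending at its first point from
    b on, whose left end cannot lie strictly between a and b. *)
Lemma consec_sub (O O' : nat -> bool) a b g : (forall x, O' x -> O x) ->
  (forall x, O x -> x < n) -> O' 0 ->
  (forall x y, consec O' x y -> y - x <= g) -> consec O a b -> b - a <= g.
Proof.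
move=> sub lt o0 hg [h1 h2 h3 h4].
have ex : exists y, ((y == n) || O' y) && (b <= y) by exists n; rewrite eqxx; lia.
case: (ex_minnP ex) => y /andP[y1 y2] y3.
have yn : y <= n by apply: y3; rewrite eqxx; lia.
have [x hx] : exists x, consec O' x y by apply: ex_prev => //; lia.
have [x1 x2 x3 x4] := hx; have := hg _ _ hx.
suff : x <= a by lia.
case: (leqP x a) => // xa; case: (ltnP x b) => xb.
  by have := h4 x; rewrite sub // xa xb => /(_ isT).
by have := y3 x; rewrite x2 orbT xb => /(_ isT); lia.
Qed.

Definition build_cost := 1500 * (k.+1 * (n * (k * k).+1)).
(** Length 1 is charged a rebuilding whatever T[0] is, since the lists have to be created. *)
Definition step_cost m := 150 + ((m == 1) || (s <= X m.-1)) * (800 * n + build_cost) +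
  \sum_(j <- bk n m.-1) unlink_cost j.

Definition letter c p := if X p < s then X p else (inter (X p) (X (c + p))).-1.

(** * Numbering of the non-solid positions, and summed costs *)

Hypothesis hs : 2 <= s <= n.
Hypothesis hk : size (ks n) = k.
Hypothesis hXs : forall i, i < n -> s <= X i -> X i = s + size (ks i).
Hypothesis hXne : forall i, i < n -> exists2 a, a < s & mb (X i) a.

Lemma ks_size i : i <= n -> size (ks i) <= k.
Proof.
move=> hi; rewrite -hk; have -> : n = i + (n - i) by lia.
by rewrite /ks iotaD filter_cat size_cat leq_addr.
Qed.

Lemma k_le_n : k <= n.
Proof. by rewrite -hk /ks size_filter -{2}(size_iota 0 n) count_size. Qed.

Lemma q_X i : i < n -> s <= X i -> q (X i - s) = i /\ X i - s < k.
Proof.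
move=> hi hx; rewrite (hXs hi hx) addKn.
have h : size (ks i) < size (ks i.+1) by rewrite ksS hx size_rcons.
rewrite -(ks_nth hi h) ksS hx nth_rcons ltnn eqxx; split=> //.
by apply: leq_trans h _; apply: ks_size.
Qed.

Lemma q_lt r : r < k -> q r < n /\ s <= X (q r).
Proof.
move=> hr; have : q r \in ks n by rewrite mem_nth // hk.
by rewrite mem_filter mem_iota => /andP[-> /andP[_ ?]].
Qed.

Lemma X_q r : r < k -> X (q r) = s + r.
Proof.
move=> hr; have [h1 h2] := q_lt hr; have [h3 h4] := q_X h1 h2.
have /eqP : q (X (q r) - s) = q r by [].
rewrite nth_uniq ?hk // ?filter_uniq ?iota_uniq // => /eqP; lia.
Qed.

Lemma X_lt i : i < n -> X i < s + k.
Proof.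
move=> hi; case: (ltnP (X i) s) => h; first lia.
by have [_] := q_X hi h; lia.
Qed.

Lemma ks_lt m r : m <= n -> (r < size (ks m)) = (r < k) && (q r < m).
Proof.
move=> hm; apply/idP/andP => [h|[h1 h2]].
  split; first by apply: leq_trans h _; apply: ks_size.
  rewrite -(ks_nth hm h); have : nth 0 (ks m) r \in ks m by rewrite mem_nth.
  by rewrite mem_filter mem_iota => /andP[_ /andP[_]].
rewrite ltnNge; apply/negP => h3.
have [q1 q2] := q_lt h1; have E := hXs q1 q2; rewrite X_q // in E.
have : size (ks (q r)) < size (ks (q r).+1) by rewrite ksS q2 size_rcons.
have : size (ks (q r).+1) <= size (ks m).
  have -> : m = (q r).+1 + (m - (q r).+1) by lia.
  by rewrite /ks iotaD filter_cat size_cat leq_addr.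
lia.
Qed.

Lemma start_le e : e <= k -> start e <= n.
Proof. by case: e => //= e he; have [] := q_lt he. Qed.

Lemma interXX i : i < n -> inter (X i) (X i) != 0.
Proof.
by move=> hi; apply/inter_neq0; have [a ha hm] := hXne hi; exists a; rewrite ?hm.
Qed.

Lemma pf0 : pf 0 = n.
Proof.
apply/eqP; rewrite eqn_leq; have := pf_le (leq0n n); rewrite add0n => -> /=.
by apply/pfP => //; split=> // y hy; apply: interXX.
Qed.

(** The letters of a class are taken from the symbols T[q r] themselves, so they fit at 0. *)
Lemma occW0 t c : t <= k -> def t c -> occW t c 0.
Proof.
move=> tk /all_iota dc; apply/all_iota => r hr; rewrite add0n.
have [q1 q2] := q_lt (leq_trans hr tk); rewrite q1 /=.
have /andP[d0 d1] := dc r hr; have hc := dl_range d0.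
rewrite /dl hc in d0 d1 *; have := @inter_letter (X (q r)) (X (c + q r)) (inter (X (q r)) (X (c + q r))).-1.
rewrite prednK // => /(_ erefl (ltac:(lia)) _ (ltac:(lia) : (inter (X (q r)) (X (c + q r))).-1 < s)).
by rewrite eqxx => /andP[].
Qed.

Lemma count_bad t : t <= k -> count (bad t) (iota 0 n) <= k * k.
Proof.
move=> tk; rewrite -size_filter.
have -> : k * k = size [seq q y - q x | x <- iota 0 k, y <- iota 0 k].
  by rewrite size_allpairs size_iota.
apply: uniq_leq_size; first by rewrite filter_uniq // iota_uniq.
move=> j; rewrite mem_filter mem_iota => /andP[/hasP[r]].
rewrite mem_iota => /andP[_ hr] /andP[h1 h2] _.
have [h3 h4] := q_X h1 h2.
apply/allpairsP; exists (r, X (j + q r) - s) => /=; rewrite !mem_iota /=.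
by split; rewrite ?h3; lia.
Qed.

Lemma sum_bad t A B : t <= k ->
  \sum_(0 <= j < n) (A + (if bad t j then n else 1) * B) <=
  n * (A + B) + k * k * (n * B).
Proof.
move=> tk; apply: (@leq_trans (\sum_(0 <= j < n) ((A + B) + bad t j * (n * B)))).
  by apply: leq_sum => j _; case: (bad t j); nia.
rewrite big_split /= sum_nat_const_nat subn0 leq_add2l -big_distrl /=.
rewrite leq_mul2r; apply/orP; right; apply: leq_trans (count_bad tk).
by rewrite /index_iota subn0 -sum1_count [X in _ <= X]big_mkcond leq_sum // => i _; case: (bad t i).
Qed.

Lemma occ0 m c : 0 < m <= n -> def (size (ks m)) c -> occurs m c 0.
Proof.
move=> hm dc; rewrite /occurs pf0 occW0 ?dc ?andbT; [lia| |by []].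
by apply: ks_size; lia.
Qed.

(** There are at most k + 1 rebuildings. For the deletions the order of summation is exchanged: a
    position lies in one bucket and is charged at most once, after which [sum_bad] applies. *)
Lemma sum_step_cost : \sum_(1 <= m < n.+1) step_cost m <=
  150 * n + k.+1 * (800 * n + build_cost) + (n * (750 + 550 * k.+1) + k * k * (n * (550 * k.+1 + 250))).
Proof.
rewrite !big_split /= sum_nat_const_nat; apply: leq_add; first apply: leq_add.
- by rewrite subSS subn0 mulnC.
- rewrite -big_distrl /= leq_mul2r; apply/orP; right.
  rewrite big_add1 /= -hk /ks size_filter -sum1_count.
  have n0 : 0 < n by lia.
  rewrite [X in _ <= X.+1](_ : _ = \sum_(0 <= i < n) (s <= X i)); last first.
    by rewrite /index_iota subn0 big_mkcond; apply: eq_bigr => i _; case: ifP.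
  apply: (@leq_trans (\sum_(0 <= i < n) ((i == 0) + (s <= X i)))).
    by apply: leq_sum => i _; rewrite eqSS /=; case: (i == 0); case: (s <= X i).
  rewrite big_split /= -[X in _ <= X]add1n leq_add2r big_ltn // big_nat_cond big1 ?addn0 // => i.
  by case: i.
- have -> : n * (750 + 550 * k.+1) = n * (500 + (550 * k.+1 + 250)) by lia.
  apply: leq_trans (sum_bad 500 (550 * k.+1 + 250) (leqnn k)).
  rewrite big_add1 /= /bk.
  under eq_bigr => i _ do rewrite big_filter.
  apply: (@leq_trans (\sum_(0 <= i < n) \sum_(0 <= j < n) (pf j == i) * unlink_cost j)).
    apply: leq_sum => i _; rewrite /index_iota subn0 big_mkcond; apply: leq_sum => j _.
    by case: (pf j == i); rewrite ?mul1n ?mul0n.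
  rewrite exchange_big_nat /=; apply: leq_sum => j _.
  rewrite -big_distrl /= -[X in _ <= X]mul1n leq_mul2r; apply/orP; right.
  apply: (@leq_trans (count (pred1 (pf j)) (iota 0 n))).
    rewrite -sum1_count /index_iota subn0 [X in _ <= X]big_mkcond; apply: leq_sum => i _ /=.
    by rewrite eq_sym; case: eqP.
  by rewrite count_uniq_mem ?iota_uniq // leq_b1.
Qed.

(** * Correctness and cost of the program *)

Variables (D : nat) (inp : nat -> nat).

Hypothesis hD : D = 2 * n + 20.
Hypothesis inp0 : inp 0 = n.
Hypothesis inp1 : inp 1 = s.
Hypothesis inpX : forall i, i < n -> inp (2 + i) = X i.
Hypothesis inpB : forall r a, r < k -> a < s -> inp (2 + n + r * s + a) = bt r a.

(** The contexts [base], [ctx1], [ctx2], [ctxZ], [ctxP], [ctxB] and [ctxC] accumulate the results of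
    the successive phases. Each one survives every program that leaves alone the registers and
    arrays it speaks of. *)
Definition base h :=
  [/\ hr h vN = n, hr h vS = s & forall a, a < D * D -> hi h a = inp a].

Definition ctx1 h :=
  [/\ base h, hr h vK = k & forall r, r < k -> ha h rQ 0 r = q r].

Definition ctx2 h := ctx1 h /\
  forall r r', r < k -> r' < k -> ha h rNN r r' = inter (s + r) (s + r').

Lemma base_fr c h h' : frame c h h' -> base h ->
  [&& vN \notin mr c, vS \notin mr c & ~~ mi c] -> base h'.
Proof.
move=> [f1 f2 f3] [b1 b2 b3] /and3P[m1 m2 m3].
by split; rewrite ?f1 //; rewrite f2.
Qed.

Lemma ctx1_fr c h h' : frame c h h' -> ctx1 h ->
  [&& vN \notin mr c, vS \notin mr c & ~~ mi c] &&
    (vK \notin mr c) && (rQ \notin ma c) -> ctx1 h'.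
Proof.
move=> F [b1 b2 b3] /andP[/andP[m1 m2] m3].
have b := base_fr F b1 m1; case: F => f1 f2 f3.
by split; rewrite ?f1 // f3.
Qed.

Lemma ctx2_fr c h h' : frame c h h' -> ctx2 h ->
  [&& vN \notin mr c, vS \notin mr c & ~~ mi c] &&
    (vK \notin mr c) && (rQ \notin ma c) && (rNN \notin ma c) -> ctx2 h'.
Proof.
move=> F [b1 b2] /andP[m1 m2].
have b := ctx1_fr F b1 m1; case: F => f1 f2 f3.
by split; rewrite // f3.
Qed.

Lemma D_sq r a : r < k -> a < s -> 2 + n + r * s + a < D * D.
Proof. by have := k_le_n; rewrite hD => *; nia. Qed.

Lemma D_sqX i : i < n -> 2 + i < D * D.
Proof. by rewrite hD => *; nia. Qed.

Lemma ok_X h e : base h -> ok D e h -> hev e h < n -> ok D (eX e) h.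
Proof. by move=> _ /= -> h1; rewrite D_sqX. Qed.

Lemma ev_X h e : base h -> hev e h < n -> hev (eX e) h = X (hev e h).
Proof. by move=> [_ _ hb] h1 /=; rewrite hb ?inpX // D_sqX. Qed.

Lemma ok_Bit h u a : base h -> ok D u h -> ok D a h ->
  hev u h < k -> hev a h < s -> ok D (eBit u a) h.
Proof. by move=> [e1 e2 _] /= -> -> h1 h2; rewrite e1 e2 D_sq. Qed.

Lemma ev_Bit h u a : base h -> hev u h < k -> hev a h < s ->
  hev (eBit u a) h = bt (hev u h) (hev a h).
Proof.
by move=> [e1 e2 hb] h1 h2 /=; rewrite e1 e2 hb ?inpB // D_sq.
Qed.

Lemma runs_inter d u v h (Q : hst -> Prop) :
  ctx2 h -> ok D u h -> ok D v h -> hev u h < s + k -> hev v h < s + k ->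
  Q (sr h d (inter (hev u h) (hev v h))) ->
  runs D (cInter d u v) h (80 + 8 * (hcost u + hcost v)) Q.
Proof.
move=> [[b _ _] cN] ou ov lu lv q0; have [eN eS _] := b; have hkn := k_le_n.
eapply runs_weak; first eapply runs_if; rewrite /= ?ov //.
- rewrite eS; case: ltnP => // hv _.
  eapply runs_if; rewrite /= ?ou // eS; case: ltnP => // hu _.
  + vc_step; rewrite /= ?ou ?ov // -?/(hev u h); first by case: eqP => _ /=; lia.
    move: q0; rewrite inter_solid // /mb hv eq_sym.
    by case: eqP => [->|] /=; rewrite ?mul1n ?addn1.
  + have os : ok D (HB OpSub u (HR 1)) h by rewrite /= ou eS.
    have ls : hev (HB OpSub u (HR 1)) h < k by rewrite /= eS; lia.
    have E := ev_Bit b ls hv; have oB := ok_Bit b os ov ls hv.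
    have E2 : hev (eBit (u |-| HR 1)%H v |*| (v |+| 1))%H h = inter (hev u h) (hev v h).
      rewrite interC inter_solid // /mb ltnNge hu.
      move: E => /= ->; rewrite eS; by case: (bt _ _); rewrite /= ?mul1n ?addn1.
    vc_step; last by rewrite E2.
      by move: oB => /= ->; rewrite ov.
    by rewrite E2; have := inter_le (hev u h) (hev v h); lia.
- rewrite eS; case: ltnP => // hv _.
  have os : ok D (HB OpSub v (HR 1)) h by rewrite /= ov eS.
  have ls : hev (HB OpSub v (HR 1)) h < k by rewrite /= eS; lia.
  eapply runs_if; rewrite /= ?ou // eS; case: ltnP => // hu _.
  + have E := ev_Bit b ls hu; have oB := ok_Bit b os ou ls hu.
    have E2 : hev (eBit (v |-| HR 1)%H u |*| (u |+| 1))%H h = inter (hev u h) (hev v h).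
      rewrite inter_solid // /mb ltnNge hv.
      move: E => /= ->; rewrite eS; by case: (bt _ _); rewrite /= ?mul1n ?addn1.
    vc_step; last by rewrite E2.
      by move: oB => /= ->; rewrite ou.
    by rewrite E2; have := inter_le (hev u h) (hev v h); lia.
  + have E2 : hev (HA rNN (u |-| HR vS) (v |-| HR vS))%H h = inter (hev u h) (hev v h).
      by rewrite /= eS cN ?subnKC //; lia.
    vc_step; last by rewrite E2.
      by rewrite /= ou ov eS hu hv /=; lia.
    by rewrite E2; have := inter_le (hev u h) (hev v h); lia.
- rewrite /hcost /=. lia.
Qed.

(** * Preprocessing: intersections, Z-arrays, longest matches and buckets *)

Lemma runs_pre h : (forall a, a < D * D -> hi h a = inp a) -> hr h vK = 0 ->
  runs D cPre h (60 * n.+1) ctx1.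
Proof.
move=> hb hK0; have d0 : 0 < D * D by nia.
have d1 : 1 < D * D by nia.
have hkn := k_le_n.
rewrite /cPre; eapply runs_weak.
  do 2 vc_step; rewrite /= ?hb ?inp0 ?inp1 //; try lia.
  do 2 vc_step; rewrite /= ?hb ?inp0 ?inp1 //; try lia.
  eapply (@runs_forc _ _ _ _ _ (fun i h => [/\ base h, hr h vK = size (ks i) &
     forall r, r < size (ks i) -> ha h rQ 0 r = q r]) 0 n) => //=; try lia.
  - by move=> i h1 _ [[-> _ _] _ _] _.
  - move=> i h1 hin [b1 eK eQ] ei; have [eN eS _] := b1.
    have o1 : ok D (HR vJ) h1 by []. have l1 : hev (HR vJ) h1 < n by rewrite /= ei.
    have E := ev_X b1 l1; have oX := ok_X b1 o1 l1; rewrite /= ei in E.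
    have := ks_size hin; rewrite ksS => hks.
    eapply runs_if; first by move: oX => /= ->.
    + move=> H; have {H} hlt : X i < s by move: H; rewrite /= ei E eS; case: ltnP.
      vc_step; split=> //=.
      by rewrite leqNgt hlt.
    + move=> H; have {H} hle : s <= X i by move: H; rewrite /= ei E eS; case: ltnP.
      rewrite hle size_rcons in hks.
      have hq := q_X hin hle; rewrite (hXs hin hle) addKn in hq.
      do 2 vc_step; rewrite /= ?ei ?eK //; try lia.
      vc_step; rewrite /= ?eK //; try lia.
      split=> //; rewrite hle size_rcons.
      split=> //=; first by rewrite addn1.
      move=> r hr; rewrite /upa /=; case: eqP => [->|hne]; first by case: hq.
      by apply: eQ; lia.
  - move=> h1 [b1 eK eQ] _; rewrite hk in eK eQ; split=> //.
by rewrite /hcost /=; lia.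
Qed.

Lemma runs_NN h : ctx1 h ->
  runs D cNN h (10 + k * (30 + k * (40 + s * 60))) ctx2.
Proof.
move=> c0; have hkn := k_le_n.
pose done i j h := forall r r', r < k -> r' < k -> (r < i) || (r == i) && (r' < j) ->
  ha h rNN r r' = inter (s + r) (s + r').
rewrite /cNN; eapply runs_weak.
  eapply (@runs_forc _ _ _ _ _ (fun i h => ctx1 h /\ done i 0 h) 0 k) => //=; try lia.
  - by split=> // r r' _ _; lia.
  - by move=> i h1 _ [[_ -> _] _] _.
  - move=> i h1 hi [c1 d1] ei.
    eapply (@runs_forc _ _ _ _ _ (fun j h => [/\ ctx1 h, done i j h & hr h vI = i]) 0 k) => //=; try lia.
    + by move=> j h2 _ [[_ -> _] _] _.
    + move=> j h2 hj [c2 d2 ei2] ej; have [[eN eS eI] eK eQ] := c2.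
      do 2 vc_step => //=; try lia.
      vc_step.
      pose L a := [seq x <- iota 0 a | bt i x && bt j x].
      eapply (@runs_forc _ _ _ _ _ (fun a h => [/\ ctx1 h, done i j h, hr h vI = i,
        hr h vJ = j & hr h vD = lcode s (L a)]) 0 s) => //=; try lia.
      * by move=> a h3 _ [[[_ -> _] _ _] _ _ _ _] _.
      * move=> a h3 la [c3 d3 ei3 ej3 ed3] ea.
        have [b3 _ _] := c3; have [_ eS3 _] := b3.
        have E1 : hev (eBit (HR vI) (HR vA)) h3 = bt i a.
          by rewrite (ev_Bit b3) /= ?ei3 ?ea.
        have E2 : hev (eBit (HR vJ) (HR vA)) h3 = bt j a.
          by rewrite (ev_Bit b3) /= ?ej3 ?ea.
        have O1 : ok D (eBit (HR vI) (HR vA)) h3 by rewrite ok_Bit //= ?ei3 ?ea.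
        have O2 : ok D (eBit (HR vJ) (HR vA)) h3 by rewrite ok_Bit //= ?ej3 ?ea.
        have EL : L a.+1 = if bt i a && bt j a then rcons (L a) a else L a.
          by rewrite /L -addn1 iotaD filter_cat /= add0n; case: ifP; rewrite ?cats1 ?cats0.
        eapply runs_if; first by move: O1 O2 => /= -> ->.
        -- move=> H; have H2 : bt i a && bt j a.
             by move: H E1 E2 => /= H; move: H => /[swap] -> /[swap] ->; case: (bt i a); case: (bt j a).
           rewrite EL H2 lcode_rcons // -ed3.
           eapply runs_if => //= H3.
           ++ vc_step => //=; rewrite ?eS3; try lia.
              by rewrite (negPf H3) addn1; split.
           ++ vc_step => //=; rewrite ?ea; try lia.
              by rewrite H3 eqxx addn1; split.
        -- move=> H; have H2 : bt i a && bt j a = false.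
             by move: H E1 E2 => /= H; move: H => /[swap] -> /[swap] ->; case: (bt i a); case: (bt j a).
           by rewrite EL H2; vc_step.
      * move=> h3 [c3 d3 ei3 ej3 ed3] _.
        have E : hr h3 vD = inter (s + i) (s + j).
          rewrite ed3 /inter /L; congr lcode; apply: eq_filter => a.
          by rewrite /mb !ltnNge !leq_addr /= !addKn.
        vc_step => //=; rewrite ?ei3 ?ej3 ?E; try lia.
          by have := inter_le (s + i) (s + j); lia.
        split=> //; split=> //= r r' hr1 hr2 hrr; rewrite /= /upa.
        case: (eqVneq r i) hr1 hrr => [->|n1] hr1 hrr; last by rewrite /=; apply: d3 => //; lia.
        by case: (eqVneq r' j) hr2 hrr => [->|n2] //= hr2 hrr; apply: d3 => //; lia.
    + move=> h2 [c2 d2 ei2] _; split=> //; split=> //= r r' h3 h4 h5.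
      by apply: d2 => //; lia.
  - by move=> h1 [c1 d1] _; split=> // r r' h2 h3; apply: d1 => //; rewrite h2.
rewrite /hcost /=; nia.
Qed.

Lemma ok_V h a y : base h -> hr h vB = a -> ok D y h -> ok D (eV y) h.
Proof.
move=> b eB oy; have [eN _ _] := b.
by apply: ok_X => //=; rewrite ?oy // eN ltn_mod; lia.
Qed.

Lemma ev_V h a y : base h -> hr h vB = a -> hev (eV y) h = V a (hev y h).
Proof.
move=> b eB; have [eN _ _] := b.
by rewrite /V -eB (ev_X b) /= eN // ltn_mod; lia.
Qed.

(** The window from L to R agrees with a prefix. Each successful comparison advances R, which never
    moves back, so the potential 40 (2n - R) makes the time linear. *)
Lemma runs_Z1 e h : ctx2 h -> e <= k -> hr h vE = e -> hr h vB = start e ->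
  runs D cZ1 h (500 * n) (fun h' => [/\ ctx2 h',
    forall y, 0 < y -> start e + y <= n + n -> isz (start e) y (ha h' rZ e y)
    & forall e' j, e' != e -> ha h' rZ e' j = ha h rZ e' j]).
Proof.
move=> c0 he eE eB; have hsl := start_le he; set a := start e in eB hsl *.
have hkn := k_le_n.
have [[[eN eS eI] eK eQ] _] := c0.
rewrite /cZ1; eapply runs_weak.
  do 2 vc_step => //=; try lia.
  do 2 vc_step => //=; try lia.
  do 2 vc_step; rewrite /= ?eN ?eB; try lia.
  eapply (@runs_forp _ _ _ _ _ (fun y h1 =>
     [/\ [/\ ctx2 h1, hr h1 vE = e, hr h1 vB = a & hr h1 vF = n + n - a],
         [/\ a + hr h1 vR <= n + n, hr h1 vL < y, hr h1 vL = 0 -> hr h1 vR = 0 &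
         forall u, hr h1 vL + u < hr h1 vR -> V a u = V a (hr h1 vL + u)],
         forall y', 0 < y' < y -> isz a y' (ha h1 rZ e y')
       & forall e' j, e' != e -> ha h1 rZ e' j = ha h rZ e' j])
     (fun h1 => 40 * (n + n - hr h1 vR)) 1 (n + n - a).+1 (fun=> 150)) => //=; try lia.
  - by split=> //; [split=> // | move=> y]; lia.
  - by move=> y h1 _ [[_ _ _ ->] _ _ _] _; split; lia.
  - move=> y h1 /andP[y0 yl] [[c1 eE1 eB1 eF1] [hR hL hL0 hLR] hz hf] ey.
    have b1 : base h1 by have [[]] := c1.
    have [[[eN1 eS1 _] eK1 _] _] := c1.
    (* While L = 0 there is no window and R = 0, so the test of the program fails by itself; the
       conjunct on L singles out this case. *)
    have [/andP[hc hL1]|hc] := boolP ((ha h1 rZ e (y - hr h1 vL) + y < hr h1 vR) && (0 < hr h1 vL)).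
    + exists 40.
      eapply runs_weak; first eapply runs_ifT.
      * by rewrite /= eE1 ey; lia.
      * by rewrite /= eE1 ey hc.
      * vc_step; rewrite /= ?eE1 ?ey; try lia.
        have hzz := hz (y - hr h1 vL) (ltac:(lia)); set z := ha h1 rZ e (y - hr h1 vL) in hzz hc *.
        split=> //=; last by lia.
        split=> //=.
        -- by split=> //; lia.
        -- move=> y' hy'; rewrite /upa eqxx /=.
           case: (eqVneq y' y) hy' => [->|n1] hy'; last by apply: hz; lia.
           (* The match at y - L ends strictly inside the window, so the mismatch behind it is seen
              from y as well. *)
           case: hzz => z1 z2 z3; split; first by lia.
             move=> u hu; rewrite z2 // hLR; last by lia.
             by congr (V a _); lia.
           move=> _ E; apply: z3; first lia.
           rewrite E (hLR (y - hr h1 vL + z)); last by lia.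
           by congr (V a _); lia.
        -- by move=> e' j ne; rewrite /upa /= (negPf ne); apply: hf.
      * by rewrite /hcost /=; lia.
    + pose R0 := maxn (hr h1 vR) y.
      (* Beyond y this only concerns the window, and there the value at y - L is known to reach its
         end. *)
      have hR0 u : y + u < R0 -> V a u = V a (y + u).
        move=> hu; have hyR : R0 = hr h1 vR by rewrite /R0; lia.
        have hL1 : 0 < hr h1 vL by case: (posnP (hr h1 vL)) => // /hL0; lia.
        have [z1 z2 z3] := hz (y - hr h1 vL) (ltac:(lia)).
        rewrite z2; last by move: hc; rewrite hL1 andbT; lia.
        by rewrite hLR; [congr (V a _)|]; lia.
      have [z [hzz hRz]] := isz_ext (ltac:(lia) : a + R0 <= n + n) (leq_maxr _ _) hR0.
      exists (40 * (y + z - R0) + 110).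
      eapply runs_weak; first eapply runs_ifF.
      * by rewrite /= eE1 ey; lia.
      * rewrite /= eE1 ey; case: ltnP => // hlt.
        by move: hc; rewrite hlt /= -eqn0Ngt => /eqP /hL0; lia.
      * vc_step.
        have RI : runs D (HIf (HR vR |<| HR vY)%H (vR ::= HR vY)%H HSkip) h1 8
            (fun h2 => hr h2 vR = R0).
          eapply runs_weak; first eapply runs_if => //=.
          -- by rewrite ey; case: ltnP => // hlt _; vc_step; rewrite /= ?ey /R0; lia.
          -- by rewrite ey; case: ltnP => // hlt _; vc_step; rewrite /R0; lia.
          -- by [].
        eapply runs_post; first exact: RI.
        move=> h2 F eR2; have c2 := ctx2_fr F c1 isT; case: (F) => F1 _ F3.
        have eE2 : hr h2 vE = e by rewrite F1.
        have eB2 : hr h2 vB = a by rewrite F1.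
        have eF2 : hr h2 vF = n + n - a by rewrite F1.
        have eY2 : hr h2 vY = y by rewrite F1.
        have eZ2 : ha h2 rZ = ha h1 rZ by rewrite F3.
        vc_step.
        pose J h3 := [/\ ctx2 h3, [/\ hr h3 vE = e, hr h3 vB = a,
          hr h3 vF = n + n - a & hr h3 vY = y], R0 <= hr h3 vR <= y + z & ha h3 rZ = ha h1 rZ].
        apply: (@runs_weak _ _ _ (40 * (y + z - hr h2 vR) + 50) (40 * (y + z - R0) + 50)); last by rewrite eR2.
        eapply runs_weak; first eapply (@runs_whilep _ _ _ J (fun h3 => 40 * (y + z - hr h3 vR))).
        -- by split=> //; rewrite eR2 leqnn.
        -- move=> h3 [c3 [e1 e2 e3 e4] hr3 _]; have b3 : base h3 by have [[]] := c3.
           have o1 := ok_V (y := HR vR |-| HR vY) b3 e2.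
           have o2 := ok_V (y := HR vR) b3 e2.
           rewrite /= in o1 o2 *.
           by rewrite o1 ?o2 // e4; lia.
        -- move=> h3 [c3 [e1 e2 e3 e4] hr3 ez]; have b3 : base h3 by have [[]] := c3.
           have v1 := ev_V (HR vR |-| HR vY)%H b3 e2.
           have v2 := ev_V (HR vR) b3 e2.
           rewrite /= in v1 v2 *; rewrite v1 v2 e3 e4 => hne.
           have hlt : hr h3 vR < y + z.
             case: (ltnP (hr h3 vR) (y + z)) => // hge.
             have hR3 : hr h3 vR = y + z by lia.
             move: hne; rewrite hR3 addKn; case: ltnP => // hl2; case: eqP => // E.
             by case: hzz => _ _ hv; case: hv => //; lia.
           exists 4; eapply runs_weak.
             vc_step => //=; first by lia.
             by split; [split=> //=; lia | rewrite /hcost /=; lia].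
           by [].
        -- move=> h3 [c3 [e1 e2 e3 e4] hr3 ez]; have b3 : base h3 by have [[]] := c3.
           have v1 := ev_V (HR vR |-| HR vY)%H b3 e2.
           have v2 := ev_V (HR vR) b3 e2.
           rewrite /= in v1 v2 *; rewrite v1 v2 e3 e4 => heq.
           have hR3 : hr h3 vR = y + z.
             apply/eqP; rewrite eqn_leq; apply/andP; split; first lia.
             rewrite leqNgt; apply/negP => hlt; move: heq.
             have -> : hr h3 vR < n + n - a by case: hzz; lia.
             case: hzz => _ z2 _; rewrite (z2 (hr h3 vR - y)); last lia.
             have -> : y + (hr h3 vR - y) = hr h3 vR by lia.
             by rewrite eqxx.
           have hzb : a + y + z <= n + n by case: hzz.
           do 2 vc_step; rewrite /= ?e1 ?e4 ?hR3 ?addKn; try lia.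
           vc_step; rewrite /= ?e4 //; first lia.
           split=> //; last by rewrite /hcost /=; lia.
           split=> //=.
           ++ split; rewrite ?hR3 //; try lia.
              move=> u hu; case: hzz => _ z2 _; apply: z2; lia.
           ++ move=> y' hy'; rewrite /upa eqxx /= ez.
              by case: (eqVneq y' y) hy' => [->|n1] hy'; last by apply: hz; lia.
           ++ by move=> e' j ne; rewrite /upa /= (negPf ne) ez; apply: hf.
        -- by rewrite /hcost /=; lia.
      * by rewrite /hcost /=; lia.
  - move=> h1 [[c1 e1 e2 e3] _ hz hf] _; split=> // y y0 y1; apply: hz; lia.
rewrite sum_nat_const_nat /hcost /=; nia.
Qed.

Definition ctxZ h := ctx2 h /\ forall e y, e <= k -> 0 < y ->
  start e + y <= n + n -> isz (start e) y (ha h rZ e y).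

Lemma runs_Z h : ctx2 h -> runs D cZ h (10 + k.+1 * (600 * n)) ctxZ.
Proof.
move=> c0; have hkn := k_le_n; rewrite /cZ; eapply runs_weak.
  eapply (@runs_forc _ _ _ _ _ (fun e h1 => ctx2 h1 /\ forall e' y, e' < e -> 0 < y ->
      start e' + y <= n + n -> isz (start e') y (ha h1 rZ e' y)) 0 k.+1) => //=; try lia.
  - by move=> e h1 _ [[[_ -> _] _] _] _; rewrite addn1.
  - move=> e h1 he [c1 hz] ee; have [[[eN eS eI] eK eQ] _] := c1.
    eapply runs_seqc with (P := fun h2 => [/\ ctx2 h2, hr h2 vE = e,
      hr h2 vB = start e & ha h2 rZ = ha h1 rZ]).
      eapply runs_if => //=; rewrite ee.
      + case: e he hz ee => // e he hz ee _; vc_step; rewrite /= ?ee ?subn1 /= ?eQ //; try lia.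
        by have [] := q_lt (ltac:(lia) : e < k); lia.
        by split=> //=; rewrite addn1.
      + by move=> e0; vc_step => //=; try lia; split=> //=; rewrite e0.
    move=> h2 _ [c2 eE eB eZ].
    have he' : e <= k by lia.
    eapply runs_post; first exact: runs_Z1 c2 he' eE eB.
    move=> h3 F [c3 hz3 hf3]; case: (F) => F1 _ _; split; first by rewrite F1.
    split=> //= e' y hle; rewrite eZ in hf3.
    case: (eqVneq e' e) hle => [->|ne] hle y0 hy; first exact: hz3.
    by rewrite hf3 //; apply: hz => //; lia.
rewrite /hcost /=; nia.
Qed.

Lemma ctxZ_fr c h h' : frame c h h' -> ctxZ h ->
  [&& vN \notin mr c, vS \notin mr c & ~~ mi c] &&
    (vK \notin mr c) && (rQ \notin ma c) && (rNN \notin ma c) &&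
    (rZ \notin ma c) -> ctxZ h'.
Proof.
move=> F [b1 b2] /andP[m1 m2].
have b := ctx2_fr F b1 m1; case: F => f1 f2 f3.
by split; rewrite // f3.
Qed.

Lemma runs_lce d e b x h i (Q : hst -> Prop) : ctxZ h ->
  ok D e h -> ok D b h -> ok D x h -> hev e h = i -> i <= k ->
  hev b h = start i -> hev x h <= n -> 0 < hev x h ->
  (forall z, islce (start i) (hev x h) z -> Q (sr h d z)) ->
  runs D (cLce d e b x) h (40 + 3 * (hcost e + hcost b + hcost x)
    + 4 * (hcost b)) Q.
Proof.
move=> [c hz] oe ob ox ee hi eb hx hx0 hQ.
have [[[eN _ _] _ _] _] := c; have hkn := k_le_n; have hsl := start_le hi.
have hzz := hz i (n - start i + hev x h) hi (ltac:(lia)) (ltac:(lia)).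
have hl := isz_lce hsl hx hzz.
have hle : minn (ha h 3 i (n - start i + hev x h)) (n - start i) <= n by lia.
eapply runs_weak; first eapply runs_if.
- by rewrite /= oe ob ox ee eN eb; lia.
- rewrite /= ee eN eb; case: ltnP => // hlt _.
  vc_step; rewrite /= ?oe ?ob ?ox ?ee ?eN ?eb; try lia.
  by apply: hQ; move: hl; rewrite (minn_idPl _) // ltnW.
- rewrite /= ee eN eb; case: ltnP => // hlt _.
  vc_step; rewrite /= ?oe ?ob ?ox ?ee ?eN ?eb; try lia.
  by apply: hQ; move: hl; rewrite (minn_idPr _).
- rewrite /hcost /=; lia.
Qed.

Lemma runs_PF1 h j : ctxZ h -> hr h vJ = j -> 0 < j < n ->
  runs D cPF1 h (1000 * k.+1) (fun h' => [/\ ctxZ h', hr h' vJ = j,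
    ha h' rPF 0 j = pf j & forall j', j' != j -> ha h' rPF 0 j' = ha h rPF 0 j']).
Proof.
move=> c0 eJ hj; have hkn := k_le_n; rewrite /cPF1.
(* State after a jump: everything before p matches and the codes at p and j + p differ, so if these
   symbols intersect they are not both solid. *)
pose A p := [/\ j + p <= n, forall y, y < p -> inter (X y) (X (j + y)) != 0
  & j + p < n -> X p <> X (j + p)].
have hA p b x e : A p -> islce b x e -> (b = p.+1 /\ x = j + p.+1) \/ (b = j + p.+1 /\ x = p.+1) ->
  j + p < n -> inter (X p) (X (j + p)) != 0 -> A (p.+1 + e).
  move=> [a1 a2 a3] [l1 l2 l3 l4] hbx hp hi.
  have hE u : u < e -> X (p.+1 + u) = X (j + p.+1 + u).
    by move=> hu; have := l3 u hu; case: hbx => [] [-> ->].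
  split.
  - by case: hbx => [] [e1 e2]; subst; lia.
  - move=> y hy; case: (ltngtP y p) => [/a2//|hyp|->//].
    have hu : y - p.+1 < e by lia.
    have := hE _ hu; have -> : p.+1 + (y - p.+1) = y by lia.
    have -> : j + p.+1 + (y - p.+1) = j + y by lia.
    move=> E; rewrite -E; apply: interXX.
    by case: hbx => [] [e1 e2]; subst; lia.
  - have -> : j + (p.+1 + e) = j + p.+1 + e by lia.
    by move=> hlt; case: hbx => [] [e1 e2]; subst; move: (l4 (ltac:(lia)) (ltac:(lia))) => // ? ?; congruence.
eapply runs_weak.
  vc_step; eapply (runs_lce (i := 0)) => //=; try lia.
  move=> e [l1 l2 l3 l4].
  do 2 vc_step => //=; try lia.
  vc_step.
  pose J h1 := [/\ ctxZ h1, hr h1 vJ = j, hr h1 vF <= 1,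
    (if hr h1 vF == 1 then A (hr h1 vP) else ispf j (hr h1 vP)) &
    ha h1 rPF = ha h rPF].
  (* A round that goes on passes a non-solid symbol at p or at j + p. The non-solid symbols not yet
     passed, counted on both sides, pay for these at most 2k rounds, and the flag for the last
     one. *)
  pose pot h1 := 480 * (hr h1 vF + (k - size (ks (hr h1 vP))) + (k - size (ks (j + hr h1 vP)))).
  eapply (@runs_weak _ _ _ _ (480 * (1 + k + k) + 2)); first eapply (@runs_whilep _ _ _ J pot).
  - split=> //=; rewrite eJ in l2 l3 l4; split=> // [y hy|].
      by rewrite -l3 // ?add0n; apply: interXX; lia.
    by move=> hlt; apply: l4; lia.
  - by [].
  - move=> h1 [c1 eJ1 hF1 hA1 hf1] /= hF0; have hF : hr h1 vF = 1 by lia.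
    rewrite hF eqxx in hA1; set p := hr h1 vP in hA1 *.
    have c1' : ctx2 h1 by case: c1. have b1 : base h1 by have [[]] := c1'.
    have [[[eN eS eI] eK eQ] cN] := c1'.
    have [a1 a2 a3] := hA1.
    have hend h2 : ctxZ h2 -> hr h2 vJ = j -> hr h2 vF = 0 -> hr h2 vP = p ->
        ha h2 rPF = ha h1 rPF -> ispf j p -> J h2 /\ pot h2 + 460 + 2 <= pot h1.
      move=> x1 x2 x3 x4 x5 x6; split; first by split; rewrite ?x3 ?x4 ?x5.
      by rewrite /pot x3 x4 hF -/p; lia.
    exists 460.
    have [hlt|hge] := ltnP (j + p) n; last first.
      eapply runs_weak; first eapply runs_ifF => //=.
      + by rewrite eJ1 eN -/p ltnNge hge.
      + vc_step => //=; first by lia.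
        by apply: hend => //; split=> //; lia.
      + by [].
    have oP : ok D (HR vP) h1 by []. have lP : hev (HR vP) h1 < n by rewrite /= -/p; lia.
    have oJ : ok D (HR vJ |+| HR vP)%H h1 by [].
    have lJ : hev (HR vJ |+| HR vP)%H h1 < n by rewrite /= eJ1 -/p.
    have E1 := ev_X b1 lP; have E2 := ev_X b1 lJ.
    have O1 := ok_X b1 oP lP; have O2 := ok_X b1 oJ lJ.
    eapply runs_weak; first eapply runs_ifT => //=.
    + by rewrite eJ1 eN -/p hlt.
    + vc_step; eapply runs_inter => //; rewrite ?E1 ?E2 ?X_lt //.
      rewrite /= eJ1 -/p; have [i0|i0] := eqVneq (inter (X p) (X (j + p))) 0.
        eapply (@runs_weak _ _ _ _ 290); first eapply runs_ifF => //=.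
          vc_step => //=; first by lia.
          by apply: hend => //.
        by [].
      eapply (@runs_weak _ _ _ _ 290); first eapply runs_ifT => //=.
      set h2 := sr h1 _ _.
      have c2 : ctxZ h2 by []. have b2 : base h2 by [].
      eapply runs_seqc with (P := fun h3 => exists2 e0, hr h3 vD = e0 /\ A (p.+1 + e0)
         & p.+1 + e0 <= n /\ (s <= X p \/ s <= X (j + p))).
        eapply (@runs_if _ _ _ _ _ 130 130).
        * by move: O1 => /= ->.
        * have -> : (hev (eX (HR vP) |<| HR vS)%H h2 != 0) = (X p < s).
            by move: E1 => /= ->; rewrite eS -/p; case: ltnP.
          move=> hXp; have hXj : s <= X (j + p).
            rewrite leqNgt; apply/negP => hXj; apply: (a3 hlt).
            by move: i0; rewrite inter_solid // /mb hXj; have [->|] := eqVneq (X (j + p)) (X p).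
          have [q1 q2] := q_X hlt hXj.
          eapply runs_weak; first eapply (runs_lce (i := (X (j + p) - s).+1)) => //.
          -- by move: O2 => /= ->; move: E2 => /= ->; rewrite eS eJ1 -/p; lia.
          -- by move: E2 => /= ->; rewrite eS eJ1 -/p addn1.
          -- by rewrite /= eJ1 q1 addn1.
          -- by rewrite /= -/p; lia.
          -- by rewrite /= addn1.
          -- move=> z hz; exists z => //=; last by case: hz => /=; rewrite -/p; split; [lia|right].
             split=> //; apply: hA hA1 hz _ hlt i0; right.
             by rewrite /= q1 -/p addn1 addnS.
          -- by [].
        * have -> : (hev (eX (HR vP) |<| HR vS)%H h2 = 0) <-> (s <= X p).
            by move: E1 => /= ->; rewrite eS -/p; case: ltnP.
          move=> hXp.
          have [q1 q2] := q_X (ltac:(lia) : p < n) hXp.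
          eapply runs_weak; first eapply (runs_lce (i := (X p - s).+1)) => //.
          -- by move: O1 => /= ->; move: E1 => /= ->; rewrite eS -/p; lia.
          -- by move: E1 => /= ->; rewrite eS -/p addn1.
          -- by rewrite /= -/p q1 addn1.
          -- by rewrite /= -/p eJ1; lia.
          -- by rewrite /= addn1.
          -- move=> z hz; exists z => //=; last by case: hz => /=; rewrite -/p /= q1; split; [lia|left].
             split=> //; apply: hA hA1 hz _ hlt i0; left.
             by rewrite /= q1 -/p eJ1 addn1 addnS.
          -- by [].
      move=> h3 F [e0 [eD hA3] [hle hX]]; case: (F) => F1 _ F3.
      have c3 : ctxZ h3 by apply: ctxZ_fr F c2 isT.
      have eP3 : hr h3 vP = p by rewrite F1.
      have eJ3 : hr h3 vJ = j by rewrite F1.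
      have eF3 : hr h3 vF = 1 by rewrite F1.
      vc_step => //=; rewrite eP3 eD addn1; first by lia.
      split; first by split; rewrite //= ?eF3 ?F3.
      have m1 : size (ks p.+1) <= size (ks (p.+1 + e0)) by apply: ks_mono; lia.
      have m2 : size (ks (j + p).+1) <= size (ks (j + (p.+1 + e0))) by apply: ks_mono; lia.
      have m3 : size (ks (p.+1 + e0)) <= k by apply: ks_size.
      have m4 : size (ks (j + (p.+1 + e0))) <= k by apply: ks_size; case: hA3.
      have n1 : size (ks p) + (s <= X p) <= size (ks p.+1).
        by rewrite ksS; case: ifP; rewrite ?size_rcons ?addn1 ?addn0.
      have n2 : size (ks (j + p)) + (s <= X (j + p)) <= size (ks (j + p).+1).
        by rewrite ksS; case: ifP; rewrite ?size_rcons ?addn1 ?addn0.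
      have hX' : 0 < (s <= X p) + (s <= X (j + p)) by case: hX => ->; lia.
      rewrite /pot /= eF3 hF -/p; have -> : hcost (HR 19) = 1 by [].
      clear - n1 n2 m1 m2 m3 m4 hX'.
      lia.
      by [].
    + by [].
  - move=> h1 [c1 eJ1 hF1 hA1 hf1] /= hF0; rewrite hF0 /= in hA1.
    have [a1 a2 a3] := hA1.
    vc_step => //=; rewrite ?eJ1; try lia.
    rewrite (ispfP hA1) /upa !eqxx; split=> // j' ne.
    by rewrite (negPf ne) /= hf1.
  - by rewrite /pot /hcost /=; lia.
rewrite /hcost /=; lia.
Qed.

Definition ctxP h := ctxZ h /\ forall j, j < n -> ha h rPF 0 j = pf j.

Lemma runs_PF h : ctxZ h -> runs D cPF h (n * (1100 * k.+1)) ctxP.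
Proof.
move=> c0; have [[[[eN _ _] _ _] _] _] := c0; rewrite /cPF; eapply runs_weak.
  do 2 vc_step => //=; rewrite ?eN; try lia.
  eapply (@runs_forc _ _ _ _ _ (fun j h1 => ctxZ h1 /\
    forall i, i < j -> ha h1 rPF 0 i = pf i) 1 n) => //=; try lia.
  - by split=> // [[|i]] //= _; rewrite pf0.
  - by move=> j h1 _ [[[[[-> _ _] _ _] _] _] _] _.
  - move=> j h1 hj [c1 hpf] ej.
    eapply runs_post; first exact: runs_PF1 c1 ej hj.
    move=> h2 _ [c2 ej2 e1 e2]; split=> //; split=> //= i hi.
    by case: (eqVneq i j) hi => [->|ne] hi //; rewrite e2 // hpf //; lia.
rewrite /hcost /=; nia.
Qed.

Definition ctxB h := ctxP h /\ forall v, v <= n ->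
  ha h rBN 0 v = size (bk n v) /\
  forall i, i < size (bk n v) -> ha h rBK v i = nth 0 (bk n v) i.

Lemma runs_BK h : ctxP h -> (forall v, ha h rBN 0 v = 0) ->
  runs D cBK h (100 * n) ctxB.
Proof.
move=> c0 hz; have [[[[[eN _ _] _ _] _] _] _] := c0; rewrite /cBK; eapply runs_weak.
  eapply (@runs_forc _ _ _ _ _ (fun j h1 => ctxP h1 /\ forall v, v <= n ->
    ha h1 rBN 0 v = size (bk j v) /\
    forall i, i < size (bk j v) -> ha h1 rBK v i = nth 0 (bk j v) i) 0 n) => //=; try lia.
  - by move=> j h1 _ [[[[[[-> _ _] _ _] _] _] _] _] _.
  - move=> j h1 hj [c1 hb] ej; have [_ ePF] := c1.
    have hpj : j + pf j <= n by apply: pf_le; lia.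
    have [b1 b2] := hb (pf j) (ltac:(lia)); have hsb := size_bk j (pf j).
    do 2 vc_step; rewrite /= ?ej ?ePF //; try lia.
    do 2 vc_step; rewrite /= ?ej ?b1 //; try lia.
    vc_step; rewrite /= ?ej ?b1 //; try lia.
    split=> //; split=> //= v hv; rewrite bkS /upa /=.
    have [b3 b4] := hb v hv.
    rewrite [pf j == v]eq_sym.
    case: (eqVneq v (pf j)) => [E|ne]; rewrite ?b3 //= ?size_rcons ?E ?addn1.
    split=> // i hi; rewrite nth_rcons.
    case: (ltngtP i (size (bk j (pf j)))) hi => h1' // hi.
    + by rewrite b2.
    + lia.
rewrite /hcost /=; lia.
Qed.

(** * Enumerating the classes at a position, and refining them *)

Definition ctxC t m h := [/\ ctxB h, hr h vT = t, hr h vM = m,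
  repok t (ha h rRep 0) & forall j, j < n -> (ha h rBad 0 j != 0) = bad t j].

Definition sfree c :=
  [&& ~~ has (fun x => x \in mr c) [:: vN; vS; vK; vM; vT], ~~ mi c &
      ~~ has (fun x => x \in ma c) [:: rNN; rQ; rZ; rPF; rBK; rBN; rRep; rBad]].

Lemma ctxB_fr c h h' : frame c h h' -> ctxB h -> 
  [&& ~~ has (fun x => x \in mr c) [:: vN; vS; vK], ~~ mi c &
      ~~ has (fun x => x \in ma c) [:: rNN; rQ; rZ; rPF; rBK; rBN]] -> ctxB h'.
Proof.
move=> F [[b1 b2] b3] /and3P[/hasPn m1 m2 /hasPn m3].
have M x : x \in [:: vN; vS; vK] -> x \notin mr c by apply: m1.
have A x : x \in [:: rNN; rQ; rZ; rPF; rBK; rBN] -> x \notin ma c by apply: m3.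
have bz : ctxZ h'.
  by apply: ctxZ_fr F b1 _; rewrite m2 !M // !A.
case: F => f1 f2 f3.
by split; [split|]; rewrite // !f3 ?A.
Qed.

Lemma ctxC_fr t m c h h' : frame c h h' -> ctxC t m h -> sfree c -> ctxC t m h'.
Proof.
move=> F [b1 b2 b3 b4 b5] /and3P[m1 m2 m3].
have M x : x \in [:: vN; vS; vK; vM; vT] -> x \notin mr c by move: x; apply/hasPn.
have A x : x \in [:: rNN; rQ; rZ; rPF; rBK; rBN; rRep; rBad] -> x \notin ma c.
  by move: x; apply/hasPn.
have bB : ctxB h'.
  apply: ctxB_fr F b1 _; rewrite m2 /=.
  by rewrite !(negPf (M _ _)) // !(negPf (A _ _)).
case: F => f1 f2 f3.
by split; rewrite ?f1 ?M ?f3 ?A.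
Qed.

Lemma runs_match t m h c j : ctxC t m h -> t <= k -> hr h vC = c -> hr h vJ = j ->
  c < n -> def t c -> (forall r, r < t -> j + q r < n) ->
  runs D cMatch h (500 * t.+1) (fun h' => hr h' vOk = occW t c j).
Proof.
move=> c0 tk eC eJ hc /all_iota dc hj; have hkn := k_le_n.
rewrite /cMatch; eapply runs_weak.
  do 2 vc_step => //=; first lia.
  eapply (@runs_forc _ _ _ _ _ (fun r h1 => [/\ ctxC t m h1, hr h1 vC = c,
    hr h1 vJ = j & hr h1 vOk = occW r c j]) 0 t) => //=; try lia.
  - by move=> r h1 _ [[_ -> _ _ _] _ _ _] _.
  - move=> r h1 hr' [c1 eC1 eJ1 eO] er; have [[[[c2 _] _] _] _ _ _ _] := c1.
    have [[_ _ eQ] _] := c2; have [q1 q2] := q_lt (leq_trans hr' tk).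
    have /andP[d0 d1] := dc r hr'; have hcr := dl_range d0; have hjr := hj r hr'.
    do 2 vc_step; rewrite /= ?er ?eQ //; try lia.
    vc_step; set h2 := sr h1 _ _.
    have b2 : base h2 by case: c2 => [[]].
    have c22 : ctx2 h2 by [].
    have l1 : hev (HR vA) h2 < n by [].
    have l2 : hev (HR vC |+| HR vA)%H h2 < n by rewrite /= eC1.
    eapply runs_inter; rewrite ?(ev_X b2 l1) ?(ev_X b2 l2) ?X_lt // ?ok_X //.
    have -> : inter (X (hev (HR 13) h2)) (X (hev (HR 6 |+| HR 13)%H h2)) = dl r c.
      by rewrite /= eC1 /dl hcr.
    vc_step; set h3 := sr h2 _ _.
    have b3 : base h3 by []. have c33 : ctx2 h3 by [].
    have l3 : hev (HR vJ |+| HR vA)%H h3 < n by rewrite /= eJ1.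
    eapply runs_inter; rewrite ?(ev_X b3 l3) ?X_lt // ?ok_X //=; try lia.
    rewrite eJ1 subn1 inter_solid; last lia.
    have hO : occW r.+1 c j = occW r c j && mb (X (j + q r)) (dl r c).-1.
      by rewrite /occW allS hjr.
    rewrite hO; eapply runs_if => //=.
    + by case: (mb _ _) => // _; vc_step; split=> //; split=> //=; rewrite andbT.
    + by case: (mb _ _) => // _; vc_step => //=; [lia|]; rewrite andbF; split.
  - by move=> h1 [].
by rewrite /hcost /=; lia.
Qed.

(** [J P] describes the state in which exactly the classes in [P] have been processed. It must
    depend on the arrays alone, so that counters and flags of the loop do not disturb it. *)
Lemma runs_foreach t m j body Bb (J : (nat -> bool) -> hst -> Prop) h :
  sfree body && ~~ has (fun x => x \in mr body) [:: vJ; vC; vHi] ->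
  ctxC t m h -> hr h vJ = j -> j < n -> t <= k ->
  (forall r, r < t -> j + q r < n) ->
  J (fun=> false) h ->
  (forall P h h', J P h -> (forall r, ha h' r = ha h r) -> J P h') ->
  (forall P P' h, (forall c, c < n -> P c = P' c) -> J P h -> J P' h) ->
  (forall P c h1, c < n -> ha h rRep 0 c = c -> def t c -> occW t c j -> ~~ P c ->
     ctxC t m h1 -> hr h1 vC = c -> hr h1 vJ = j -> J P h1 ->
     runs D body h1 Bb (J (fun c' => P c' || (c' == c)))) ->
  runs D (cForEach body) h
    (80 + (if bad t j then n else 1) * (550 * t.+1 + Bb))
    (fun h' => [/\ ctxC t m h', hr h' vJ = j &
       J (fun c => (ha h rRep 0 c == c) && occW t c j) h']).
Proof.
move=> /andP[sf /hasPn hm] c0 eJ hj tk hjq J0 Jst Jext hbody; have hkn := k_le_n.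
have [cB eT eM R hB] := c0; set f := ha h rRep 0 in R *.
have [[[[[[eN _ _] _ _] _] _] _] _] := cB.
have Rn : f j <= n.
  have [R1 _] := R; have := R1 j hj; case: ifP => _; first by case=> /ltnW.
  by move=> ->.
pose lo := if bad t j then 0 else f j.
pose hi := if bad t j then n else if f j < n then (f j).+1 else f j.
have hlohi : lo <= hi <= n by rewrite /lo /hi; case: (bad t j) => //; case: ltnP; lia.
rewrite /cForEach; eapply runs_weak.
  do 2 vc_step => //=; rewrite ?eJ -/f; try lia.
  do 2 vc_step => //=; try lia.
  eapply runs_seqc with (P := fun h1 => [/\ ha h1 = ha h, hr h1 vLo = lo, hr h1 vJ = j,
      hr h1 vHi = if bad t j then n else (f j).+1 & ctxC t m h1]).
    eapply runs_if; rewrite /= ?eJ ?hB //; first (by lia); move=> hb.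
    + do 2 vc_step => //=; first lia.
      by vc_step => //=; rewrite ?eN; [lia|]; rewrite /lo hb; split.
    + have hb' : bad t j = false by rewrite -hB // hb.
      by vc_step; rewrite /lo hb'; split=> //=; rewrite addn1.
  move=> h1 _ [ea1 eL1 eJ1 eH1 c1].
  eapply runs_seqc with (P := fun h1 => [/\ ha h1 = ha h, hr h1 vLo = lo, hr h1 vJ = j,
      hr h1 vHi = hi & ctxC t m h1]).
    have [[[[[[[eN1 _ _] _ _] _] _] _] _] _ _ _ _] := c1.
    eapply runs_if => //=; rewrite eL1 eN1.
    + case: ltnP => // hlt _; vc_step; split=> //; rewrite eH1 /hi.
      by move: hlt; rewrite /lo; case: (bad t j) => // ->.
    + case: ltnP => // hge _; vc_step => //=; rewrite eL1; first lia.
      split=> //=; move: hge; rewrite /lo /hi; case: (bad t j) => //; first lia.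
      by case: ltnP => //; lia.
  move=> h2 _ [ea2 eL2 eJ2 eH2 c2].
  eapply (@runs_forc _ _ _ _ _ (fun c h3 => [/\ ctxC t m h3, hr h3 vJ = j, hr h3 vHi = hi,
    ha h3 rRep = ha h rRep &
    J (fun c' => [&& lo <= c' < c, f c' == c' & occW t c' j]) h3]) lo hi) => //=; try lia.
  - split=> //; first by rewrite ea2.
    apply: (Jst _ h); last by move=> r; rewrite /= ea2.
    by apply: Jext J0 => c hc; rewrite ltnNge; case: leqP.
  - by move=> c h3 _ [_ _ -> _ _] _.
  - move=> c h3 hc [c3 eJ3 eH3 eR3 J3] eC3.
    have hcn : c < n by lia.
    have JS (b : bool) h4 : b = (f c == c) && occW t c j ->
        J (fun c' => [&& lo <= c' < c, f c' == c' & occW t c' j] || b && (c' == c)) h4 ->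
        J (fun c' => [&& lo <= c' < c.+1, f c' == c' & occW t c' j]) h4.
      move=> eb; apply: Jext => c' hc'; rewrite ltnS [c' <= c]leq_eqVlt.
      case: (eqVneq c' c) => [->|ne] /=; last by rewrite andbF orbF.
      rewrite ltnn andbF /= andbT eb; case/andP: hc => -> _ //.
    eapply runs_if; rewrite /= ?eC3 ?eR3 -/f; first lia.
    + case: (eqVneq (f c) c) => // fc _; have dc : def t c by rewrite -(repok_def R hcn) fc.
      eapply runs_seqc; first exact: runs_match c3 tk eC3 eJ3 hcn dc hjq.
      move=> h4 F4 eO; have c4 := ctxC_fr F4 c3 isT; case: F4 => F1 F2 F3.
      have ea4 r : ha h4 r = ha h3 r by rewrite F3.
      have J4 := Jst _ _ _ J3 ea4.
      eapply runs_if => //=; rewrite eO.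
      * case: (boolP (occW t c j)) => // oc _.
        have eR4 : ha h4 rRep = ha h rRep by rewrite ea4.
        eapply runs_post; first eapply (hbody (fun c' => [&& lo <= c' < c, f c' == c' & occW t c' j]) c h4 hcn) => //.
        -- by rewrite ltnn andbF.
        -- by rewrite F1.
        -- by rewrite F1.
        move=> h5 F5 J5; have c5 := ctxC_fr F5 c4 sf; case: F5 => G1 G2 G3.
        have hmx x : x \in [:: vJ; vC; vHi] -> hr h5 x = hr h3 x.
          by move=> hx; rewrite G1 ?F1 //; [move: hx; rewrite !inE => /or3P[] /eqP->|apply: hm].
        split; first by rewrite hmx.
        split=> //=; try by rewrite hmx.
        -- rewrite G3 ?eR4 //; case/and3P: sf => _ _ /hasPn; apply; by rewrite !inE.
        -- apply: (JS true); first by rewrite fc eqxx oc.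
           by apply: (Jst _ h5) => //; apply: Jext J5 => c' _.
      * case: (boolP (occW t c j)) => // noc _; vc_step.
        split; first by rewrite F1.
        split=> //=; rewrite ?F1 ?ea4 //.
        apply: (JS false); first by rewrite (negPf noc) andbF.
        by apply: (Jst _ h4) => //; apply: Jext J4 => c' _; rewrite orbF.
    + case: (eqVneq (f c) c) => // nfc _; vc_step; split=> //; split=> //=.
      apply: (JS false); first by rewrite (negPf nfc).
      by apply: (Jst _ h3) => //; apply: Jext J3 => c' _; rewrite orbF.
  - move=> h3 [c3 eJ3 _ _ J3] _; split=> //; apply: Jext J3 => c hc.
    case: (boolP ((f c == c) && occW t c j)) => hcj; last by rewrite andbF.
    rewrite andbT; case/andP: hcj => /eqP fc oc.
    have dc : def t c by rewrite -(repok_def R hc) fc.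
    rewrite /lo /hi; case: (boolP (bad t j)) => hb; first by rewrite hc.
    (* No non-solid symbol is met, so a class that fits at j is the class of j, the one visited. *)
    have [dj ej] := occ_good tk hjq dc oc hb.
    have [_ R2] := R; have e := R2 c j hc hj dc ej.
    by rewrite -e fc leqnn hc ltnSn.
set W := if bad t j then n else 1.
have hW : hi - lo <= W.
  by rewrite /W /hi /lo; case: (bad t j); [lia|case: ltnP; lia].
rewrite /hcost /=; nia.
Qed.

(** Before the refinement to t + 1, the stamp t + 1 thus occurs nowhere and the whole table is
    stale. *)
Definition stamps t h := forall o e, ha h rStp o e <= t.

Lemma runs_refine t m h : ctxC t m h -> 0 < m <= n -> s <= X m.-1 ->
  t = size (ks m.-1) -> stamps t h ->
  runs D cRefine h (800 * n) (fun h' => ctxC t.+1 m h' /\ stamps t.+1 h').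
Proof.
move=> [cB eT eM R hB] hm hX et hst; have hkn := k_le_n.
have hm1 : m.-1 < n by lia.
have [qt tk] := q_X hm1 hX; rewrite (hXs hm1 hX) -et addKn in qt tk.
set f0 := ha h rRep 0 in R.
pose I j h1 := [/\ [/\ ctxB h1, hr h1 vT = t.+1, hr h1 vM = m & hr h1 vP = q t],
  refining t f0 j (ha h1 rRep 0) (ha h1 rTbl) (ha h1 rStp), stamps t.+1 h1 &
  forall i, i < n -> (ha h1 rBad 0 i != 0) = if i < j then bad t.+1 i else bad t i].
rewrite /cRefine; eapply runs_weak.
  do 2 vc_step; rewrite /= ?eM; try lia.
  do 2 vc_step; rewrite /= ?eT; try lia.
  eapply (@runs_forc _ _ _ _ _ I 0 n) => //=; try lia.
  - split=> //=; first by split=> //=; lia.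
    + by split=> // o e /= E; have := hst o e; rewrite E ltnn.
    + by move=> o e /=; have := hst o e; lia.
  - by move=> j h1 _ [[[[[[[[-> _ _] _ _] _] _] _] _] _ _ _] _ _ _] _.
  - move=> j h1 hj [[c1 eT1 eM1 eP1] hrf hst1 hb1] ej.
    have [[[c2 _] _] _] := c1; have [[b1 _ _] _] := c2; have [eN1 eS1 _] := b1.
    have [r1 _ _ _ _] := hrf; have efj := r1 j (leqnn j).
    have fjn : f0 j <= n.
      by case: R => R1 _; have := R1 j hj; case: ifP => _; [case=> /ltnW|move->].
    have Bd h2 (v : bool) : (forall i, ha h2 rBad 0 i = if i == j then (if v then 1 else ha h1 rBad 0 j) else ha h1 rBad 0 i) ->
       v = (j + q t < n) && (s <= X (j + q t)) ->
       forall i, i < n -> (ha h2 rBad 0 i != 0) = if i < j.+1 then bad t.+1 i else bad t i.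
      move=> hv ev i hi; rewrite hv ltnS leq_eqVlt; case: (eqVneq i j) => [->|ne] /=.
        by rewrite badS -ev; case: (v) => /=; rewrite ?orbT ?orbF ?hb1 // ltnn.
      by apply: hb1.
    have [hlt|hge] := ltnP (j + q t) n; last first.
      eapply (@runs_weak _ _ _ _ 500); first eapply runs_ifF => //=.
      + by rewrite ej eP1 eN1 ltnNge hge.
      + vc_step; rewrite /= ?ej ?eN1; try lia.
        split=> //; split=> //=.
        * apply: refining_undef hrf hj _ _ => [|i]; last by rewrite /upa.
          by rewrite defS /dl [_ < n]ltnNge hge andbF.
        * apply: (Bd _ false) => [i|] /=; last by rewrite ltnNge hge.
          by case: eqP => [->|].
      + by rewrite /hcost /=; lia.
    eapply (@runs_weak _ _ _ _ 500); first eapply runs_ifT => //=.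
    + by rewrite ej eP1 eN1 hlt.
    + have oJ : ok D (HR vJ |+| HR vP)%H h1 by [].
      have lJ : hev (HR vJ |+| HR vP)%H h1 < n by rewrite /= ej eP1.
      have E2 := ev_X b1 lJ; have O2 := ok_X b1 oJ lJ.
      eapply runs_seqc with (P := fun h2 => [/\ ctxB h2, hr h2 vJ = j /\ ha h2 rRep = ha h1 rRep,
          [/\ hr h2 vT = t.+1, hr h2 vM = m & hr h2 vP = q t],
          ha h2 rTbl = ha h1 rTbl /\ ha h2 rStp = ha h1 rStp &
          forall i, i < n -> (ha h2 rBad 0 i != 0) = if i < j.+1 then bad t.+1 i else bad t i]).
        eapply runs_if.
        * by move: O2 => /= ->.
        * have -> : (hev (eX (HR vJ |+| HR vP) |<| HR vS)%H h1 != 0) = (X (j + q t) < s).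
            by move: E2 => /= ->; rewrite eS1 ej eP1; case: ltnP.
          move=> hX1; vc_step; split=> //; apply: (Bd _ false) => [i|].
            by case: eqP => [->|].
          by rewrite hlt leqNgt hX1.
        * have -> : (hev (eX (HR vJ |+| HR vP) |<| HR vS)%H h1 = 0) <-> (s <= X (j + q t)).
            by move: E2 => /= ->; rewrite eS1 ej eP1; case: ltnP.
          move=> hX1; vc_step; rewrite /= ?ej; try lia.
          split=> //; apply: (Bd (sa h1 rBad 0 j 1) true) => [i|]; last by rewrite hlt hX1.
          by rewrite /= /upa /=; case: (i == j).
      move=> h2 _ [c2' [ej2 eR2] [eT2 eM2 eP2] [etb2 est2] hb2].
      have [[[c22 _] _] _] := c2'; have [[b2 _ _] _] := c22; have [eN2 eS2 _] := b2.
      do 2 vc_step; rewrite /= ?ej2 ?eR2 ?efj; try lia.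
      vc_step; set h3 := sr h2 _ _.
      have c33 : ctx2 h3 by []. have b3 : base h3 by [].
      have l3 : hev (HR vJ |+| HR vP)%H h3 < n by rewrite /= ej2 eP2.
      have l4 : hev (HR vP) h3 < n by rewrite /= eP2; case: (q_lt tk).
      eapply runs_inter; rewrite ?(ev_X b3 l3) ?(ev_X b3 l4) ?X_lt // ?ok_X //.
      rewrite /= ej2 eP2.
      have -> : inter (X (q t)) (X (j + q t)) = dl t j by rewrite /dl hlt.
      have hdl : dl t j <= s.+1 by rewrite /dl hlt inter_le.
      have edef : def t.+1 j = (f0 j < n) && (0 < dl t j) && (dl t j < s + 1).
        by rewrite defS -(repok_def R hj) addn1 ltnS andbA.
      eapply runs_if => //=; rewrite eN2 eS2; case: (boolP (def t.+1 j)) edef => dj edef.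
      * move=> _; case/andP: (esym edef) => /andP[d1 d2] d3.
        eapply runs_if; rewrite /= ?est2 ?eT2; first lia.
        -- case: (eqVneq (ha h1 rStp (f0 j) (dl t j)) t.+1) => // hs1 _.
           have [i [a1 a2 a3 a4 a5]] : exists i, [/\ i < j, def t.+1 i,
               f0 i = f0 j, dl t i = dl t j & ha h1 rRep 0 i = ha h1 rTbl (f0 j) (dl t j)].
             by case: hrf => _ _ _ r4 _; apply: r4.
           have hle : ha h1 rTbl (f0 j) (dl t j) <= i.
             by case: hrf => _ r2 _ _ _; have := r2 i a1; rewrite a2 a5 => - [].
           vc_step; rewrite /= ?ej2 ?etb2; try lia.
           split=> //; split=> //=.
           ++ rewrite est2 etb2; apply: refining_old hrf hj dj hs1 _ => // i'.
              by rewrite /upa eR2.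
           ++ by move=> o e /=; rewrite est2; apply: hst1.
        -- case: (eqVneq (ha h1 rStp (f0 j) (dl t j)) t.+1) => // /eqP hs1 _.
           do 2 vc_step; rewrite /= ?eT2; try lia.
           do 2 vc_step; rewrite /= ?ej2; try lia.
           vc_step; rewrite /= ?ej2; try lia.
           split=> //; split=> //=.
           ++ apply: refining_new hrf hj dj hs1 _ _ _ => // [i'|o e|o e].
              ** by rewrite /upa eR2.
              ** by rewrite /upa etb2.
              ** by rewrite /upa est2.
           ++ by move=> o e /=; rewrite /upa est2; case: ifP => // _; apply: hst1.
      * by move: edef; case: (f0 j < n); case: (0 < dl t j); case: (dl t j < s + 1).
      * by move: edef; case: (f0 j < n); case: (0 < dl t j); case: (dl t j < s + 1).
      * move=> _; vc_step; rewrite /= ?ej2 ?eN2; try lia.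
        split=> //; split=> //=.
        -- rewrite est2 etb2; apply: refining_undef hrf hj dj _ => i'.
           by rewrite /upa eR2.
        -- by move=> o e /=; rewrite est2; apply: hst1.
    + by rewrite /hcost /=; lia.
  - move=> h1 [[c1 eT1 eM1 eP1] [r1 r2 r3 r4 r5] hst1 hb1] _; split=> //; split=> //.
    + split=> [j hj|i j hi hj]; last exact: r3.
      by have := r2 j hj; case: ifP => // _ [h1' h2 h3]; split=> //; lia.
    + by move=> j hj; rewrite hb1 // hj.
by rewrite /hcost /=; lia.
Qed.

(* [O c] is the occurrence list of the class [c]; the gap of a [dead] class,
   one without an odot-prefix, is set to the infeasible value [n.+1]. *)
Definition dat (f mp : nat -> nat) m (O : nat -> nat -> bool) (dead : nat -> bool) h :=
  [/\ forall c, c < n -> f c = c -> linked (O c) (ha h rNxt c) (ha h rPrv c),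
      forall c, c < n -> f c = c -> [/\ ha h rGap 0 c <= n.+1,
        m <= mp c -> ismaxgap (O c) (ha h rGap 0 c) &
        dead c -> ha h rGap 0 c = n.+1]
    & forall g, g <= n.+1 -> ha h rCnt 0 g =
        count (fun c => (f c == c) && (ha h rGap 0 c == g)) (iota 0 n)].

Definition Inv m h := [/\ ctxC (size (ks m)) m h, stamps (size (ks m)) h,
  mpok (ha h rRep 0) (ha h rMp 0) &
  dat (ha h rRep 0) (ha h rMp 0) m (occurs m) (fun c => ha h rMp 0 c < m) h].

(** * Building the occurrence lists *)

Definition class_list (O : nat -> nat -> bool) c j h :=
  plist (O c) j (ha h rNxt c) (ha h rPrv c) (ha h rLast 0 c) (ha h rGap 0 c).

Lemma runs_append (O : nat -> nat -> bool) h c j : hr h vC = c -> hr h vJ = j -> c < n -> j <= n ->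
  O c j -> class_list O c j h ->
  runs D cAppend h 100 (fun h' => [/\ class_list O c j.+1 h',
    forall c' j', c' != c -> class_list O c' j' h -> class_list O c' j' h',
    forall c' x, c' != c -> ha h' rNxt c' x = ha h rNxt c' x /\ ha h' rPrv c' x = ha h rPrv c' x,
    ha h' rGap 0 c <= maxn (ha h rGap 0 c) n &
    forall c', c' != c -> ha h' rGap 0 c' = ha h rGap 0 c']).
Proof.
move=> eC eJ hc hj oj hP; have [/andP[p0 p1] _ _ _] := hP.
rewrite /cAppend; eapply runs_weak.
  do 2 vc_step; rewrite /= ?eC; try lia.
  do 2 vc_step; rewrite /= ?eC ?eJ; try lia.
  do 2 vc_step; rewrite /= ?eC ?eJ; try lia.
  set h1 := sa _ _ _ _ _.
  eapply runs_seqc with (P := fun h2 => [/\ ha h2 rGap 0 c = maxn (ha h rGap 0 c) (j - ha h rLast 0 c),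
    forall c', c' != c -> ha h2 rGap 0 c' = ha h rGap 0 c' &
    [/\ hr h2 vC = c, hr h2 vJ = j, ha h2 rNxt = ha h1 rNxt, ha h2 rPrv = ha h1 rPrv
      & ha h2 rLast = ha h rLast]]).
    eapply runs_if; rewrite /= ?eC ?eJ; first lia.
    + case: ltnP => // hlt _; vc_step; rewrite /= ?eC ?eJ; try lia.
      split=> //; rewrite /upa ?eqxx /=; first by lia.
      by move=> c' ne; rewrite (negPf ne).
    + by case: ltnP => // hlt _; vc_step; split=> //=; lia.
  move=> h2 _ [g1 g2 [eC2 eJ2 en ep el]].
  vc_step; rewrite /= ?eC2 ?eJ2; try lia.
  split=> //=.
  - rewrite /class_list /= /upa !eqxx /= g1 en ep /= /upa.
    apply: plist_ext (plist_append oj hP) => x; by rewrite eqxx.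
  - move=> c' j' ne; rewrite /class_list /= /upa (negPf ne) andbF el g2 // en ep /=.
    by apply: plist_ext => x; rewrite /upa (negPf ne).
  - by move=> c' x ne; rewrite en ep /= /upa (negPf ne).
  - by rewrite g1; lia.
by [].
Qed.

Lemma class_list_final m c h : class_list (occS m) c n.+1 h ->
  linked (occurs m c) (ha h rNxt c) (ha h rPrv c) /\
  ismaxgap (occurs m c) (ha h rGap 0 c).
Proof.
move=> [/andP[p0 p1] p2 p3 p4]; split; [|split].
- by move=> a b /consecP /p3 [].
- by move=> a b /consecP /p3 [].
- case: p4 => [/andP[_ /eqP e0]|[a [b [/consecP h1 h2]]]]; last by exists a, b.
  have := p2 n; rewrite e0 /occS eqxx ltnSn andbT; lia.
Qed.

Lemma runs_build m h : ctxC (size (ks m)) m h -> stamps (size (ks m)) h ->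
  0 < m <= n ->
  runs D cBuild h (1500 * (k.+1 * (n * (k * k).+1))) (Inv m).
Proof.
move=> c0 st0 hm; have hkn := k_le_n; set t := size (ks m) in c0 st0.
have tk : t <= k by apply: ks_size; lia.
have [_ _ _ R0 _] := c0; set f := ha h rRep 0 in R0.
have ctxC_N h1 : ctxC t m h1 -> hr h1 vN = n by case=> [[[[[[[-> _ _] _ _] _] _] _] _]].
have ctxC_PF h1 : ctxC t m h1 -> forall j, j < n -> ha h1 rPF 0 j = pf j by case=> [[[_ ?] _]].
have fle j : j < n -> f j <= n.
  by move=> hj; case: R0 => R1 _; have := R1 j hj; case: ifP => _; [case=> /ltnW|move->].
have fdef c : c < n -> f c = c -> def t c by move=> hc e; rewrite -(repok_def R0 hc) e.
have fun_c c : c < n -> f c = c -> occS m c 0.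
  move=> hc e; rewrite /occS /occurs pf0 occW0 ?fdef //; lia.
pose C1 h1 := [/\ ctxC t m h1, stamps t h1 & ha h1 rRep 0 = f].
rewrite /cBuild; eapply runs_weak.
  eapply runs_seqc with (P := fun h1 => C1 h1 /\ forall g, g < n + 2 -> ha h1 rCnt 0 g = 0).
    eapply (@runs_forc _ _ _ _ _ (fun i h1 => C1 h1 /\ forall g, g < i -> ha h1 rCnt 0 g = 0) 0 (n + 2)) => //=; try lia.
    + by move=> i h1 _ [[/ctxC_N -> _ _] _] _.
    + move=> i h1 hi [c1 hz] ei; vc_step; rewrite /= ?ei; try lia.
      split=> //; split=> //= g hg; rewrite /upa /=.
      by case: (eqVneq g i) hg => [//|ne] hg; apply: hz; lia.
  move=> h1 _ [c1 z1].
  eapply runs_seqc with (P := fun h2 => [/\ C1 h2, forall g, g < n + 2 -> ha h2 rCnt 0 g = 0 &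
     forall c, c < n -> [/\ ha h2 rMp 0 c = 0, ha h2 rLast 0 c = 0 & ha h2 rGap 0 c = 0]]).
    eapply (@runs_forc _ _ _ _ _ (fun i h1 => [/\ C1 h1, forall g, g < n + 2 -> ha h1 rCnt 0 g = 0 &
       forall c, c < i -> [/\ ha h1 rMp 0 c = 0, ha h1 rLast 0 c = 0 & ha h1 rGap 0 c = 0]]) 0 n) => //=; try lia.
    + by move=> i h2 _ [[/ctxC_N -> _ _] _ _] _.
    + move=> i h2 hi [c2 z2 hz] ei; do 2 vc_step; rewrite /= ?ei; try lia.
      do 2 vc_step; rewrite /= ?ei; try lia.
      vc_step; rewrite /= ?ei; try lia.
      split=> //; split=> //= c hc; rewrite /upa /=.
      by case: (eqVneq c i) hc => [//|ne] hc; apply: hz; lia.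
  move=> h2 _ [c2 z2 q2].
  pose Q3 h3 := [/\ C1 h3, forall g, g < n + 2 -> ha h3 rCnt 0 g = 0 &
     forall c, c < n -> ha h3 rLast 0 c = 0 /\ ha h3 rGap 0 c = 0].
  eapply runs_seqc with (P := fun h3 => Q3 h3 /\ mpok f (ha h3 rMp 0)).
    eapply (@runs_forc _ _ _ _ _ (fun i h3 => Q3 h3 /\ forall c, c < n ->
       (forall j, j < i -> f j = c -> pf j <= ha h3 rMp 0 c) /\
       (ha h3 rMp 0 c = 0 \/ exists j, [/\ j < n, f j = c & pf j = ha h3 rMp 0 c])) 0 n) => //=; try lia.
    + split; first by split=> // c hc; have [] := q2 c hc.
      by move=> c hc; have [-> _ _] := q2 c hc; split=> //; left.
    + by move=> i h3 _ [[[/ctxC_N -> _ _] _ _] _] _.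
    + move=> j h3 hj [[c3 z3 q3] hmp] ej; have [cc3 _ ef3] := c3.
      have pj := pf_le (ltnW hj); have eN := ctxC_N _ cc3; have eP := ctxC_PF _ cc3.
      have fj := fle j hj.
      do 2 vc_step; rewrite /= ?ej ?ef3; try lia.
      eapply runs_if; rewrite /= ?ej ?ef3 ?eN ?eP //; first lia.
      * case: (ltnP (f j)) => // hfn; case: ltnP => // hlt _.
        vc_step; rewrite /= ?ej ?ef3 ?eP //; try lia.
        split=> //; split=> //= c hc; rewrite /upa /=.
        case: (eqVneq c (f j)) => [->|ne].
          have [h1' h2'] := hmp (f j) hfn.
          split; last by right; exists j.
          move=> i hi fi; case: (eqVneq i j) => [->//|ne].
          by apply: leq_trans (h1' i _ fi) (ltnW hlt); lia.
        have [h1' h2'] := hmp c hc; split=> // i hi fi; apply: h1' => //.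
        by case: (eqVneq i j) => [ei|]; [move: ne; rewrite -fi ei eqxx|lia].
      * move=> hno; vc_step; split=> //; split=> //= c hc.
        have [h1' h2'] := hmp c hc; split=> // i hi fi.
        case: (eqVneq i j) => [ei|ne]; last by apply: h1' => //; lia.
        by move: hno; rewrite -ei fi hc; case: ltnP.
    + move=> h3 [q3 hmp] _; split=> // c hc fc; have [h1' h2'] := hmp c hc.
      split=> //; case: h2' => // e0; exists c; split=> //.
      by have := h1' c hc fc; lia.
  move=> h3 _ [[c3 z3 q3] mp3]; set mp := ha h3 rMp 0 in mp3.
  pose C2 h4 := [/\ C1 h4, forall g, g < n + 2 -> ha h4 rCnt 0 g = 0 & ha h4 rMp 0 = mp].
  eapply runs_seqc with (P := fun h4 => C2 h4 /\ forall c, c < n -> f c = c ->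
      class_list (occS m) c n h4 /\ ha h4 rGap 0 c <= n).
    eapply (@runs_for _ _ _ _ _ (fun j h4 => C2 h4 /\ forall c, c < n -> f c = c ->
        class_list (occS m) c j h4 /\ ha h4 rGap 0 c <= n) 1 n
        (fun j => 150 + (if bad t j then n else 1) * (550 * t.+1 + 100))) => //=; try lia.
    + split=> // c hc fc; have [e1 e2] := q3 c hc; rewrite /= e2; split=> //.
      rewrite /class_list /= e1 e2; split=> //; try by [move=> *; lia|left].
      * by rewrite fun_c.
      * by move=> a b [] *; lia.
    + by move=> j h4 _ [[[/ctxC_N -> _ _] _ _] _] _.
    + move=> j h4 hj [[c4 z4 em4] hP] ej; have [cc4 st4 ef4] := c4.
      have hjn : j < n by lia. have pj := pf_le (ltnW hjn).
      have [_ _ eM4 _ _] := cc4.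
      have hjq : m <= pf j -> forall r, r < t -> j + q r < n.
        move=> hpf r hr; have := hr; rewrite /t ks_lt; last by lia.
        by move=> /andP[_]; lia.
      have ocE c : occS m c j = (m <= pf j) && occW t c j.
        rewrite /occS /occurs hjn; case: eqP => //; lia.
      have step h5 : ha h5 rMp = ha h4 rMp -> ha h5 rCnt = ha h4 rCnt -> 
         ha h5 rStp = ha h4 rStp -> ha h5 rRep = ha h4 rRep ->
         ctxC t m h5 -> C2 (sr h5 vJ j.+1).
        by move=> e1 e2 e3 e4 c5; split; [split=> //= [o e|]; rewrite ?e3 ?e4| rewrite /= e2 | rewrite /= e1].
      have [hpf|hpf] := ltnP (pf j) m.
        eapply runs_weak; first eapply runs_ifT => //=.
        * by rewrite ej; lia.
        * by rewrite ej eM4 ctxC_PF // hpf.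
        * vc_step; split=> //; split=> // c hc fc; have [h1' h2'] := hP c hc fc.
          by split=> //; apply: plist_skip => //; rewrite ocE; lia.
        * by rewrite /hcost /=; lia.
      eapply runs_weak; first eapply runs_ifF => //=.
      * by rewrite ej; lia.
      * by rewrite ej eM4 ctxC_PF // ltnNge hpf.
      * eapply runs_post.
          eapply (@runs_foreach t m j cAppend 100 (fun P h5 => forall c, c < n -> f c = c ->
             class_list (occS m) c (if P c then j.+1 else j) h5 /\ ha h5 rGap 0 c <= n)) => //.
          -- by apply: hjq.
          -- move=> P h5 h6 hp e c hc fc; rewrite /class_list !e; exact: hp.
          -- move=> P P' h5 e hp c hc fc; rewrite -e //; exact: hp.
          -- move=> P c h5 hc fc dc oc nP cc5 eC5 eJ5 hp; rewrite ef4 in fc *.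
             have [hp1 hp2] := hp c hc fc; rewrite (negPf nP) in hp1.
             eapply runs_post; first eapply (@runs_append (occS m) _ c); try eassumption; try lia.
             ++ by rewrite ocE hpf.
             ++ move=> h6 _ [a1 a2 _ a3 a4] c' hc' fc'.
                case: (eqVneq c' c) => [->|ne]; first by rewrite orbT; split=> //; lia.
                rewrite orbF a4 //; have [b1 b2] := hp c' hc' fc'.
                by split=> //; apply: a2.
        move=> h5 F [c5 ej5 J5]; case: (F) => F1 _ F3; split=> //; split.
          by apply: step; rewrite ?F3.
        move=> c hc fc; have [b1 b2] := J5 c hc fc; split=> //.
        move: b1; rewrite ef4 fc eqxx /=; case: ifP => // noc.
        by apply: plist_skip; rewrite ocE noc andbF.
      * by rewrite /hcost /=; lia.
  move=> h4 _ [c4 hP4].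
  do 2 vc_step => //=; try by have [[/ctxC_N -> _ _] _ _] := c4; lia.
  set h5 := sr h4 _ _.
  have eJ5 : hr h5 vJ = n by rewrite /=; have [[/ctxC_N -> _ _] _ _] := c4.
  (* Classes below c are closed by the sentinel and counted; the others still have their lists from
     the insertion phase. *)
  pose I c h6 := [/\ ctxC t m h6 /\ hr h6 vJ = n, stamps t h6, ha h6 rRep 0 = f /\ ha h6 rMp 0 = mp,
    forall c', c' < n -> f c' = c' -> if c' < c then
      [/\ linked (occurs m c') (ha h6 rNxt c') (ha h6 rPrv c'), ha h6 rGap 0 c' <= n.+1,
        m <= mp c' -> ismaxgap (occurs m c') (ha h6 rGap 0 c') &
        mp c' < m -> ha h6 rGap 0 c' = n.+1]
      else class_list (occS m) c' n h6 /\ ha h6 rGap 0 c' <= n &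
    forall g, g <= n.+1 -> ha h6 rCnt 0 g =
        count (fun c => (f c == c) && (ha h6 rGap 0 c == g)) (iota 0 c)].
  eapply (@runs_forc _ _ _ _ _ I 0 n) => //=; try lia.
  - split=> //=; try by have [[? ? ?] ? ?] := c4.
    by have [_ z4 _] := c4 => g hg; rewrite z4 //; lia.
  - by move=> c h6 _ [[/ctxC_N -> _] _ _ _ _] _.
  - move=> c h6 hc [[cc6 eJ6] st6 [ef6 em6] hcl hcnt] eC6.
    have cntS (G : nat -> nat) g : count (fun c => (f c == c) && (G c == g)) (iota 0 c.+1) =
        count (fun c => (f c == c) && (G c == g)) (iota 0 c) + ((f c == c) && (G c == g)).
      by rewrite -addn1 iotaD count_cat /= add0n addn0.
    have cnt_ext (G G' : nat -> nat) g : (forall c', c' != c -> G c' = G' c') ->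
       count (fun c => (f c == c) && (G c == g)) (iota 0 c) = count (fun c => (f c == c) && (G' c == g)) (iota 0 c).
      move=> hG; apply: eq_in_count => c'; rewrite mem_iota => hc'; rewrite hG //; lia.
    have eN6 := ctxC_N _ cc6; have [_ _ eM6 _ _] := cc6.
    have [nfc|fc] := boolP (f c != c).
      eapply (@runs_weak _ _ _ _ 250); first eapply runs_ifF => //=.
      + by rewrite eC6; lia.
      + by rewrite eC6 ef6 (negPf nfc).
      + vc_step; split=> //; split=> //.
        * move=> c' hc' fc'; have := hcl c' hc' fc'; rewrite ltnS [c' <= c]leq_eqVlt.
          case: (eqVneq c' c) => [e|ne]; first by move: nfc; rewrite -e fc' eqxx.
          by move=> H; exact: H.
        * by move=> g hg; rewrite cntS (negPf nfc) addn0 hcnt.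
      + by rewrite /hcost /=; lia.
    rewrite negbK in fc; have fce := eqP fc.
    have := hcl c hc fce; rewrite ltnn => - [hPc hgc].
    eapply (@runs_weak _ _ _ _ 250); first eapply runs_ifT => //=.
    + by rewrite eC6; lia.
    + by rewrite eC6 ef6 fc.
    + eapply runs_seqc; first eapply (@runs_append (occS m) _ c); try eassumption; try lia.
        by rewrite /occS eqxx.
      move=> h7 F7 [a1 a2 a0 a3 a4]; have [a5 a6] := class_list_final a1.
      have cc7 := ctxC_fr F7 cc6 isT; case: (F7) => F71 _ F73.
      have [_ _ eM7 _ _] := cc7; have eN7 := ctxC_N _ cc7.
      have eC7 : hr h7 vC = c by rewrite F71.
      have em7 : ha h7 rMp 0 = mp by rewrite F73.
      pose Gc := if mp c < m then n.+1 else ha h7 rGap 0 c.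
      have hGc : Gc <= n.+1 by rewrite /Gc; case: ifP => // _; lia.
      eapply runs_seqc with (P := fun h8 => [/\ ha h8 rGap 0 c = Gc,
         forall c', c' != c -> ha h8 rGap 0 c' = ha h7 rGap 0 c', ctxC t m h8 &
         [/\ hr h8 vC = c, hr h8 vJ = n & forall r, r != rGap -> ha h8 r = ha h7 r]]).
        eapply runs_if; rewrite /= ?eC7 ?em7 ?eM7; first lia.
        * case: ltnP => // hlt _; vc_step; rewrite /= ?eC7 ?eN7; try lia.
          split=> //=.
          -- by rewrite /upa !eqxx /Gc hlt addn1.
          -- by move=> c' ne; rewrite /upa (negPf ne).
          -- split=> //=; first by rewrite F71.
             by move=> r; rewrite upE => /negPf ->.
        * case: ltnP => // hlt _; vc_step; split=> //=.
          -- by rewrite /Gc ltnNge hlt.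
          -- by split=> //; rewrite F71.
      move=> h8 _ [g1 g2 cc8 [eC8 eJ8 eo8]].
      have hcntG : ha h8 rCnt 0 Gc = count (fun c => (f c == c) && (ha h6 rGap 0 c == Gc)) (iota 0 c).
        by rewrite eo8 // F73 // hcnt.
      have hcl2 : count (fun c => (f c == c) && (ha h6 rGap 0 c == Gc)) (iota 0 c) <= c.
        by apply: leq_trans (count_size _ _) _; rewrite size_iota.
      vc_step; rewrite /= ?eC8 ?g1 ?hcntG; try lia.
      split=> //; split=> //.
      * by move=> o e; rewrite /= eo8 // F73.
      * by rewrite /= !eo8 // F73.
      * move=> c' hc' fc'; rewrite ltnS [c' <= c]leq_eqVlt.
        case: (eqVneq c' c) => [->|ne].
          rewrite /= g1 !eo8 // /Gc; split=> //.
          -- by move=> hmc; rewrite ltnNge hmc.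
          -- by move=> ->.
        have := hcl c' hc' fc'; rewrite /= /class_list /= g2 // a4 // !eo8 //.
        case: ifP => _ [x1 x2].
          move=> x3 x4; split=> //.
          move=> a b hab; have [y1 y2] := x1 a b hab.
          by have [-> _] := a0 c' a ne; have [_ ->] := a0 c' b ne.
        by split=> //; have := a2 c' n ne x1; rewrite /class_list a4.
      * move=> g hg; rewrite cntS fc /= /upa /= g1.
        rewrite (cnt_ext (fun c => ha h8 rGap 0 c) (fun c => ha h6 rGap 0 c)); last first.
          by move=> c' ne; rewrite g2 // a4.
        case: (eqVneq g Gc) => [->|ne]; first by [].
        by rewrite addn0 -hcnt // eo8 // F73.
    + by rewrite /hcost /=; lia.
  - move=> h6 [[cc6 eJ6] st6 [ef6 em6] hcl hcnt] _; split; rewrite ?ef6 ?em6 //.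
    by split=> // c hc fc; have := hcl c hc fc; rewrite hc => - [].
have hsum := sum_bad (150 + hcost (HR vN) + 7) (550 * t.+1 + 100) tk.
have n0 : 0 < n by lia.
(* [sum_bad] counts from 0 whereas insertions start at 1; the surplus term is split off. *)
rewrite big_ltn // in hsum; set S0 := \sum_(1 <= i < n) _ in hsum.
set S1 := \sum_(1 <= i < n) _.
have eS : S1 = S0 by apply: eq_bigr => i _; lia.
rewrite eS; move: S0 hsum {eS S1} => S0.
case: (bad t 0) => hsum.
all: have h1 : t.+1 <= k.+1 by lia.
all: have h2 : n * t.+1 <= n * k.+1 by rewrite leq_mul2l h1 orbT.
all: have h3 : k * k * (n * t.+1) <= k * k * (n * k.+1) by rewrite leq_mul2l h2 orbT.
all: have h4 : k.+1 * (n * (k * k).+1) = n * k.+1 + k * k * (n * k.+1) by lia.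
all: have h5 : n <= n * k.+1 by rewrite leq_pmulr.
all: have h6 : k * k * n <= k * k * (n * k.+1) by rewrite leq_mul2l h5 orbT.
all: have h7 : n * (550 * t.+1 + 100) = 550 * (n * t.+1) + 100 * n by lia.
all: have h8 : k * k * (n * (550 * t.+1 + 100)) = 550 * (k * k * (n * t.+1)) + 100 * (k * k * n) by lia.
all: have h9 : n * (150 + hcost (HR vN) + 7 + (550 * t.+1 + 100)) =
  550 * (n * t.+1) + 258 * n by rewrite /hcost /=; lia.
all: rewrite h4; rewrite h8 h9 ?h7 in hsum.
all: clear - hsum h2 h3 h5 h6 n0.
all: rewrite /hcost /= in hsum *; lia.
Qed.

(** * Deleting occurrences *)

Definition cntok (f : nat -> nat) h := forall g, g <= n.+1 -> ha h rCnt 0 g =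
  count (fun c => (f c == c) && (ha h rGap 0 c == g)) (iota 0 n).

Lemma runs_setgap f h c g : cntok f h -> hr h vC = c -> hr h vD = g -> c < n ->
  f c = c -> g <= n.+1 -> ha h rGap 0 c <= n.+1 ->
  runs D cSetGap h 100 (fun h' => [/\ cntok f h', ha h' rGap 0 c = g,
    forall c', c' != c -> ha h' rGap 0 c' = ha h rGap 0 c',
    ha h' rNxt = ha h rNxt & ha h' rPrv = ha h rPrv]).
Proof.
move=> hcnt eC eD hc fc hg hG; set G := ha h rGap 0 in hG hcnt *.
(* Splitting off c leaves a count over the other classes, which the update does not affect; this
   also covers equal old and new gaps. *)
have spl (G' : nat -> nat) g' : count (fun c => (f c == c) && (G' c == g')) (iota 0 n) =
    count (fun x => (x != c) && ((f x == x) && (G' x == g'))) (iota 0 n) + (G' c == g').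
  by rewrite (count_split _ hc) /= fc eqxx.
have hcG : ha h rCnt 0 (G c) = count (fun x => (x != c) && ((f x == x) && (G x == G c))) (iota 0 n) + 1.
  by rewrite hcnt // spl eqxx.
have cle (P : nat -> bool) : count P (iota 0 n) <= n.
  by apply: leq_trans (count_size _ _) _; rewrite size_iota.
have hcle g' : g' <= n.+1 -> ha h rCnt 0 g' <= n by move=> /hcnt ->.
rewrite /cSetGap; eapply runs_weak.
  do 2 vc_step; rewrite /= ?eC -/G; try lia.
  have hl1 := hcle _ hG.
  do 2 vc_step; rewrite /= ?eC; try lia.
  have hx : upa (ha h 11) 0 (G c) (ha h 11 0 (G c) - 1) 0 g <= n.
    by rewrite /upa; case: ifP => _; [lia|apply: hcle].
  do 2 vc_step; rewrite /= ?eD ?eC; try lia.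
  vc_step; rewrite /= ?eD ?eC; try lia.
  split=> //=.
  - move=> g' hg'; rewrite /= spl /upa /= eqxx.
    rewrite (eq_count (a2 := fun x => (x != c) && ((f x == x) && (G x == g')))); last first.
      by move=> x /=; case: (x == c).
    have E := hcnt g' hg'; rewrite spl in E.
    rewrite [g == g']eq_sym; case: (eqVneq g' g) => [eg|ne].
      rewrite -eg; case: (eqVneq g' (G c)) E => [->|ne2] E; first by rewrite hcG addnK.
      by rewrite E addn0.
    by case: (eqVneq g' (G c)) E => [->|ne2] E; rewrite E ?addnK ?addn0.
  - by rewrite /upa !eqxx.
  - by move=> c' ne; rewrite /upa (negPf ne).
by rewrite /hcost /=; lia.
Qed.

(** Since 0 is an occurrence and 0 < j, the position j has neighbours on both sides, the right one
    possibly the sentinel n. *)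
Lemma runs_unlink f mp m (O : nat -> nat -> bool) dead h c j :
  dat f mp m O dead h -> hr h vC = c -> hr h vJ = j -> c < n -> f c = c ->
  0 < j < n -> O c 0 -> O c j ->
  runs D cUnlink h 250
    (dat f mp m (fun c' x => O c' x && ~~ ((c' == c) && (x == j))) dead).
Proof.
move=> [dl dg dc] eC eJ hc fc hj o0 oj.
have [a ca] : exists a, consec (O c) a j by apply: ex_prev; rewrite ?oj ?orbT //; lia.
have [b cb] : exists b, consec (O c) j b by apply: ex_next; rewrite ?oj //; lia.
have [_ ea] := dl c hc fc _ _ ca; have [eb _] := dl c hc fc _ _ cb.
have [hg1 hg2 hg3] := dg c hc fc.
have [h1 h2 h3 h4] := ca; have [g1 g2 g3 g4] := cb.
rewrite /cUnlink; eapply runs_weak.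
  do 2 vc_step; rewrite /= ?eC ?eJ ?ea; try lia.
  do 2 vc_step; rewrite /= ?eC ?eJ ?eb; try lia.
  do 2 vc_step; rewrite /= ?eC; try lia.
  do 2 vc_step; rewrite /= ?eC; try lia.
  set h9 := sa _ _ _ _ _.
  have fin h' : cntok f h' -> ha h' rGap 0 c = maxn (ha h rGap 0 c) (b - a) ->
      (forall c', c' != c -> ha h' rGap 0 c' = ha h rGap 0 c') ->
      ha h' rNxt = ha h9 rNxt -> ha h' rPrv = ha h9 rPrv ->
      dat f mp m (fun c' x => O c' x && ~~ ((c' == c) && (x == j))) dead h'.
    move=> k1 k2 k3 k4 k5; split=> // c' hc' fc'; rewrite ?k4 ?k5 /=.
    - case: (eqVneq c' c) => [->|ne].
        move=> a' b' hab; have {}hab : consec (fun x => O c x && (x != j)) a' b'.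
          by apply: consec_ext hab => x; rewrite ?eqxx.
        rewrite /upa !eqxx /=; case: (consec_del ca cb hab) => [[-> ->]|[k6 k7 k8 _ _]].
          by rewrite !eqxx.
        by rewrite (negPf k7) (negPf k8); apply: dl.
      apply: linked_ext (dl c' hc' fc') => x; rewrite ?andbT //;
        by rewrite /upa (negPf ne).
    - case: (eqVneq c' c) => [->|ne].
        rewrite k2; split; first by lia.
          move=> hm; apply: ismaxgap_ext (maxgap_del ca cb (hg2 hm)) => x.
          by rewrite ?eqxx.
        by move=> /hg3 ->; lia.
      rewrite k3 //; have [k6 k7 k8] := dg c' hc' fc'; split=> // /k7.
      by apply: ismaxgap_ext => x; rewrite andbT.
  eapply runs_if; rewrite /= ?eC; try lia.
  - case: ltnP => // hlt _; do 2 vc_step => //=; try lia.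
    eapply runs_post; first eapply (@runs_setgap f _ c (b - a)) => //=; try lia.
    move=> h' _ [k1 k2 k3 k4 k5]; apply: fin => //.
    by rewrite k2; lia.
  - case: ltnP => // hlt _; vc_step; apply: fin => //=; lia.
by rewrite /hcost /=; lia.
Qed.

Lemma runs_delete m h : 1 < m <= n -> X m.-1 < s ->
  ctxC (size (ks m)) m h -> stamps (size (ks m)) h ->
  mpok (ha h rRep 0) (ha h rMp 0) ->
  dat (ha h rRep 0) (ha h rMp 0) m.-1 (occurs m.-1) (fun c => ha h rMp 0 c < m.-1) h ->
  runs D cDelete h (20 + \sum_(j <- bk n m.-1) unlink_cost j) (Inv m).
Proof.
move=> hm hX c0 st0 mp0 d0; have hkn := k_le_n.
set f := ha h rRep 0 in mp0 d0; set mp := ha h rMp 0 in mp0 d0.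
set t := size (ks m) in c0 st0.
have et : size (ks m.-1) = t.
  have e : ks m = ks m.-1.+1 by congr ks; lia.
  by rewrite /t e ksS leqNgt hX.
have tk : t <= k by apply: ks_size; lia.
have [_ _ _ R0 _] := c0; rewrite -/f in R0.
have ctxC_N h1 : ctxC t m h1 -> hr h1 vN = n by case=> [[[[[[[-> _ _] _ _] _] _] _] _]].
pose l := bk n m.-1.
have ul : uniq l by rewrite filter_uniq // iota_uniq.
have sl : size l <= n by apply: size_bk.
have ctxC_B h1 : ctxC t m h1 -> hr h1 vM = m -> ha h1 rBN 0 m.-1 = size l /\
    forall i, i < size l -> ha h1 rBK m.-1 i = nth 0 l i.
  by case=> [[_ hb]] _ _ _ _ _; apply: hb; lia.
(* State after i positions of the bucket. A class without a member matching m symbols counts as dead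
   once one of its members in the bucket has been handled, unless it was dead before. *)
pose O i c x := occurs m.-1 c x && (x \notin take i l).
pose dead i c := (mp c < m.-1) || (mp c < m) && has (fun j => f j == c) (take i l).
pose C1 h1 := [/\ ctxC t m h1, stamps t h1, ha h1 rRep 0 = f & ha h1 rMp 0 = mp].
rewrite /cDelete; eapply runs_weak.
  eapply (@runs_for _ _ _ _ _ (fun i h1 => C1 h1 /\ dat f mp m (O i) (dead i) h1)
     0 (size l) (fun i => unlink_cost (nth 0 l i) - 20)) => //=; try lia.
  - split=> //; case: d0 => d1 d2 d3; split=> //.
    + move=> c hc fc; apply: linked_ext (d1 c hc fc) => // x.
      by rewrite /O take0 in_nil andbT.
    + move=> c hc fc; have [k1 k2 k3] := d2 c hc fc; split=> //.
        move=> hmc; apply: ismaxgap_ext (k2 (ltac:(lia))) => x.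
        by rewrite /O take0 in_nil andbT.
      by rewrite /dead take0 andbF orbF.
  - move=> i h1 _ [[c1 _ _ _] _] _; have [_ _ eM _ _] := c1.
    by rewrite eM subn1; have [-> _] := ctxC_B _ c1 eM; split=> //; lia.
  - move=> i h1 hi [[c1 st1 ef1 em1] d1] ei; have [_ _ eM1 _ _] := c1.
    have [_ eb] := ctxC_B _ c1 eM1; have ebi := eb i hi.
    set j := nth 0 l i in ebi *; have : j \in l by rewrite mem_nth.
    rewrite mem_bk => /andP[hjn /eqP epj].
    have hj0 : 0 < j by rewrite lt0n; apply/eqP => e; rewrite e pf0 in epj; lia.
    have hpj := pf_le (ltnW hjn).
    have hjq r : r < t -> j + q r < n.
      by rewrite -et ks_lt; [move=> /andP[_]; lia|lia].
    have etake : take i.+1 l = rcons (take i l) j by rewrite -take_nth.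
    have jnt : j \notin take i l.
      have := take_uniq i.+1 ul; by rewrite etake rcons_uniq => /andP[].
    eapply (@runs_weak _ _ _ (_ + ((80 + (if bad t j then n else 1) * (550 * t.+1 + 250)) + 250))).
      do 2 vc_step; rewrite /= ?eM1 ?ei ?subn1 ?ebi; try lia.
      set h2 := sr h1 _ _.
      have c2 : ctxC t m h2 by [].
      pose J (P : nat -> bool) h3 := dat f mp m (fun c x => O i c x && ~~ (P c && (x == j))) (dead i) h3.
      eapply runs_seqc.
        eapply (@runs_foreach t m j cUnlink 250 J h2) => //.
        + case: d1 => x1 x2 x3; split=> //.
            move=> c hc fc; apply: linked_ext (x1 c hc fc) => // x; by rewrite andbT.
          move=> c hc fc; have [y1 y2 y3] := x2 c hc fc; split=> // hh.
          by apply: ismaxgap_ext (y2 hh) => x; rewrite andbT.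
        + move=> P h3 h4 hJ e; case: hJ => x1 x2 x3; split; rewrite ?e //.
        + move=> P P' h3 e [x1 x2 x3]; split=> //.
            by move=> c hc fc; apply: linked_ext (x1 c hc fc) => // x; rewrite e.
          move=> c hc fc; have [y1 y2 y3] := x2 c hc fc; split=> // hh.
          by apply: ismaxgap_ext (y2 hh) => x; rewrite e.
        + move=> P c h3 hc fc dc oc nP c3 eC3 eJ3 hJ; rewrite /= ef1 in fc.
          have oj : O i c j by rewrite /O /occurs et hjn epj leqnn oc jnt.
          eapply runs_post; first eapply (runs_unlink hJ eC3 eJ3 hc fc).
          * by rewrite hj0.
          * rewrite /O /occurs pf0 et occW0 // (negPf nP) /= andbT.
            have -> : 0 < n by lia. have -> /= : m.-1 <= n by lia.
            apply/negP => /mem_take; rewrite mem_bk pf0; lia.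
          * by rewrite oj (negPf nP).
          move=> h4 _ [x1 x2 x3]; split=> //.
            move=> c' hc' fc'; apply: linked_ext (x1 c' hc' fc') => // x.
            by rewrite andb_orl negb_or andbA.
          move=> c' hc' fc'; have [y1 y2 y3] := x2 c' hc' fc'; split=> // hh.
          by apply: ismaxgap_ext (y2 hh) => x; rewrite andb_orl negb_or andbA.
      move=> h3 F3 [c3 eJ3 J3]; case: (F3) => F31 _ F33.
      have st3 : stamps t h3 by move=> o e; rewrite F33 //; exact: st1.
      have ef3 : ha h3 rRep 0 = f by rewrite F33.
      have em3 : ha h3 rMp 0 = mp by rewrite F33.
      have {}J3 : dat f mp m (O i.+1) (dead i) h3.
        have ee c x : c < n -> f c = c ->
           O i c x && ~~ [&& ha h2 rRep 0 c == c, occW t c j & x == j] = O i.+1 c x.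
          move=> hc fc; rewrite /= ef1 fc eqxx /= /O etake mem_rcons inE negb_or.
          case: (eqVneq x j) => [->|ne]; rewrite ?andbF ?andbT //=.
          by rewrite /occurs et; case: (occW t c j); rewrite ?andbF.
        case: J3 => x1 x2 x3; split=> //.
          by move=> c hc fc; apply: linked_ext (x1 c hc fc) => // x; rewrite -andbA ee.
        move=> c hc fc; have [y1 y2 y3] := x2 c hc fc; split=> // hh.
        by apply: ismaxgap_ext (y2 hh) => x; rewrite -andbA ee.
      have deadS c : dead i.+1 c = dead i c || (mp c < m) && (f j == c).
        by rewrite /dead etake has_rcons andb_orr orbA orbAC.
      have fin h4 : ctxC t m h4 -> stamps t h4 -> ha h4 rRep 0 = f -> ha h4 rMp 0 = mp ->
          dat f mp m (O i.+1) (dead i.+1) h4 -> hr h4 vI = i ->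
          hr h4 vI = i /\ C1 (sr h4 vI i.+1) /\ dat f mp m (O i.+1) (dead i.+1) (sr h4 vI i.+1).
        by move=> z1 z2 z3 z4 z5 z6; split.
      have fjn : f j <= n.
        by case: R0 => R1 _; have := R1 j hjn; case: ifP => _; [case=> /ltnW|move->].
      have eI3 : hr h3 vI = i by rewrite F31.
      eapply (@runs_weak _ _ _ _ 250).
      do 2 vc_step; rewrite /= ?eJ3 ?ef3; try lia.
      set h4 := sr h3 _ _. have c4 : ctxC t m h4 by [].
      have eN4 : hr h4 vN = n by apply: ctxC_N.
      have [_ _ eM4 _ _] := c4.
      have same : (forall c, c < n -> f c = c -> dead i.+1 c -> dead i c) ->
          runs D HSkip h4 1 (fun h' => hr h' 15 = i /\ C1 (sr h' 15 i.+1) /\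
             dat f mp m (O i.+1) (dead i.+1) (sr h' 15 i.+1)).
        move=> hd; vc_step; apply: fin => //; case: J3 => x1 x2 x3; split=> // c hc fc.
        by have [y1 y2 y3] := x2 c hc fc; split=> // /(hd c hc fc).
      eapply runs_if => //=; rewrite [hr h3 0]eN4; last first.
      + case: ltnP => // hge _; apply: same => c hc fc.
        by rewrite deadS => /orP[//|/andP[_ /eqP e]]; lia.
      + case: ltnP => // hlt _; eapply runs_if; rewrite /= ?em3 ?[hr h3 3]eM4; first lia; last first.
          case: ltnP => // hge _; apply: same => c hc fc.
          by rewrite deadS => /orP[//|/andP[hh /eqP e]]; move: hge; rewrite e leqNgt hh.
        case: ltnP => // hltm _.
        do 2 vc_step; rewrite /= ?[hr h3 0]eN4; try lia.
        have ffj := repok_idem R0 hjn hlt.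
        case: J3 => x1 x2 x3; have [y1 y2 y3] := x2 (f j) hlt ffj.
        eapply runs_post; first eapply (@runs_setgap f _ (f j) n.+1) => //=; try lia.
        move=> h5 F5 [z1 z2 z3 z4 z5]; have c5 := ctxC_fr F5 (c4 : ctxC t m (sr h4 vD _)) isT.
        case: (F5) => F51 _ F53.
        apply: fin => //; try by rewrite ?F53 // ?F51.
          by move=> o e; rewrite F53 //; exact: st3.
        split=> // c hc fc; rewrite ?z4 ?z5; first exact: x1.
        case: (eqVneq c (f j)) => [->|ne].
          by rewrite z2; split=> //; lia.
        rewrite z3 //; have [w1 w2 w3] := x2 c hc fc; split=> //.
        by rewrite deadS [f j == c]eq_sym (negPf ne) andbF orbF.
      + by rewrite /hcost /=; lia.
    have hbm : (if bad t j then n else 1) <= (if bad k j then n else 1).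
      by case: (boolP (bad t j)) => [/(bad_mono tk) ->|_] //; case: (bad k j); lia.
    rewrite /unlink_cost; set b1 := (if bad t j then n else 1) in hbm *.
    set b2 := (if bad k j then n else 1) in hbm *.
    have hb2 : b1 * (550 * t.+1 + 250) <= b2 * (550 * k.+1 + 250) by apply: leq_mul; lia.
    by rewrite /hcost /=; lia.
  - move=> h1 [[c1 st1 ef1 em1] [x1 x2 x3]] _; split; rewrite ?ef1 ?em1 //.
    have ee c x : O (size l) c x = occurs m c x.
      rewrite /O take_size mem_bk /occurs et -/t; case: (ltnP x n) => //= hx.
      by case: (occW t c x); rewrite ?andbF ?andbT //; lia.
    split=> //.
      by move=> c hc fc; apply: linked_ext (x1 c hc fc) => // x; rewrite ee.
    move=> c hc fc; have [y1 y2 y3] := x2 c hc fc; split=> //.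
      by move=> hh; apply: ismaxgap_ext (y2 hh) => x; rewrite ee.
    (* In a class that dies at m the longest match is exactly m - 1, so the member attaining it is
       in the bucket. *)
    move=> hmc; apply: y3; rewrite /dead hmc /= take_size.
    case: (ltnP (mp c) m.-1) => //= hge; apply/hasP.
    have [_ [i [i1 i2 i3]]] := mp0 c hc fc; exists i; last by rewrite i2.
    by rewrite mem_bk i1 i3; lia.
rewrite [X in _ <= _ + X](big_nth 0).
rewrite -/l; set S1 := \sum_(0 <= i < size l) _; set S2 := \sum_(0 <= i < size l) _.
suff : S1 <= S2 by rewrite /hcost /=; lia.
apply: leq_sum => i _; rewrite /unlink_cost /hcost /=; lia.
Qed.

(** Feasibility asks for a gap of at most m, the counter for one of exactly m; the infeasibility of
    all smaller lengths closes the difference. *)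
Lemma feas_cnt m h : 0 < m <= n -> Inv m h ->
  (forall m', 0 < m' < m -> ~ feasible m') -> feasible m <-> ha h rCnt 0 m != 0.
Proof.
move=> hm [[cB _ _ R _] _ mp0 [d1 d2 d3]] inf; set f := ha h rRep 0 in R mp0 d1 d2 d3.
set mp := ha h rMp 0 in mp0 d2; set G := ha h rGap 0 in d2 d3.
rewrite d3; last by lia.
rewrite -lt0n -has_count; split.
- move=> [c0 [hc0 dc0 [i [hi ei hmi]] hgap]].
  have [R1 R2] := R; have := R1 c0 hc0; rewrite dc0 => - [hc dc ec].
  set c := f c0 in hc dc ec.
  have fc : f c = c by apply: repok_idem R hc0 hc.
  have fi : f i = c by rewrite -(R2 c0 i).
  have [m1 _] := mp0 c hc fc; have hmp := m1 i hi fi.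
  have [g1 g2 g3] := d2 c hc fc; have [k1 [a [b [k2 k3]]]] := g2 (leq_trans hmi hmp).
  apply/hasP; exists c; first by rewrite mem_iota.
  rewrite fc eqxx /= eqn_leq; apply/andP; split.
    by rewrite -k3; apply: hgap; apply: consec_ext k2 => x; apply: occ_eqw.
  (* A gap below m would make m - 1 feasible, as the class of c at length m - 1 has all these
     occurrences and maybe more. Gaps are positive, hence 1 < m. *)
  rewrite leqNgt; apply/negP => hlt.
  have m2 : 1 < m by case: (k2) => *; lia.
  apply: (inf m.-1); first lia.
  have sk : size (ks m.-1) <= size (ks m) by apply: ks_mono; lia.
  exists c; split=> //.
  + apply/all_iota => r hr; move/all_iota: dc; apply; lia.
  + exists i; split=> //; last lia.
    apply/all_iota => r hr; have /all_iota := eqw_trans ec ei; apply; lia.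
  + move=> x y hxy.
    have : y - x <= G c.
      apply: (consec_sub _ _ _ k1 hxy).
      * by move=> z; apply: occ_pred; lia.
      * by move=> z /and3P[].
      * by apply: occ0.
    lia.
- move=> /hasP[c]; rewrite mem_iota => /andP[_ hc] /andP[/eqP fc /eqP hg].
  have [g1 g2 g3] := d2 c hc fc.
  have hmm : m <= mp c by case: (leqP m (mp c)) => // /g3; rewrite hg; lia.
  have [k1 _] := g2 hmm; have [m1 [i [i1 i2 i3]]] := mp0 c hc fc.
  have dc : def (size (ks m)) c by rewrite -(repok_def R hc) fc.
  exists c; split=> //; last by move=> a b /k1; rewrite hg.
  exists i; split=> //; last by rewrite i3.
  case: R => R1 _; have := R1 i i1; case: ifP => _; last by rewrite i2; lia.
  by rewrite i2 => - [].
Qed.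

(** * Main loop and output *)

Definition before m h := [/\ 0 < m <= n.+1, ctxC (size (ks m.-1)) m h,
  stamps (size (ks m.-1)) h, forall m', 0 < m' < m -> ~ feasible m' &
  1 < m -> mpok (ha h rRep 0) (ha h rMp 0) /\
    dat (ha h rRep 0) (ha h rMp 0) m.-1 (occurs m.-1) (fun c => ha h rMp 0 c < m.-1) h].

Definition found m h := [/\ 0 < m <= n, Inv m h, ha h rCnt 0 m != 0 &
  forall m', 0 < m' < m -> ~ feasible m'].

Lemma runs_step m h : before m h -> m <= n -> hr h vF = 0 ->
  runs D (HIf (eX (HR vM |-| 1) |<| HR vS)%H
       (HIf (HR vM |==| 1)%H cBuild cDelete)
       (cRefine;; cBuild)%H) h (step_cost m - 70)
    (fun h' => Inv m h' /\ hr h' vF = 0).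
Proof.
move=> [hm c0 st0 _ hd] hmn eF; have [[[[[[b0 _ _] _] _] _] _] _ eM _ _] := c0.
have [eN eS _] := b0.
have o1 : ok D (HR vM |-| 1)%H h by rewrite /= eM; lia.
have l1 : hev (HR vM |-| 1)%H h < n by rewrite /= eM; lia.
have E := ev_X b0 l1; have O := ok_X b0 o1 l1.
have eC : hev (eX (HR vM |-| 1) |<| HR vS)%H h = (X m.-1 < s).
  by move: E => /= ->; rewrite eS eM subn1.
have hm1 : m.-1 < n by lia. have em : m = m.-1.+1 by lia.
have ek : size (ks m) = size (ks m.-1) + (s <= X m.-1).
  have -> : ks m = ks m.-1.+1 by rewrite -em.
  by rewrite ksS; case: ifP; rewrite ?size_rcons ?addn0 ?addn1.
have [hX|hX] := ltnP (X m.-1) s.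
- rewrite leqNgt hX addn0 in ek.
  apply: (@runs_weak _ _ _ (hcost (eX (HR vM |-| 1) |<| HR vS)%H + (5 + (step_cost m - 90))).+1); last first.
    by rewrite /step_cost /hcost /=; lia.
  eapply runs_ifT; first by move: O => /= ->.
    by rewrite eC hX.
  have [m1|m1] := eqVneq m 1.
    apply: (@runs_weak _ _ _ (hcost (HR vM |==| 1)%H + build_cost).+1); last first.
      by rewrite /step_cost m1 /hcost /=; lia.
    eapply runs_ifT => //=; first by rewrite eM m1.
    eapply runs_post; first apply: (runs_build (m := m)); rewrite ?ek //; first lia.
    by move=> h' F I; split=> //; case: F => F1 _ _; rewrite F1.
  apply: (@runs_weak _ _ _ (hcost (HR vM |==| 1)%H + (20 + \sum_(j <- bk n m.-1) unlink_cost j)).+1); last first.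
    by rewrite /step_cost; set z := _ * _; rewrite /hcost /=; lia.
  eapply runs_ifF => //=; first by rewrite eM (negPf m1).
  have [mp0 d0] := hd (ltac:(lia)).
  eapply runs_post; first apply: (runs_delete (m := m)); rewrite ?ek //; first lia.
  by move=> h' F I; split=> //; case: F => F1 _ _; rewrite F1.
- rewrite hX addn1 in ek.
  apply: (@runs_weak _ _ _ (hcost (eX (HR vM |-| 1) |<| HR vS)%H + (800 * n + build_cost)).+1); last first.
    by rewrite /step_cost hX orbT /hcost /=; lia.
  eapply runs_ifF; first by move: O => /= ->.
    by rewrite eC ltnNge hX.
  eapply runs_seqc; first apply: (runs_refine (m := m) c0 _ hX erefl st0); first lia.
  move=> h1 F1 [c1 st1]; rewrite -ek in c1 st1.
  eapply runs_post; first apply: (runs_build (m := m)) => //; first lia.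
  by move=> h' [F2 _ _] I; split=> //; case: F1 => F1 _ _; rewrite F2 // F1.
Qed.

Lemma ctxB_N h : ctxB h -> hr h vN = n.
Proof. by case=> [[[[[[-> _ _] _ _] _] _] _] _]. Qed.

Lemma Inv_before m h : 0 < m <= n -> Inv m h -> ha h rCnt 0 m = 0 ->
  (forall m', 0 < m' < m -> ~ feasible m') -> before m.+1 (sr h vM m.+1).
Proof.
move=> hm I0 e0 inf; have := feas_cnt hm I0 inf; case: I0 => [[cB eT eM R hB] st mp0 d0] fc.
split=> //; try by lia.
 move=> m' hm'; case: (eqVneq m' m) => [->|ne]; last by apply: inf; lia.
  by move=> /fc; rewrite e0.
Qed.

Lemma runs_main h : ctxB h -> (forall j, ha h rRep 0 j = 0) ->
  (forall j, ha h rBad 0 j = 0) -> (forall o e, ha h rStp o e = 0) ->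
  runs D cMain h (50 + \sum_(1 <= m < n.+1) step_cost m) (fun h' =>
    (hr h' vF = 1 /\ found (hr h' vM) h') \/
    [/\ hr h' vF = 0, ctxB h' & forall m, 0 < m <= n -> ~ feasible m]).
Proof.
move=> cB z1 z2 z3; rewrite /cMain.
pose I h1 := (hr h1 vF = 0 /\ before (hr h1 vM) h1) \/
  (hr h1 vF = 1 /\ found (hr h1 vM) h1).
pose pot h1 := if hr h1 vF == 0 then \sum_(hr h1 vM <= m < n.+1) step_cost m else 0.
have IN h1 : I h1 -> hr h1 vN = n.
  by case=> [[_ [_ [cB1 _ _ _ _] _ _ _]]|[_ [_ [[cB1 _ _ _ _] _ _ _] _ _]]]; apply: ctxB_N.
eapply runs_weak.
  do 2 vc_step => //=; try lia.
  do 2 vc_step => //=; try lia.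
  do 2 vc_step => //=; try lia.
  eapply (@runs_whilep _ _ _ I pot).
  - left; split=> //=; split=> //=; try lia.
    + split=> //; last by move=> j _; rewrite z2.
      split=> [j hj|i j hi hj _ _]; last by rewrite !z1.
      by rewrite z1; split=> //; lia.
    + by move=> o e; rewrite z3.
  - by [].
  - move=> h1 HI; have eN := IN _ HI; rewrite /= eN.
    case: HI => [[eF hb]|[-> _]]; last by rewrite muln0.
    rewrite eF /= muln1; case: ltnP => // hmn _.
    (* The 150 units per length in [step_cost] cover the tests: 70 are left over by the branch on
       the symbol, 30 of them go to the test of the counter, and the rest suffices for the loop. *)
    set m := hr h1 vM in hb hmn *; exists (step_cost m - 20).
    have hmn' : m <= n by lia.
    have hb' := hb; case: hb' => hm c0 _ inf _.
    have w150 : 150 <= step_cost m by rewrite /step_cost -addnA leq_addr.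
    apply: (@runs_weak _ _ _ (step_cost m - 70 + 30)); last by lia.
    eapply runs_seqc; first exact: runs_step hb hmn' eF.
    move=> h2 _ [I2 eF2]; have hm0 : 0 < m <= n by lia.
    have [[cB2 _ eM2 _ _] _ _ _] := I2.
    have ePot : pot h1 = step_cost m + \sum_(m.+1 <= m0 < n.+1) step_cost m0.
      by rewrite /pot eF /= -/m big_ltn.
    eapply (@runs_weak _ _ _ _ 30); first eapply runs_if; rewrite /= ?eM2; first lia.
    + move=> hc; vc_step => //=; first lia.
      split; last by rewrite ePot /pot /= /hcost /=; lia.
      by right; split=> //; rewrite /= eM2; split.
    + move=> hc; vc_step => //=; rewrite ?eM2; first by lia.
      rewrite addn1; split; last by rewrite ePot /pot /= eF2 /hcost /=; lia.
      by left; split=> //=; apply: Inv_before.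
    + by rewrite /hcost /=.
  - move=> h1 HI; have eN := IN _ HI; rewrite /= eN.
    case: HI => [[eF hb]|]; last by left.
    rewrite eF /= muln1; case: ltnP => // hge _; right; split=> //.
      by case: hb => _ [].
    by case: hb => _ _ _ inf _ m hm; apply: inf; lia.
rewrite /pot /= /hcost /=; lia.
Qed.

Lemma runs_out h : (hr h vF = 1 /\ found (hr h vM) h) \/
    [/\ hr h vF = 0, ctxB h & forall m, 0 < m <= n -> ~ feasible m] ->
  runs D cOut h (500 * n) (fun h' =>
    (exists m c, [/\ 0 < m <= n, c < n /\ def (size (ks m)) c,
        (exists i, [/\ i < n, eqw (size (ks m)) c i & m <= pf i]) /\
        (forall a b, consec (occurs m c) a b -> b - a <= m),
        (forall m', 0 < m' < m -> ~ feasible m') &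
        [/\ hi h' 0 = 1, hi h' 1 = m & forall p, p < m -> hi h' (2 + p) = letter c p]]) \/
    (hi h' 0 = 0 /\ forall m, 0 < m <= n -> ~ feasible m)).
Proof.
case=> [[eF [hm I0 cnt0 inf]]|[eF cB inf]]; last first.
  rewrite /cOut; eapply runs_weak; first eapply runs_ifF => //.
    by vc_step => //=; [nia|lia|right].
  by rewrite /hcost /=; lia.
set m := hr h vM in hm I0 cnt0 inf.
have [[cB eT eM R hB] st mp0 [d1 d2 d3]] := I0.
set f := ha h rRep 0 in R mp0 d1 d2 d3; set mp := ha h rMp 0 in mp0 d2.
set G := ha h rGap 0 in d2 d3.
pose P c := (f c == c) && (G c == m).
have hasP' : has P (iota 0 n) by move: cnt0; rewrite d3 ?has_count ?lt0n //; lia.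
pose c0 := find P (iota 0 n).
have hc0 : c0 < n by have := hasP'; rewrite has_find size_iota.
have Pc0 : P c0 by have := nth_find 0 hasP'; rewrite nth_iota ?add0n.
have nP c : c < c0 -> ~~ P c.
  move=> hc; have := before_find 0 hc; rewrite nth_iota ?add0n; last by lia.
  by move->.
have [/eqP fc /eqP gc] := andP Pc0.
have dc : def (size (ks m)) c0 by rewrite -(repok_def R hc0) fc.
have [[[c2 cZ] ePF] _] := cB; have [[b0 eK eQ] cNN'] := c2; have [eN eS eI] := b0.
have [g1 g2 g3] := d2 c0 hc0 fc.
have hmm : m <= mp c0 by case: (leqP m (mp c0)) => // /g3; rewrite gc; lia.
have [k1 _] := g2 hmm; have [_ [i [i1 i2 i3]]] := mp0 c0 hc0 fc.
have wit : exists i, [/\ i < n, eqw (size (ks m)) c0 i & m <= pf i].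
  exists i; split=> //; last by rewrite i3.
  case: R => R1 _; have := R1 i i1; case: ifP => _; last by rewrite i2; lia.
  by rewrite i2 => - [].
have mD : forall a, a < 2 + m -> a < D * D by move=> a ha; rewrite hD; nia.
rewrite /cOut; eapply runs_weak.
  eapply runs_ifT => //=; first by rewrite eF.
  do 2 vc_step => //=; first lia.
  set h1 := sr h _ _.
  pose J h2 := [/\ hr h2 vC <= c0, ha h2 = ha h, hi h2 = hi h &
    [/\ hr h2 vM = m, hr h2 vN = n, hr h2 vS = s & ctx2 h2]].
  eapply runs_seqc with (P := fun h2 => J h2 /\ hr h2 vC = c0).
    eapply (@runs_weak _ _ _ _ (50 * n + 30)); first eapply (@runs_whilep _ _ _ J (fun h2 => 40 * (c0 - hr h2 vC))).
    - by split.
    - by move=> h2 [hc ea eh [em en es _]] /=; lia.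
    - move=> h2 [hc ea eh [em en es cc]] /=; rewrite ea em -/f -/G mulnb -/(P _) => hP.
      have hlt : hr h2 vC < c0.
        by rewrite ltn_neqAle hc andbT; apply/eqP => e; move: hP; rewrite e Pc0.
      exists (hcost (HR vC |+| 1)%H).+1; vc_step => //=; first lia.
      split; last by rewrite /hcost /=; lia.
      by split=> //=; lia.
    - move=> h2 [hc ea eh [em en es cc]] /=; rewrite ea em -/f -/G mulnb -/(P _) => hP.
      split=> //; apply/eqP; rewrite eqn_leq hc leqNgt; apply/negP => /nP.
      by move: hP; case: (P _).
    - rewrite /h1 /hcost /=; lia.
  move=> h2 _ [[_ ea eh [em en es cc2]] eC2].
  (* The class is defined, so its code at a non-solid position of the prefix is neither 0 nor s + 1
     and decodes to a letter. *)
  have letS p : p < m -> (X p < s \/ s <= X p /\ c0 + p < n /\ 0 < inter (X p) (X (c0 + p)) <= s).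
    move=> hp; case: (ltnP (X p) s) => hX; [by left|right].
    have hpn : p < n by lia.
    have [h3 h4] := q_X hpn hX.
    have hr : X p - s < size (ks m) by rewrite ks_lt ?h4 ?h3 //; lia.
    have := all_iota _ _ dc _ hr; rewrite /dl h3; case: ifP => //.
  have letlt p : p < m -> letter c0 p < s.
    move=> /letS hp; rewrite /letter; case: hp => [h3|[h3 [_ h4]]]; first by rewrite h3.
    by rewrite [X p < s]ltnNge h3 /=; lia.
  pose K p h3 := [/\ hr h3 vM = m /\ hr h3 vC = c0, ctx2 h3 &
     forall p', p' < p -> ha h3 rLast 0 p' = letter c0 p'].
  eapply runs_seqc with (P := K m).
    eapply (@runs_forc _ _ _ _ _ K 0 m) => //=; try lia.
    - by move=> p h3 _ [[-> _] _ _] _.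
    - move=> p h3 hp [[em3 ec3] c3 hK] ep; have [[b3 _ _] _] := c3.
      have [eN3 eS3 _] := b3.
      have l1 : hev (HR vP) h3 < n by rewrite /= ep; lia.
      have E1 := ev_X b3 l1; have O1 := ok_X b3 (isT : ok D (HR vP) h3) l1.
      rewrite /= ep in E1.
      have Kn h4 : hr h4 vM = m -> hr h4 vC = c0 -> ctx2 h4 ->
          ha h4 rLast 0 p = letter c0 p -> (forall p', p' <> p -> ha h4 rLast 0 p' = ha h3 rLast 0 p') ->
          K p.+1 (sr h4 vP p.+1).
        move=> y1 y2 y3 y4 y5; split=> // p' hp'.
        by rewrite /=; case: (eqVneq p' p) => [->//|/eqP ne]; rewrite y5 // hK //; lia.
      eapply (@runs_weak _ _ _ _ 250); first eapply (@runs_if _ _ _ _ _ 20 200).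
      + by move: O1 => /= ->.
      + move=> hX0; have hX : X p < s by move: hX0; rewrite /= ep E1 eS3; case: ltnP.
        eapply (@runs_weak _ _ _ _ 20); first vc_step; rewrite /= ?ep ?E1; try lia.
          split=> //; apply: (Kn (sa h3 rLast 0 p (X p))) => //=; first by rewrite /upa !eqxx /letter hX.
          by move=> p' /eqP ne; rewrite /upa (negPf ne).
        by [].
      + move=> hX0; have hX : s <= X p by move: hX0; rewrite /= ep E1 eS3; case: ltnP.
        have [|[_ [hcp hi]]] := letS p hp; first by lia.
        have l2 : hev (HR vC |+| HR vP)%H h3 < n by rewrite /= ec3 ep.
        eapply (@runs_weak _ _ _ _ 200); first vc_step.
          have l1' : hev (HR vP) h3 < n by rewrite /= ep; lia.
          eapply runs_inter; rewrite ?(ev_X b3 l1') ?(ev_X b3 l2) ?X_lt // ?ok_X //.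
          rewrite /= ec3 ep; vc_step; rewrite /= ?ep; try lia.
          split=> //; set h4 := sr h3 vD _; apply: (Kn (sa h4 rLast 0 p ((inter (X p) (X (c0 + p))) - 1))) => //=; first by rewrite /upa !eqxx /letter ltnNge hX /= subn1.
          by move=> p' /eqP ne; rewrite /upa (negPf ne).
        by [].
      + by rewrite /hcost /=.
  move=> h3 _ [[em3 ec3] c3 hK]; have [[[eN3 eS3 _] _ _] _] := c3.
  have hmn : m <= n by lia.
  vc_step; pose L p h4 := [/\ hr h4 vM = m, ha h4 = ha h3 &
     forall p', p' < p -> hi h4 (2 + p') = letter c0 p'].
  eapply (@runs_forc _ _ _ _ _ L 0 m) => //=; try lia.
  - by move=> p h4 _ [-> _ _] _.
  - move=> p h4 hp [em4 ea4 hL] ep.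
    have lp := letlt p hp.
    vc_step; rewrite /= ?ep ?ea4 ?hK //; try lia.
    split=> //; split=> // p' hp'.
    change (up (hi h4) (2 + p) (letter c0 p) (2 + p') = letter c0 p'); rewrite upE.
    by case: (eqVneq p' p) => [->|ne]; [rewrite eqxx|rewrite eqn_add2l (negPf ne) hL //; lia].
  - move=> h4 [em4 ea4 hL] _.
    do 2 vc_step => //=; try nia.
    vc_step; rewrite /= ?em4 //; try nia.
    left; exists m, c0; split=> //; first by split=> // a b /k1; rewrite gc.
rewrite /hcost /=. lia.
Qed.

Lemma runs_all h : (forall a, a < D * D -> hi h a = inp a) ->
  (forall x, hr h x = 0) -> (forall r i j, ha h r i j = 0) ->
  runs D cAll h (160 * 200 * (n * maxn 1 k ^ 4)) (fun h' =>
    (exists m c, [/\ 0 < m <= n, c < n /\ def (size (ks m)) c,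
        (exists i, [/\ i < n, eqw (size (ks m)) c i & m <= pf i]) /\
        (forall a b, consec (occurs m c) a b -> b - a <= m),
        (forall m', 0 < m' < m -> ~ feasible m') &
        [/\ hi h' 0 = 1, hi h' 1 = m & forall p, p < m -> hi h' (2 + p) = letter c p]]) \/
    (hi h' 0 = 0 /\ forall m, 0 < m <= n -> ~ feasible m)).
Proof.
move=> hinp hr0 ha0; rewrite /cAll; eapply runs_weak.
  eapply runs_seqc; first exact: runs_pre hinp (hr0 _).
  move=> h1 F1 c1; eapply runs_seqc; first exact: runs_NN c1.
  move=> h2 F2 c2; eapply runs_seqc; first exact: runs_Z c2.
  move=> h3 F3 c3; eapply runs_seqc; first exact: runs_PF c3.
  move=> h4 F4 c4.
  have E4 r : r \in [:: rBN; rRep; rBad; rStp] -> ha h4 r = ha h r.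
    case: F1 F2 F3 F4 => [_ _ f1] [_ _ f2] [_ _ f3] [_ _ f4].
    by rewrite !inE => /or4P[] /eqP ->; rewrite f4 // f3 // f2 // f1.
  eapply runs_seqc; first by apply: (runs_BK c4) => v; rewrite E4.
  move=> h5 F5 c5; have E5 r : r \in [:: rRep; rBad; rStp] -> ha h5 r = ha h r.
    move=> hr1; case: F5 => _ _ f5; rewrite f5; last by move: hr1; rewrite !inE => /or3P[] /eqP ->.
    by rewrite E4 // inE hr1 orbT.
  eapply runs_seqc; first by apply: (runs_main c5) => *; rewrite E5.
  by move=> h6 F6 c6; exact: runs_out c6.
have hS := sum_step_cost; have hkn := k_le_n.
set S := \sum_(_ <= _ < _) _ in hS *.
(* The maximum keeps the bound linear in n for k = 0. Each product of n and powers of k is bounded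
   by a multiple of n K ^ 4 and then generalized, which leaves linear arithmetic. *)
set K := maxn 1 k; have k1 : k <= K by rewrite /K; lia.
have K1 : 0 < K by rewrite /K; lia.
rewrite /build_cost in hS; clear - hS hkn k1 K1 hs.
have e1 : k.+1 <= 2 * K by lia.
have e2 : (k * k).+1 <= 2 * (K * K) by nia.
have e3 : k * k <= K * K by apply: leq_mul.
have eK : K ^ 4 = K * K * (K * K) by rewrite !expnS expn0; lia.
rewrite eK; set K2 := K * K in e2 e3 *.
have K21 : K <= K2 by rewrite leq_pmulr.
have K3 : K2 <= K * K2 by rewrite leq_pmull.
have K4 : K * K2 <= K2 * K2 by rewrite leq_mul2r K21 orbT.
have f1 : k.+1 * (k.+1 * (n * (k * k).+1)) <= 8 * (n * (K2 * K2)).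
  have -> : 8 * (n * (K2 * K2)) = (2 * K) * ((2 * K) * (n * (2 * K2))) by rewrite /K2; lia.
  by do 2 (apply: leq_mul => //); apply: leq_mul.
have f2 : n * k.+1 <= 2 * (n * (K2 * K2)).
  have -> : 2 * (n * (K2 * K2)) = n * (2 * (K2 * K2)) by lia.
  by apply: leq_mul => //; lia.
have f3 : k * k * (n * k.+1) <= 2 * (n * (K2 * K2)).
  have -> : 2 * (n * (K2 * K2)) = K2 * (n * (2 * K2)) by lia.
  by apply: leq_mul => //; apply: leq_mul => //; lia.
have f4 : n <= n * (K2 * K2) by rewrite leq_pmulr // !muln_gt0 K1.
have f5 : k * k * n <= n * (K2 * K2).
  by rewrite mulnC; apply: leq_mul => //; apply: leq_trans e3 _; lia.
have f6 : k * k * s <= k * k * n by apply: leq_mul => //; lia.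
have f7 : k * k <= k * k * n by rewrite leq_pmulr //; lia.
set Z := n * (K2 * K2) in f1 f2 f3 f4 f5 *.
clear e1 e2 e3 eK K21 K3 K4 K1 k1.
have g1 : k.+1 * (800 * n + 1500 * (k.+1 * (n * (k * k).+1))) =
  800 * (n * k.+1) + 1500 * (k.+1 * (k.+1 * (n * (k * k).+1))) by lia.
have g2 : k * k * (n * (550 * k.+1 + 250)) = 550 * (k * k * (n * k.+1)) + 250 * (k * k * n) by lia.
have g3 : n * (750 + 550 * k.+1) = 750 * n + 550 * (n * k.+1) by lia.
rewrite g1 g2 g3 in hS.
have g4 : k * (30 + k * (40 + s * 60)) = 30 * k + 40 * (k * k) + 60 * (k * k * s) by lia.
have g5 : k.+1 * (600 * n) = 600 * (n * k.+1) by lia.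
have g6 : n * (1100 * k.+1) = 1100 * (n * k.+1) by lia.
rewrite g4 g5 g6; move: (k.+1 * (k.+1 * _)) hS f1 => x1 hS f1.
clear g1 g2 g3 g4 g5 g6.
move: (k * k * (n * k.+1)) (n * k.+1) (k * k * n) (k * k * s) (k * k) Z hS f1 f2 f3 f4 f5 f6 f7
  => x2 x3 x4 x5 x6 Z hS f1 f2 f3 f4 f5 f6 f7.
lia.
Qed.

End Algo.

(** * Back to indeterminate strings *)

Section Strings.

Variables (s : nat) (T : seq {set 'I_s}).

Local Notation n := (size T).
Local Notation k := (size (nonsolids T)).
Local Notation sym i := (nth set0 T i).
Local Notation X := (symbol_code T).

Definition code_bit r a : bool :=
  if insub a is Some x then x \in nth set0 (nonsolids T) r else false.

Local Notation mbT := (mb s code_bit).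
Local Notation interT := (inter s code_bit).
Local Notation ksT := (ks s X).
Local Notation qT := (q n s X).
Local Notation pfT := (pf n s X code_bit).
Local Notation inpT := (nth 0 (encode T)).
Local Notation defT := (def n s X code_bit).
Local Notation eqwT := (eqw n s X code_bit).
Local Notation occT := (occurs n s X code_bit).
Local Notation letterT := (letter s X code_bit).
Local Notation feasibleT := (feasible n s X code_bit).

Lemma code_bitE r (a : 'I_s) : code_bit r a = (a \in nth set0 (nonsolids T) r).
Proof. by rewrite /code_bit valK. Qed.

Lemma solidP (Y : {set 'I_s}) : solid Y ->
  exists x : 'I_s, Y = [set x] /\ solid_letter Y = x.
Proof.
by move=> /cards1P[x ->]; exists x; split; rewrite // /solid_letter enum_set1.
Qed.

Lemma X_solid i : (X i < s) = solid (sym i).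
Proof.
rewrite /symbol_code; case: ifP => [/solidP[x [_ ->]]|_]; first exact: ltn_ord.
by rewrite ltnNge leq_addr.
Qed.

Lemma size_ks i : i <= n -> size (ksT i) = size (nonsolids (take i T)).
Proof.
elim: i => [|i IH] hi; first by rewrite take0.
rewrite ksS (take_nth set0) // /nonsolids filter_rcons -/(nonsolids _) leqNgt X_solid.
by case: ifP => _; rewrite ?size_rcons IH // ltnW.
Qed.

Lemma X_nonsolid i : i < n -> s <= X i -> X i = s + size (ksT i).
Proof.
move=> hi; rewrite leqNgt X_solid size_ks ?(ltnW hi) // /symbol_code.
by move=> /negPf ->.
Qed.

(** For a non-solid symbol, its code exceeds s by the number of non-solid symbols before it, which
    is the index of its bit vector. *)
Lemma mbE i (a : 'I_s) : i < n -> mbT (X i) a = (a \in sym i).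
Proof.
move=> hi; rewrite /mb X_solid; case: ifP => hsol.
  have [x [e el]] := solidP hsol; rewrite /symbol_code hsol el e inE eq_sym.
  by rewrite (inj_eq val_inj).
rewrite code_bitE /symbol_code hsol addKn; congr (_ \in _).
rewrite -{1}(cat_take_drop i T) /nonsolids filter_cat nth_cat ltnn subnn.
by rewrite (drop_nth set0 hi) /= hsol.
Qed.

Lemma inter_neq0E i j : i < n -> j < n ->
  (interT (X i) (X j) != 0) = (sym i :&: sym j != set0).
Proof.
move=> hi hj; apply/idP/set0Pn => [/inter_neq0[a la]|[a]].
  by exists (Ordinal la); rewrite inE -!mbE.
rewrite inE -!mbE // => ha; apply/inter_neq0; exists a => //; exact: ltn_ord.
Qed.

Lemma inp_code i : i < n -> inpT (2 + i) = X i.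
Proof.
by move=> hi; rewrite /encode /= nth_cat size_mkseq hi nth_mkseq.
Qed.

Lemma size_bit_vector (Y : {set 'I_s}) : size (bit_vector Y) = s.
Proof. by rewrite size_map size_enum_ord. Qed.

Lemma nth_flatten_bits (l : seq {set 'I_s}) r a : r < size l -> a < s ->
  nth 0 (flatten [seq bit_vector Y | Y <- l]) (r * s + a) =
  nth 0 (bit_vector (nth set0 l r)) a.
Proof.
move=> hr ha; elim: l r hr => [//|Y l IH] [|r] /= hr; rewrite nth_cat size_bit_vector.
  by rewrite mul0n ha.
by rewrite mulSn -addnA ltnNge leq_addr /= addKn IH.
Qed.

Lemma inp_bit r a : r < k -> a < s -> inpT (2 + n + r * s + a) = code_bit r a.
Proof.
move=> hr ha; rewrite /encode.
have -> : 2 + n + r * s + a = (2 + n) + (r * s + a) by lia.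
rewrite catA nth_cat size_cat size_mkseq ltnNge leq_addr /= addKn.
rewrite nth_flatten_bits // (nth_map (Ordinal ha)) ?size_enum_ord //.
by rewrite -(code_bitE r) nth_enum_ord.
Qed.

Lemma size_ks_n : size (ksT n) = k.
Proof. by rewrite size_ks // take_size. Qed.

Lemma pfE j m : j <= n -> (m <= pfT j) <->
  (j + m <= n /\ forall y, y < m -> sym y :&: sym (j + y) != set0).
Proof.
move=> hj; rewrite (pfP s X code_bit m hj).
split=> [] [h1 h2]; split=> // y hy; have := h2 y hy; rewrite inter_neq0E //; lia.
Qed.

Lemma inter_set1 i j (a : 'I_s) : i < n -> j < n ->
  (interT (X i) (X j) == a.+1) = (sym i :&: sym j == [set a]).
Proof.
move=> hi hj; apply/eqP/eqP => E.
  apply/setP => x; rewrite !inE -!mbE //.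
  have := inter_letter E (ltn_ord a) (ltn_ord x).
  by move=> ->.
have E2 x : x < s -> mbT (X i) x && mbT (X j) x = (x == a).
  move=> hx; have /setP/(_ (Ordinal hx)) := E; rewrite !inE -!mbE //.
rewrite /inter (eq_in_filter (a2 := fun x => x == a :> nat)); last first.
  by move=> x; rewrite mem_iota => /andP[_ hx]; apply: E2.
by rewrite filter_pred1_uniq ?iota_uniq // mem_iota ltn_ord.
Qed.

(** * Matching, odot-prefixes and covers in terms of codes *)

Lemma imatchP (U W : seq {set 'I_s}) : reflect
  (size U = size W /\ forall y, y < size U -> nth set0 U y :&: nth set0 W y != set0)
  (imatch U W).
Proof.
rewrite /imatch all2E; apply: (iffP andP) => [[/eqP e /(all_nthP (set0, set0)) h]|[e h]].
  split=> // y hy; have := h y; rewrite size_zip e minnn -e => /(_ hy).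
  by rewrite nth_zip.
split; first by rewrite e.
apply/(all_nthP (set0, set0)) => y; rewrite size_zip e minnn => hy.
by rewrite nth_zip //=; apply: h; rewrite e.
Qed.

Lemma nth_factor j m y : y < m -> nth set0 (factor T j m) y = sym (j + y).
Proof. by move=> hy; rewrite /factor nth_take // nth_drop. Qed.

Lemma size_factor j m : j + m <= n -> size (factor T j m) = m.
Proof. by move=> h; rewrite size_take size_drop; case: ltnP; lia. Qed.

Lemma occ_prefix m j : m <= n -> j <= n ->
  Defs.occ (take m T) T j <-> m <= pfT j.
Proof.
move=> hm hj; rewrite pfE // /Defs.occ size_take_min (minn_idPl hm); split.
  move=> /andP[h1 /imatchP[_ h2]]; split=> // y hy; have := h2 y.
  by rewrite size_take_min (minn_idPl hm) => /(_ hy); rewrite nth_take // nth_factor.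
move=> [h1 h2]; rewrite h1; apply/imatchP.
rewrite size_factor // size_take_min (minn_idPl hm); split=> // y hy.
by rewrite nth_take // nth_factor //; apply: h2.
Qed.

Lemma occ_solid (u : seq 'I_s) x0 j :
  Defs.occ (of_solid u) T j <-> j + size u <= n /\
  forall p, p < size u -> nth x0 u p \in sym (j + p).
Proof.
rewrite /Defs.occ size_map; split.
  move=> /andP[h1 /imatchP[_ h2]]; split=> // p hp; have := h2 p.
  rewrite size_map => /(_ hp); rewrite (nth_map x0) // nth_factor //.
  by move=> /set0Pn[x]; rewrite !inE => /andP[/eqP ->].
move=> [h1 h2]; rewrite h1; apply/imatchP; rewrite size_factor // size_map.
split=> // p hp; rewrite (nth_map x0) // nth_factor //.
by apply/set0Pn; exists (nth x0 u p); rewrite !inE eqxx h2.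
Qed.

(** For nonempty u the occurrence i is a position of T, and thus a candidate member of a class. *)
Lemma odot_prefixP (u : seq 'I_s) x0 : 0 < size u ->
  odot_prefix T u <-> size u <= n /\ exists i, [/\ i < n, size u <= pfT i &
    forall p, p < size u -> sym p :&: sym (i + p) = [set nth x0 u p]].
Proof.
move=> u0; rewrite /odot_prefix; split=> [[hu [i [o e]]]|[hu [i [hi hp he]]]].
  have hin : i + size u <= n.
    by move: o => /andP[]; rewrite size_take_min (minn_idPl hu).
  split=> //; exists i; split; first by lia.
    by apply/occ_prefix => //; lia.
  move=> p hp; have := congr1 (fun l => nth set0 l p) e.
  rewrite (nth_map x0) // (nth_map (set0, set0)); last first.
    by rewrite size_zip size_factor size_take_min (minn_idPl hu) ?minnn.
  rewrite nth_zip; last by rewrite size_factor size_take_min (minn_idPl hu).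
  by rewrite /= size_take_min (minn_idPl hu) nth_take // nth_factor.
split=> //; exists i; split; first by apply/occ_prefix => //; lia.
have [hin _] := (pfE (size u) (ltnW hi)).1 hp.
apply: (@eq_from_nth _ set0).
  rewrite !size_map size_zip size_factor size_take_min (minn_idPl hu) ?minnn //.
rewrite size_map => p hpu; rewrite (nth_map x0) // (nth_map (set0, set0)); last first.
  by rewrite size_zip size_factor size_take_min (minn_idPl hu) ?minnn.
rewrite nth_zip; last by rewrite size_factor size_take_min (minn_idPl hu).
by rewrite /= size_take_min (minn_idPl hu) nth_take // nth_factor // he.
Qed.

Hypothesis hT : istring T.
Hypothesis hs2 : 2 <= s <= size T.

Lemma X_nonempty i : i < n -> exists2 a, a < s & mbT (X i) a.
Proof.
move=> hi; have /set0Pn[a ha] : sym i != set0.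
  by apply: contra hT => /eqP <-; apply: mem_nth.
by exists a; rewrite ?mbE ?ltn_ord.
Qed.

Lemma nonsolid_index p m : p < m <= n -> s <= X p ->
  exists r, r < size (ksT m) /\ qT r = p.
Proof.
move=> hp hX; exists (X p - s).
have hpn : p < n by lia.
have [e h] := q_X hs2 size_ks_n X_nonsolid hpn hX.
split=> //; rewrite (ks_lt hs2 size_ks_n X_nonsolid) ?h ?e; lia.
Qed.

Lemma q_ks m r : m <= n -> r < size (ksT m) -> qT r < m /\ s <= X (qT r).
Proof.
move=> hm hr; have := hr.
rewrite (ks_lt hs2 size_ks_n X_nonsolid) // => /andP[h1 h2].
by have [_ h3] := q_lt size_ks_n h1.
Qed.

(** A solid T[p] meets T[i + p] in its own letter; at a non-solid p the code is that of c, a single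
    letter since the class is defined. So all members matching m symbols yield the same string. *)
Lemma class_letter m c i p : i < n -> defT (size (ksT m)) c ->
  eqwT (size (ksT m)) c i -> m <= pfT i -> p < m ->
  interT (X p) (X (i + p)) = (letterT c p).+1 /\ letterT c p < s.
Proof.
move=> hi dc ei hm hp; have [him hne] := (pfE m (ltnW hi)).1 hm.
have hp1 : p < n by lia. have hip : i + p < n by lia.
have := hne p hp; rewrite -inter_neq0E // /letter.
case: (ltnP (X p) s) => hX.
  by rewrite inter_solid //; case: (mbT _ _).
move=> _; have hpm : p < m <= n by lia.
have [r [hr eq]] := nonsolid_index hpm hX.
have /all_iota/(_ r hr) /andP[d0 d1] := dc; have hcr := dl_range d0.
have /all_iota/(_ r hr) /eqP := ei; move: d0 d1; rewrite /dl hcr eq hip.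
by move=> h0 h1 <-; rewrite prednK //; split=> //; lia.
Qed.

(** The letters of u lie in the symbols of the prefix, so an occurrence of u is a match of the
    prefix. Conversely, a match of the prefix settles the solid positions and [occW] the non-solid
    ones. *)
Lemma occ_class m c i (u : seq 'I_s) x0 j : m <= n -> i < n ->
  defT (size (ksT m)) c ->
  eqwT (size (ksT m)) c i -> m <= pfT i -> size u = m -> 0 < m ->
  (forall p, p < m -> nth x0 u p = letterT c p :> nat) ->
  Defs.occ (of_solid u) T j <-> occT m c j.
Proof.
move=> hmn hi dc ei hm su m0 eu; rewrite (occ_solid _ x0) su.
have [him hne] := (pfE m (ltnW hi)).1 hm.
have up p : p < m -> nth x0 u p \in sym p.
  move=> hp; have [e1 e2] := class_letter hi dc ei hm hp.
  have /eqP : interT (X p) (X (i + p)) = (nth x0 u p).+1 by rewrite e1 eu.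
  rewrite inter_set1; [|lia|lia] => /eqP/setP/(_ (nth x0 u p)).
  by rewrite !inE eqxx => /andP[].
have hl r : r < size (ksT m) -> (dl n s X code_bit r c).-1 = letterT c (qT r).
  move=> hr; have [q1 q2] := q_ks hmn hr.
  have /all_iota/(_ r hr) /andP[d0 _] := dc; have := dl_range d0.
  by rewrite /dl /letter [_ < s]ltnNge q2 => ->.
split=> [[h1 h2]|/and3P[h1 h2 /all_iota h3]].
  have hjn : j < n by lia.
  rewrite /occurs hjn /=; apply/andP; split.
    apply/pfE; first exact: ltnW.
    split=> // y hy; apply/set0Pn; exists (nth x0 u y).
    by rewrite inE up // h2.
  apply/all_iota => r hr; have [q1 q2] := q_ks hmn hr.
  have hq : j + qT r < n by lia.
  by rewrite hq hl // -eu // mbE // h2.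
have [h4 h5] := (pfE m (ltnW h1)).1 h2; split=> // p hp.
have hjp : j + p < n by lia. have hpn : p < n by lia.
rewrite -mbE // eu //; case: (ltnP (X p) s) => hX.
  have := h5 p hp; rewrite -inter_neq0E // inter_solid // /letter hX.
  by case: (mbT _ _).
have hpm : p < m <= n by lia.
have [r [hr eq]] := nonsolid_index hpm hX.
by have := h3 r hr; rewrite hl // eq hjp.
Qed.

Lemma class_cover m c i (u : seq 'I_s) x0 : 0 < m <= n -> i < n ->
  defT (size (ksT m)) c ->
  eqwT (size (ksT m)) c i -> m <= pfT i -> size u = m ->
  (forall p, p < m -> nth x0 u p = letterT c p :> nat) ->
  odot_prefix T u /\
  (Defs.cover T u <-> forall a b, consec n (occT m c) a b -> b - a <= m).
Proof.
move=> hmn hi dc ei hm su eu; have [m0 mn] := andP hmn.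
have O j := occ_class j mn hi dc ei hm su m0 eu.
split.
  apply/(odot_prefixP x0); rewrite su //; split=> //; exists i; split=> // p hp.
  have [him _] := (pfE m (ltnW hi)).1 hm.
  have [e1 e2] := class_letter hi dc ei hm hp.
  by apply/eqP; rewrite -inter_set1 ?e1 ?eu //; lia.
have o0 : occT m c 0.
  exact: (occ0 hs2 size_ks_n X_nonempty).
split=> [hc a b [h1 h2 h3 h4]|hg x hx].
  (* An occurrence covering b - 1 starts before b, hence at a or earlier, and still has to reach b -
     1. *)
  have [j [j1 j2 /O j3]] := hc b.-1 (ltac:(lia)).
  rewrite su in j1; case: (leqP j a) => ja; first lia.
  by have := h4 j; rewrite j3; lia.
have ex : exists y, ((y == n) || occT m c y) && (x < y) by exists n; rewrite eqxx.
(* The first occurrence b beyond x, or n; its predecessor is at most x and covers it. *)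
case: (ex_minnP ex) => b /andP[b1 b2] b3.
have bn : b <= n by apply: b3; rewrite eqxx.
have hb : 0 < b <= n by lia.
have [a ab] := ex_prev o0 hb b1.
have := hg a b ab; have [a1 a2 _ _] := ab; exists a; split; last exact/O.
  by rewrite su; lia.
rewrite leqNgt; apply/negP => xa; have := b3 a; rewrite a2 orbT xa => /(_ isT); lia.
Qed.

Lemma cover_feas (u : seq 'I_s) : odot_prefix_cover T u ->
  0 < size u <= n /\ feasibleT (size u).
Proof.
move=> [op cv]; have s0 : 0 < s by lia.
(* The empty string covers no position, and T has one. *)
have u0 : 0 < size u by have [|j [j1 j2 _]] := cv 0; lia.
have x0 := Ordinal s0; have [un [i [hi hm hu]]] := (odot_prefixP x0 u0).1 op.
have [him _] := (pfE (size u) (ltnW hi)).1 hm.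
have hI p : p < size u -> interT (X p) (X (i + p)) = (nth x0 u p).+1.
  by move=> hp; apply/eqP; rewrite inter_set1 ?hu //; lia.
have di : defT (size (ksT (size u))) i.
  apply/all_iota => r hr; have [q1 q2] := q_ks un hr.
  by rewrite /dl ifT ?hI ?ltn_ord //; lia.
have eu p : p < size u -> nth x0 u p = letterT i p :> nat.
  move=> hp; have [] := class_letter hi di (eqw_refl _ _ _ _ _ _) hm hp.
  by rewrite hI // => -[].
have hmn : 0 < size u <= n by rewrite u0.
have [_ [h _]] := class_cover hmn hi di (eqw_refl _ _ _ _ _ _) hm erefl eu.
split=> //; exists i; split=> //; last exact: h.
by exists i; split=> //; apply: eqw_refl.
Qed.

End Strings.

(* Low-level register 0 holds the row length [D] of the arrays. *)
Definition solver :=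
  Seq (Assign 0 (Bin OpAdd (Bin OpMul (Const 2) (Read (Const 0))) (Const 20)))
      (cc cAll).

(** * Word size and the final assembly *)

Lemma words_large n w : 1 < n -> 80 * up_log 2 n <= w -> (2 * n + 20) ^ 16 <= 2 ^ w.
Proof.
move=> hn hw; have h1 : n <= 2 ^ up_log 2 n by apply: up_logP.
(* For n >= 2 one has 2n + 20 <= 16n and 16 <= n ^ 4. Together with the degree 16 this exponent
   gives the factor 80 = 5 * 16. *)
have h2 : 2 * n + 20 <= n ^ 5.
  have h3 : 2 ^ 4 <= n ^ 4 by rewrite leq_exp2r.
  have -> : n ^ 5 = n * n ^ 4 by rewrite expnS.
  by apply: (@leq_trans (n * 2 ^ 4)); [rewrite (_ : 2 ^ 4 = 16) //; lia|rewrite leq_mul2l h3 orbT].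
apply: (@leq_trans ((n ^ 5) ^ 16)); first by rewrite leq_exp2r.
rewrite -expnM; apply: (@leq_trans ((2 ^ up_log 2 n) ^ (5 * 16))).
  by rewrite leq_exp2r.
by rewrite -expnM leq_pexp2l // mulnC.
Qed.

Lemma encode_small s (T : seq {set 'I_s}) a : istring T -> 2 <= s <= size T ->
  nth 0 (encode T) a < 2 * size T + 20.
Proof.
move=> hT hs; have hk : size (nonsolids T) <= size T by rewrite size_filter count_size.
rewrite /encode; case: a => [|[|a]] /=; try lia.
rewrite nth_cat size_mkseq; case: (ltnP a (size T)) => ha.
  have := X_lt hs (size_ks_n T) (@X_nonsolid s T) ha.
  by rewrite nth_mkseq //; lia.
set b := flatten _; case: (ltnP (a - size T) (size b)) => hb; last by rewrite nth_default //; lia.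
have : nth 0 b (a - size T) \in b by apply: mem_nth.
by move=> /flattenP[l /mapP[Y _ ->] /mapP[x _ ->]]; case: (_ \in _); lia.
Qed.

Lemma size_encode s (T : seq {set 'I_s}) : 
  size (encode T) = 2 + size T + size (nonsolids T) * s.
Proof.
rewrite /encode /= size_cat size_mkseq; congr (_.+2); congr (_ + _).
rewrite size_flatten /shape -map_comp sumnE big_map.
rewrite (eq_bigr (fun=> s)) => [|Y _]; first by rewrite big_const_seq count_predT iter_addn_0 mulnC.
by rewrite /= size_bit_vector.
Qed.

Theorem theorem2 :
  exists (P : cmd) (c C : nat),
    forall (s n k w : nat) (T : seq {set 'I_s}),
      istring T ->
      size T = n ->
      size (nonsolids T) = k ->
      2 <= s <= n ->
      c * up_log 2 n <= w ->
      exists (t : nat) (st : state) (A : option (seq 'I_s)),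
        [/\ exec w P (init_state T) t st,
            t <= C * (n * maxn 1 k ^ 4),
            outputs st A
          & shortest_odot_prefix_cover T A].
Proof.
exists solver, 80, (162 * 200) => s n k w T hT eN eK hs hw.
subst n k; set D := 2 * size T + 20.
have hn : 1 < size T by lia.
have hD : 20 <= D by rewrite /D; lia.
have hDw : D ^ 16 <= 2 ^ w by apply: words_large.
have hkn : size (nonsolids T) <= size T by rewrite size_filter count_size.
pose h0 := Hst (fun=> 0) (nth 0 (encode T)) (fun _ _ _ => 0).
have [t1 [h1 [X1 l1 post]]] := @runs_all _ _ _ _ _ hs
  (size_ks_n T) (@X_nonsolid s T) (X_nonempty hT) D (nth 0 (encode T)) erefl
  erefl erefl (@inp_code s T) (@inp_bit s T)
  h0 (fun a _ => erefl) (fun=> erefl) (fun _ _ _ => erefl).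
pose e0 := Bin OpAdd (Bin OpMul (Const 2) (Read (Const 0))) (Const 20).
pose st0 := set_reg (init_state T) 0 (eval w e0 (init_state T)).
have wr v : v <= D -> Defs.wrap w v = v.
  by move=> hv; apply: (@wrap_small D w hD hDw v 2); rewrite // expnS expn1; nia.
have eD : eval w e0 (init_state T) = D.
  rewrite /= (wr 0) // (wr 2) ?(wr 20) //; try lia.
  have -> : nth 0 (encode T) 0 = size T by [].
  by rewrite !wr /D //; lia.
have S0 : sim D h0 st0.
  rewrite /st0 eD; split=> //.
  - by move=> x; split=> //=; lia.
  - by move=> a ha; split=> //; apply: encode_small.
  - move=> r i j hr hi hj; split; last by rewrite /=; lia.
    (* The input ends before cell D ^ 2, where the arrays begin, so the arrays start out as
       zeros. *)
    rewrite /= nth_default // size_encode /ad.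
    have : size (nonsolids T) * s <= size T * size T by apply: leq_mul => //; lia.
    move: hi hj hr; rewrite /D; nia.
have [st1 X2 [_ _ hi1 _]] := compileP hD hDw X1 wf_all S0.
(* Setting register 0 to D takes 7 units. *)
have time : 7 + t1 <= 162 * 200 * (size T * maxn 1 (size (nonsolids T)) ^ 4).
  have : 0 < size T * maxn 1 (size (nonsolids T)) ^ 4.
    by rewrite muln_gt0 expn_gt0; lia.
  by move: l1; set Z := size T * _; lia.
have X3 : exec w solver (init_state T) (7 + t1) st1.
  by apply: ExecSeq X2; exact: ExecAssign.
have hmem a : a < 2 + size T -> Defs.mem st1 a = hi h1 a.
  by move=> ha; have [|] := hi1 a; first by rewrite /D; nia.
case: post => [[m [c [hm [hc dc] [[i [hi ei hmi]] gaps] inf [o0 o1 o2]]]]|[o0 inf]].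
- have s0 : 0 < s by lia.
  pose x0 := Ordinal s0.
  have lt p : p < m -> letter s (symbol_code T) (code_bit T) c p < s.
    by move=> hp; have [] := class_letter hT hs hi dc ei hmi hp.
  pose u := mkseq (fun p => insubd x0 (letter s (symbol_code T) (code_bit T) c p)) m.
  have su : size u = m by rewrite size_mkseq.
  have eu p : p < m -> nth x0 u p = letter s (symbol_code T) (code_bit T) c p :> nat.
    by move=> hp; rewrite nth_mkseq // val_insubd lt.
  have [op cv] := class_cover hT hs hm hi dc ei hmi su eu.
  exists (7 + t1), st1, (Some u); split=> //.
  + rewrite /outputs /encode_answer /= size_map su.
    apply: (@eq_from_nth _ 0); first by rewrite size_mkseq /= size_map ?su.
    rewrite size_mkseq => p hp; rewrite nth_mkseq // hmem; last by lia.
    case: p hp => [|[|p]] hp //=.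
    by rewrite o2 // (nth_map x0) ?su // eu.
  + split; first by split=> //; apply/cv.
    move=> u' /(cover_feas hT hs) [hu' fu']; rewrite su leqNgt; apply/negP => hlt.
    by apply: (inf (size u')) => //; lia.
- exists (7 + t1), st1, None; split=> //.
  + by rewrite /outputs /mkseq /= hmem ?o0.
  + by move=> u /(cover_feas hT hs) [hu fu]; apply: (inf (size u)).
Qed.
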